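(* There exists a Cantor type set $K\subset\mathbb{R}$, obtained by deleting from $[-1,1]$ a sequence of open intervals $I_i=(a_i,b_i)$, $i\ge 1$ (so that $\min K=-1$, $\max K=1$), such that the holomorphic function $f=f_K$ on $\mathbb{C}\setminus K$ associated with $K$ (defined in the context) satisfies $$(\Gamma_f)^*_{\mathbb{C}^2}\cap\big((\mathbb{C}\setminus K)\times\mathbb{C}\big)=\Gamma_f\cup\Gamma_{-f}.$$
   Context: For a domain $D\subset\mathbb{C}^n$ let $\mathrm{PSH}(D)$ be the set of all plurisubharmonic functions on $D$. For $A\subset D$ the pluripolar hull of $A$ in $D$ is $A^*_D=\{z\in D:\ \text{for all } h\in \mathrm{PSH}(D),\ h|_A=-\infty \Rightarrow h(z)=-\infty\}$. For a function $f$ on a set $V$, $\Gamma_f=\{(z,f(z)): z\in V\}$ denotes its graph. A Cantor type set is a (nonempty) compact perfect subset $K$ of $\mathbb{R}$ with empty interior. It is of the form $K=[a_0,b_0]\setminus\bigcup_{j\ge1}I_j$, where $a_0=\min K$, $b_0=\max K$, and $I_j=(a_j,b_j)$ are open intervals in $[a_0,b_0]$ with $\overline{I_j}\cap\overline{I_k}=\emptyset$ for $j\ne k$ and $\bigcup_j I_j$ dense in $[a_0,b_0]$; the intervals are numbered so that their lengths decrease with $j$. For each $n$, the set $\{a_j,b_j: 0\le j\le n\}$ is enumerated as $\{\alpha_{jn},\beta_{jn}: 0\le j\le n\}$ with $\alpha_{0n}=a_0$, $\alpha_{jn}<\beta_{jn}<\alpha_{j+1,n}$, $\beta_{nn}=b_0$,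 so that $[a_0,b_0]\setminus\bigcup_{j=1}^n I_j=\bigcup_{j=0}^n[\alpha_{jn},\beta_{jn}]$. Put $$g_n(z)=\frac{z-a_0}{z-b_0}\prod_{j=1}^n\frac{z-b_j}{z-a_j}=\prod_{j=0}^n\frac{z-\alpha_{jn}}{z-\beta_{jn}},\qquad f_n(z)=\prod_{j=0}^n\sqrt{\frac{z-\alpha_{jn}}{z-\beta_{jn}}},$$ where $\sqrt{(z-\alpha_{jn})/(z-\beta_{jn})}$ is the holomorphic branch on $\mathbb{C}\setminus[\alpha_{jn},\beta_{jn}]$ that equals $1$ at infinity. Then $f_n^2=g_n$ and $f_n$ is holomorphic on $\mathbb{C}\setminus\bigcup_{j=0}^n[\alpha_{jn},\beta_{jn}]$. The sequence $g_n$ converges uniformly on compact subsets of $\mathbb{C}\setminus K$ to a holomorphic function $g=g_K$, and $f_K$ denotes the holomorphic function on $\mathbb{C}\setminus K$ that is the locally uniform limit of the $f_n$ (each compact subset of $\mathbb{C}\setminus K$ lies in the domain of $f_n$ for all large $n$); equivalently, $f_K$ is the holomorphic branch of $\sqrt{g}$ on $\mathbb{C}\setminus K$ with $f_K(\infty)=1$. *)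

(* Defs.v *)
From HB Require Import structures.
From mathcomp Require Import all_boot all_order all_algebra.
From mathcomp Require Import all_classical all_reals all_analysis.
From mathcomp Require Import complex.

Set Implicit Arguments.
Unset Strict Implicit.
Unset Printing Implicit Defensive.

Import Order.TTheory GRing.Theory Num.Theory.
Import numFieldNormedType.Exports.

Local Open Scope ring_scope.
Local Open Scope classical_set_scope.
Local Open Scope complex_scope.

(* The complex plane is R[i]^o: the bare type R[i] carries no topology, whereas
   its regular module R[i]^o is a normed module over R[i]. *)

(* Upper semicontinuous with values in [-oo, +oo[ on the open set D. *)
Definition usc_on (R : realType) (X : topologicalType) (D : set X)
    (u : X -> \bar R) : Prop :=
  (forall x, D x -> (u x < +oo)%E) /\
  (forall t : R, open (D `&` [set x | (u x < t%:E)%E])).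

(* For u upper semicontinuous with values in [-oo, +oo[, the integrand is bounded
   above, so the integral is well defined in [-oo, +oo[. *)
Definition circle_mean (R : realType) (u : R[i]^o -> \bar R) (c : R[i]^o)
    (r : R) : \bar R :=
  let circle (t : R) : R[i]^o := c + ((r * cos t) +i* (r * sin t)) in
  let period : set R := `[0, 2 * pi] in
  (((2 * pi)^-1)%:E *
     \int[lebesgue_measure]_(t in period) u (circle t))%E.

(* D is open in the plane; the function -oo is allowed. *)
Definition subharmonic_on (R : realType) (D : set R[i]^o)
    (u : R[i]^o -> \bar R) : Prop :=
  usc_on D u /\
  (forall (c : R[i]^o) (r : R), 0 < r ->
    (forall z : R[i]^o, `|z - c| <= r%:C -> D z) ->
    (u c <= circle_mean u c r)%E).

(* U stands for C^n, as a complex normed space (C * C for n = 2). *)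
Definition psh (R : realType) (U : normedModType R[i]) (D : set U)
    (h : U -> \bar R) : Prop :=
  usc_on D h /\
  (forall a b : U, subharmonic_on [set l : R[i]^o | D (a + l *: b)]
                                  (fun l : R[i]^o => h (a + l *: b))).

Definition pluripolar_hull (R : realType) (U : normedModType R[i])
    (D A : set U) : set U :=
  [set z | D z /\ forall h : U -> \bar R, psh D h ->
                    (forall w, A w -> h w = -oo%E) -> h z = -oo%E].

Definition graph_on (T S : Type) (V : set T) (f : T -> S) : set (T * S) :=
  [set p | V p.1 /\ p.2 = f p.1].

Definition holomorphic_on (R : realType) (V : set R[i]^o)
    (f : R[i]^o -> R[i]^o) : Prop :=
  forall z, V z -> derivable f z 1.

(* A subset of the real line, seen in the complex plane. *)
Definition in_plane (R : realType) (A : set R) : set R[i]^o :=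
  [set x%:C | x in A].

Definition cantor_type_set (R : realType) (K : set R) : Prop :=
  [/\ K !=set0, compact K, perfect_set K & interior K = set0].

(* K is [a 0, b 0] minus the gaps ]a j, b j[, j >= 1, numbered by nonincreasing
   length (distinct gaps may have equal lengths). *)
Definition cantor_gaps (R : realType) (K : set R) (a b : nat -> R) : Prop :=
  [/\ (forall j, (0 < j)%N -> [/\ a 0%N <= a j, a j < b j & b j <= b 0%N]),
      trivIset [set j | (0 < j)%N] (fun j => closure `]a j, b j[),
      `[a 0%N, b 0%N] `<=`
        closure (\bigcup_(j in [set j | (0 < j)%N]) `]a j, b j[),
      (forall j k, (0 < j)%N -> (j <= k)%N -> b k - a k <= b j - a j) &
      K = `[a 0%N, b 0%N] `\` \bigcup_(j in [set j | (0 < j)%N]) `]a j, b j[].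

(* The 2n+2 numbers a j, b j, 0 <= j <= n, in increasing order:
   alpha_{0n}, beta_{0n}, alpha_{1n}, beta_{1n}, ..., alpha_{nn}, beta_{nn}. *)
Definition endpoints (R : realType) (a b : nat -> R) (n : nat) : seq R :=
  sort <=%R ([seq a j | j <- iota 0 n.+1] ++ [seq b j | j <- iota 0 n.+1]).

Definition alpha (R : realType) (a b : nat -> R) (n j : nat) : R :=
  (endpoints a b n)`_(2 * j).

Definition beta (R : realType) (a b : nat -> R) (n j : nat) : R :=
  (endpoints a b n)`_(2 * j).+1.

(* s is, off the segment [p, q], the holomorphic branch of
   sqrt ((z - p) / (z - q)) that equals 1 at infinity; the last clause is the
   limit of s at infinity, read in the chart w = 1/z. *)
Definition is_sqrt_branch (R : realType) (p q : R) (s : R[i]^o -> R[i]^o) :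
    Prop :=
  [/\ holomorphic_on (~` in_plane `[p, q]) s,
      (forall z, (~` in_plane `[p, q]) z ->
         s z ^+ 2 = (z - p%:C) / (z - q%:C)) &
      s w^-1 @[w --> (0 : R[i]^o)^'] --> (1 : R[i]^o)].

(* F is f_n.  It is determined only off the union of the segments
   [alpha_{jn}, beta_{jn}]. *)
Definition is_f_n (R : realType) (a b : nat -> R) (n : nat)
    (F : R[i]^o -> R[i]^o) : Prop :=
  exists s : nat -> R[i]^o -> R[i]^o,
    (forall j, (j <= n)%N ->
       is_sqrt_branch (alpha a b n j) (beta a b n j) (s j)) /\
    (forall z, F z = \prod_(j < n.+1) s j z).

(* f is f_K; it is determined only on the complement of K. *)
Definition is_f_K (R : realType) (K : set R) (a b : nat -> R)
    (f : R[i]^o -> R[i]^o) : Prop :=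
  holomorphic_on (~` in_plane K) f /\
  exists F : nat -> R[i]^o -> R[i]^o,
    (forall n, is_f_n a b n (F n)) /\
    (forall L : set R[i]^o, compact L -> L `<=` ~` in_plane K ->
       {uniform L, F @ \oo --> f}).

(* Main.v *)
(* The gaps have lengths l_j shrinking doubly exponentially, so that f_n tends to f
   doubly exponentially fast, while f_n^2 = P_n / Q_n has degree n + 1 only.  For
   p_n(z, w) = w^2 Q_n(z) - P_n(z) and d_n = exp(-4 8^n), the series with terms
   8^-n ln(|p_n|^2 + d_n) / 2 - 2^-n is therefore plurisubharmonic, equal to -oo on
   the graph of f, and finite at the points (z, w), z off K, with w^2 <> f(z)^2.

   Conversely, let h be psh with h = -oo on the graph of f.  With T a square root of
   (1 + z) / (1 - z), the function G_n = - i T prod_(j <= n) sqrt((z - b_j) / (z - a_j))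
   equals f_n in the upper half plane and - f_n in the lower one, and it is
   holomorphic across ]-1, 1[ outside discs of radii r_j >= sqrt(l_j) around the
   a_j.  Since sum_j 1 / ln(1 / r_j) is small, these discs have a small harmonic
   measure: a two-constants estimate for h along the graph of G_n, on an annulus
   whose inner circle lies in the upper half plane, where h(z, f z) = -oo, gives
   h(z, - f z) = -oo near - i / 8, and then, by the same estimate on plain annuli,
   on all of the complement of K. *)
Require Import Defs.
From mathcomp Require Import all_boot all_order all_algebra.
From mathcomp Require Import all_classical all_reals all_analysis.
From mathcomp Require Import measurable_realfun.
From mathcomp Require Import complex ring lra zify.
Set Implicit Arguments.
Unset Strict Implicit.
Unset Printing Implicit Defensive.
Import Order.TTheory GRing.Theory Num.Theory.
Import numFieldNormedType.Exports.
Local Open Scope ring_scope.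
Local Open Scope classical_set_scope.
Local Open Scope complex_scope.
Local Notation Re := complex.Re.
Local Notation Im := complex.Im.

(** * Averages over circles *)

(** Both inclusions want short gaps, and lengths of the form exp(-2 A 8^j) serve both: they beat the
    degree growth of p_n, and what a disc costs in the harmonic measure is 1 / ln (1 / r_j), not
    r_j. The obstacle in the crossing is that upper semicontinuity works one way only: knowing that
    h(w, G_n w) tends to -oo as G_n w tends to - f w says nothing about h(w, - f w). Therefore G_n
    is shifted by a constant so that its value at the point under study is exactly - f w for every
    n. On the inner circle this shift is harmless: there h has poles, and upper semicontinuity keeps
    h very negative near them. The estimate also needs one upper bound of h for all n, hence a bound
    of G_n uniform in n. This is the reason for r_j >= sqrt(l_j): outside its disc the factor of a
    gap differs from 1 by at most l_j / r_j <= r_j, and the product of these factors stays below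
    e^2. *)

Definition circle_avg (R : realType) (phi : R -> R) : R :=
  (2 * pi)^-1 * \int[lebesgue_measure]_(t in `[0, 2 * pi]) phi t.

Lemma continuous_itv_integrable (R : realType) (phi : R -> R) (a b : R) :
  continuous phi -> lebesgue_measure.-integrable `[a, b] (EFin \o phi).
Proof.
move=> cphi; apply: continuous_compact_integrable; first exact: segment_compact.
exact: continuous_subspaceT.
Qed.

Lemma two_pi_gt0 (R : realType) : 0 < 2 * pi :> R.
Proof. by rewrite mulr_gt0 ?pi_gt0. Qed.

Lemma circle_avgE (R : realType) (phi : R -> R) : continuous phi ->
  (((2 * pi)^-1)%:E * \int[lebesgue_measure]_(t in (`[0%R, (2 * pi)%R] : set R)) (phi t)%:E)%E
  = (circle_avg phi)%:E.
Proof.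
move=> cphi; rewrite /circle_avg EFinM /Rintegral fineK //.
by apply: integrable_fin_num => //; exact: continuous_itv_integrable.
Qed.

Lemma circle_avgD (R : realType) (phi psi : R -> R) :
  continuous phi -> continuous psi ->
  circle_avg (fun t => phi t + psi t) = circle_avg phi + circle_avg psi.
Proof.
move=> cphi cpsi; rewrite /circle_avg -mulrDr; congr (_ * _).
by apply: RintegralD; [|exact: continuous_itv_integrable..].
Qed.

Lemma circle_avgZ (R : realType) (k : R) (phi : R -> R) :
  continuous phi -> circle_avg (fun t => k * phi t) = k * circle_avg phi.
Proof.
move=> cphi; rewrite /circle_avg [RHS]mulrCA; congr (_ * _).
by apply: RintegralZl; [|exact: continuous_itv_integrable].
Qed.

Lemma circle_avg_le (R : realType) (phi psi : R -> R) :
  continuous phi -> continuous psi -> (forall t, phi t <= psi t) ->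
  circle_avg phi <= circle_avg psi.
Proof.
move=> cphi cpsi h; rewrite ler_pM2l ?invr_gt0 ?two_pi_gt0 //.
by apply: le_Rintegral; [|exact: continuous_itv_integrable..|].
Qed.

Lemma circle_avg_cst (R : realType) (k : R) : circle_avg (fun=> k) = k.
Proof.
rewrite /circle_avg Rintegral_cst //= lebesgue_measure_itv /= lte_fin two_pi_gt0.
by rewrite sube0 /= mulrCA mulVf ?mulr1 ?gt_eqF ?two_pi_gt0.
Qed.

Lemma eq_circle_avg (R : realType) (phi psi : R -> R) :
  phi =1 psi -> circle_avg phi = circle_avg psi.
Proof. by move=> /funext ->. Qed.

Lemma circle_avg_sum (R : realType) (I : Type) (s : seq I) (F : I -> R -> R) :
  (forall i, continuous (F i)) ->
  circle_avg (fun t => \sum_(i <- s) F i t) = \sum_(i <- s) circle_avg (F i).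
Proof.
move=> cF; elim: s => [|i s IH].
  rewrite big_nil (@eq_circle_avg _ _ (fun=> 0)) ?circle_avg_cst // => t.
  by rewrite big_nil.
rewrite big_cons -IH -circle_avgD //.
  by apply: eq_circle_avg => t; rewrite big_cons.
elim: s {IH} => [|j s IH].
  by under eq_fun do rewrite big_nil; exact: cst_continuous.
under eq_fun do rewrite big_cons; move=> t; apply: continuousD; first exact: cF.
exact: IH.
Qed.

Lemma circle_avg_deriv (R : realType) (Phi phi : R -> R) : continuous phi ->
  (forall t : R, is_derive t 1 Phi (phi t)) -> Phi (2 * pi) = Phi 0 ->
  circle_avg phi = 0.
Proof.
move=> cphi dPhi e; rewrite /circle_avg /Rintegral (@continuous_FTC2 _ _ Phi).
- by rewrite e subee //= mulr0.
- exact: two_pi_gt0.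
- exact: continuous_subspaceT.
- have cP : continuous Phi.
    by move=> t; apply/differentiable_continuous/derivable1_diffP; case: (dPhi t).
  split; first by move=> t _; case: (dPhi t).
    exact: cvg_at_right_filter (cP _).
  exact: cvg_at_left_filter (cP _).
- by move=> t _; rewrite derive1E; case: (dPhi t).
Qed.

Lemma circle_avg_cos (R : realType) : circle_avg (@cos R) = 0.
Proof.
apply: (@circle_avg_deriv _ (@sin R)); first exact: continuous_cos.
by rewrite mulr_natl sin2pi sin0.
Qed.

Lemma circle_avg_sin (R : realType) : circle_avg (@sin R) = 0.
Proof.
apply: (@circle_avg_deriv _ (fun t => - cos t)); first exact: continuous_sin.
  by move=> t; apply: is_derive_eq; rewrite opprK.
by rewrite mulr_natl cos2pi cos0.
Qed.

Lemma affine_continuous (R : realType) (c d : R) : continuous (fun t : R => c * t + d).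
Proof.
move=> t; apply: continuousD; last exact: cst_continuous.
by apply: continuousM; [exact: cst_continuous|exact: cvg_id].
Qed.

Lemma affine_deriv (R : realType) (c d : R) (t : R) :
  is_derive t (1 : R) (fun t : R => c * t + d) c.
Proof. by apply: is_derive_eq; rewrite ?scaler0 ?addr0 /GRing.scale /= mulr1. Qed.

Lemma Rintegral_affine (R : realType) (G : R -> R) (c d a b : R) :
  0 < c -> a <= b -> continuous G ->
  \int[lebesgue_measure]_(t in `[c * a + d, c * b + d]) G t
  = c * \int[lebesgue_measure]_(t in `[a, b]) G (c * t + d).
Proof.
move=> c0 ab cG; pose F t := c * t + d.
have F' : F^`() = fun=> c.
  by apply/funext => t; rewrite derive1E; case: (affine_deriv c d t).
have cF : continuous F by exact: affine_continuous.
rewrite -RintegralZl //; last first.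
  apply: (@continuous_itv_integrable _ (G \o F)) => t.
  by apply: continuous_comp; [exact: cF|exact: cG].
rewrite /Rintegral.
rewrite (@integration_by_substitution_increasing _ F) //.
- congr fine; apply: eq_integral => t _.
  by rewrite F' /= mulrC.
- by move=> x y _ _ xy; rewrite /F ltrD2r ltr_pM2l.
- by rewrite F' => t _; exact: cst_continuous.
- by rewrite F'; exact: is_cvg_cst.
- by rewrite F'; exact: is_cvg_cst.
- split; first by move=> t _; case: (affine_deriv c d t).
    exact: cvg_at_right_filter (cF _).
  exact: cvg_at_left_filter (cF _).
- exact: continuous_subspaceT.
Qed.

Lemma halving_le0 (R : realType) (a B : R) :
  (forall k, a <= B * 2^-1 ^+ k) -> a <= 0.
Proof.
move=> h; rewrite leNgt; apply/negP => a0.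
have B0 : 0 < B by have := h 0%N; rewrite expr0 mulr1; exact: lt_le_trans.
have := archi_boundP (ltW (divr_gt0 B0 a0)); set k := Num.bound _ => kB.
have : a * 2 ^+ k <= B.
  by have := h k; rewrite exprVn ler_pdivlMr // exprn_gt0.
apply/negP; rewrite -ltNge mulrC -ltr_pdivrMr //.
by apply: lt_trans kB _; rewrite -natrX ltr_nat ltn_expl.
Qed.

Section log_circle.
Variable R : realType.
Implicit Types x y s t : R.

(** With w = x + i y, [u] is the real part of w e^(it) and [psi] is ln |1 - w e^(it)|^2, whose mean
    over the circle is shown to vanish for |w| < 1 by real integrals alone. *)
Let u x y (t : R) := x * cos t - y * sin t.
Let psi x y (t : R) := ln (1 + (x ^+ 2 + y ^+ 2) - 2 * u x y t).

Lemma circle_lin_continuous x y : continuous (fun t : R => x * cos t - y * sin t).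
Proof.
move=> t; apply: cvgB; apply: cvgM;
  by [exact: cvg_cst|exact: continuous_cos|exact: continuous_sin].
Qed.

Let u_sq x y t : (u x y t) ^+ 2 <= x ^+ 2 + y ^+ 2.
Proof.
rewrite -subr_ge0 /u.
have -> : x ^+ 2 + y ^+ 2 - (x * cos t - y * sin t) ^+ 2
  = (x * sin t + y * cos t) ^+ 2.
  by have e := sin2cos2 t; ring: e.
exact: sqr_ge0.
Qed.

Let arg_ge x y s t : 0 <= s < 1 -> x ^+ 2 + y ^+ 2 <= s ^+ 2 ->
  (1 - s) ^+ 2 <= 1 + (x ^+ 2 + y ^+ 2) - 2 * u x y t <= 4.
Proof.
move=> /andP[s0 s1] qs; have := u_sq x y t.
have : `|u x y t| <= s.
  by rewrite -(@ler_pXn2r _ 2) ?nnegrE // -normrX ger0_norm ?sqr_ge0 //;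
     exact: le_trans (u_sq x y t) qs.
by rewrite ler_norml => /andP[u1 u2] uq; apply/andP; split; nra.
Qed.

Lemma continuous_ln_comp (f : R -> R) : continuous f -> (forall t, 0 < f t) ->
  continuous (fun t => ln (f t)).
Proof.
by move=> cf f0 t; apply: continuous_comp; [exact: cf|exact: continuous_ln].
Qed.

Let psi_continuous x y s : 0 <= s < 1 -> x ^+ 2 + y ^+ 2 <= s ^+ 2 ->
  continuous (psi x y).
Proof.
move=> s01 qs; apply: continuous_ln_comp => t.
  apply: cvgB; first exact: cvg_cst.
  apply: cvgM; first exact: cvg_cst.
  exact: circle_lin_continuous.
have /andP[h _] := arg_ge t s01 qs; apply: lt_le_trans h.
by case/andP: s01 => _ s1; rewrite exprn_gt0 // subr_gt0.
Qed.

Let psi_bound x y s t : 0 <= s < 1 -> x ^+ 2 + y ^+ 2 <= s ^+ 2 ->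
  `|psi x y t| <= ln 4 - 2 * ln (1 - s).
Proof.
move=> s01 qs; have /andP[h1 h2] := arg_ge t s01 qs.
case/andP: s01 => s0 s1; have s10 : 0 < 1 - s by rewrite subr_gt0.
have h0 : 0 < 1 + (x ^+ 2 + y ^+ 2) - 2 * u x y t.
  by apply: lt_le_trans h1; rewrite exprn_gt0.
have l4 : 0 <= ln 4 :> R by rewrite ln_ge0 // ler1n.
have ls : ln (1 - s) <= 0 by rewrite ln_le0 // lerBlDr lerDl.
have e1 : psi x y t <= ln 4 by rewrite ler_ln // posrE.
have e2 : 2 * ln (1 - s) <= psi x y t.
  by rewrite mulr_natl -lnXn // ler_ln // posrE exprn_gt0.
by rewrite ler_norml; apply/andP; split; lra.
Qed.

Let J x y := \int[lebesgue_measure]_(t in `[0, 2 * pi]) psi x y t.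

(* The values of 1 - w at w and -w multiply to 1 - w^2; iterated, this halves the
   integral [J] of a function that stays bounded, so that [J] vanishes. *)
Let J_double x y s : 0 <= s < 1 -> x ^+ 2 + y ^+ 2 <= s ^+ 2 ->
  J x y = 2^-1 * J (x ^+ 2 - y ^+ 2) (2 * x * y).
Proof.
move=> s01 qs.
have qs2 : (x ^+ 2 - y ^+ 2) ^+ 2 + (2 * x * y) ^+ 2 <= s ^+ 2.
  have -> : (x ^+ 2 - y ^+ 2) ^+ 2 + (2 * x * y) ^+ 2 = (x ^+ 2 + y ^+ 2) ^+ 2 by ring.
  case/andP: s01 => s0 s1.
  have q0 : 0 <= x ^+ 2 + y ^+ 2 by rewrite addr_ge0 ?sqr_ge0.
  by apply: (le_trans _ qs); rewrite expr2 ler_piMl // (le_trans qs) // exprn_ile1 // ltW.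
have c1 := psi_continuous s01 qs; have c2 := psi_continuous s01 qs2.
have pi0 := @pi_gt0 R.
have split_J : J x y = \int[lebesgue_measure]_(t in `[0, pi]) psi x y t
   + \int[lebesgue_measure]_(t in `[1 * 0 + pi, 1 * pi + pi]) psi x y t.
  have h := @Rintegral_itvB R (psi x y) (BLeft 0) (BRight (2 * pi)) pi
     (continuous_itv_integrable _ _ c1).
  rewrite -[LHS](subrK (\int[lebesgue_measure]_(t in `[0, pi]) psi x y t)).
  rewrite addrC; congr (_ + _); rewrite /J h ?bnd_simp; [|by lra|by lra].
  rewrite Rintegral_itv_obnd_cbnd; last first.
    apply: (integrableS _ _ _ (continuous_itv_integrable 0 (2 * pi) c1)) => //.
    by apply: subset_itv; rewrite bnd_simp //; lra.
  have -> : 1 * 0 + pi = pi :> R by ring.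
  have -> : 1 * pi + pi = 2 * pi :> R by ring.
  reflexivity.
rewrite split_J Rintegral_affine ?ler0n //; last by lra.
rewrite mul1r -RintegralD //; last 2 first.
- exact: continuous_itv_integrable.
- apply: (@continuous_itv_integrable _ (psi x y \o (fun t => 1 * t + pi))) => t.
  by apply: continuous_comp; [exact: affine_continuous|exact: c1].
rewrite /J; have -> : `[0, 2 * pi] = `[2 * 0 + 0, 2 * pi + 0] :> set R.
  by rewrite mulr0 !addr0.
rewrite Rintegral_affine //; last by lra.
rewrite mulrA mulVf ?mul1r //.
apply: eq_Rintegral => t _.
have /andP[h1 _] := arg_ge t s01 qs; have /andP[h2 _] := arg_ge (1 * t + pi) s01 qs.
case/andP: s01 => s0 s1; have s10 : 0 < (1 - s) ^+ 2 by rewrite exprn_gt0 // subr_gt0.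
rewrite /psi -lnM ?posrE; [|exact: lt_le_trans h1|exact: lt_le_trans h2].
congr ln; rewrite /u mul1r addr0 cosDpi sinDpi (mulr_natl t 2) cos_mulr2n sin_mulr2n.
by have e := sin2cos2 t; ring: e.
Qed.

Let J0 x y : x ^+ 2 + y ^+ 2 < 1 -> J x y = 0.
Proof.
move=> q1; pose s := Num.sqrt (x ^+ 2 + y ^+ 2).
have q0 : 0 <= x ^+ 2 + y ^+ 2 by rewrite addr_ge0 ?sqr_ge0.
have qs : x ^+ 2 + y ^+ 2 <= s ^+ 2 by rewrite sqr_sqrtr.
have s01 : 0 <= s < 1.
  by rewrite sqrtr_ge0 /= -(ltr_pXn2r (n := 2)) ?nnegrE ?sqrtr_ge0 // sqr_sqrtr // expr1n.
pose B := (ln 4 - 2 * ln (1 - s)) * (2 * pi).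
(* Quantified over the whole disc of radius s, because the doubling passes from w to w^2, which
   again has modulus at most s. *)
have bnd k : forall x' y', x' ^+ 2 + y' ^+ 2 <= s ^+ 2 -> `|J x' y'| <= B * 2^-1 ^+ k.
  clearbody s; elim: k => [|k IH] {x y q0 q1 qs} x y qs.
    have := psi_continuous s01 qs => c1.
    rewrite expr0 mulr1 /J.
    apply: le_trans (_ : \int[lebesgue_measure]_(t in `[0, 2 * pi]) `|psi x y t| <= _).
      by apply: le_normr_Rintegral => //; exact: continuous_itv_integrable.
    apply: le_trans (_ : \int[lebesgue_measure]_(t in `[0, 2 * pi]) (ln 4 - 2 * ln (1 - s)) <= _).
      apply: le_Rintegral => //.
      - apply: (@continuous_itv_integrable _ (fun t => `|psi x y t|)) => t.
        by apply: continuous_comp; [exact: c1|exact: norm_continuous].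
      - by apply: continuous_itv_integrable; exact: cst_continuous.
      - by move=> t _; exact: psi_bound.
    rewrite Rintegral_cst //= lebesgue_measure_itv /= lte_fin two_pi_gt0 sube0 /=.
    by rewrite /B.
  rewrite (J_double s01 qs) normrM gtr0_norm ?invr_gt0 // [_ ^+ k.+1]exprS [leRHS]mulrCA.
  rewrite ler_pM2l ?invr_gt0 //; apply: IH.
  have -> : (x ^+ 2 - y ^+ 2) ^+ 2 + (2 * x * y) ^+ 2 = (x ^+ 2 + y ^+ 2) ^+ 2 by ring.
  have q0 : 0 <= x ^+ 2 + y ^+ 2 by rewrite addr_ge0 ?sqr_ge0.
  case/andP: s01 => s0 s1.
  by apply: (le_trans _ qs); rewrite expr2 ler_piMl // (le_trans qs) // exprn_ile1 // ltW.
apply/eqP; rewrite -normr_le0; apply: (@halving_le0 _ _ B) => k.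
exact: bnd.
Qed.

(** The argument of the logarithm is |C - w e^(it)|^2 / C with w = x + i y, so the mean is ln C plus
    the vanishing mean of ln |1 - (w / C) e^(it)|^2. *)
Lemma circle_avg_ln (C x y : R) : 0 < C -> x ^+ 2 + y ^+ 2 < C ^+ 2 ->
  circle_avg (fun t => ln (C + (x ^+ 2 + y ^+ 2) / C - 2 * (x * cos t - y * sin t)))
  = ln C.
Proof.
move=> C0 qC.
have Cn0 : C != 0 by rewrite gt_eqF.
have q1 : (x / C) ^+ 2 + (y / C) ^+ 2 < 1.
  by rewrite !expr_div_n -mulrDl ltr_pdivrMr ?exprn_gt0 // mul1r.
have q0 : 0 <= (x / C) ^+ 2 + (y / C) ^+ 2 by rewrite addr_ge0 ?sqr_ge0.
pose s := Num.sqrt ((x / C) ^+ 2 + (y / C) ^+ 2).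
have qs : (x / C) ^+ 2 + (y / C) ^+ 2 <= s ^+ 2 by rewrite sqr_sqrtr.
have s01 : 0 <= s < 1.
  by rewrite sqrtr_ge0 /= -(ltr_pXn2r (n := 2)) ?nnegrE ?sqrtr_ge0 // sqr_sqrtr // expr1n.
have c1 := psi_continuous s01 qs.
rewrite (@eq_circle_avg _ _ (fun t => ln C + psi (x / C) (y / C) t)).
  rewrite circle_avgD //; last by exact: cst_continuous.
  by rewrite circle_avg_cst /circle_avg -/(J _ _) (J0 q1) mulr0 addr0.
move=> t; have /andP[h _] := arg_ge t s01 qs.
case/andP: s01 => s0 s1; have s10 : 0 < (1 - s) ^+ 2 by rewrite exprn_gt0 // subr_gt0.
rewrite /psi -lnM ?posrE //; last exact: lt_le_trans h.
by congr ln; rewrite /u; field.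
Qed.

(** An inequality between [A] and C + |w|^2 / C lets the user pick a convenient [C] instead of
    solving the quadratic equation for the exact mean. *)
Lemma circle_avg_ln_ge (A C x y : R) : 0 < C -> x ^+ 2 + y ^+ 2 < C ^+ 2 ->
  C + (x ^+ 2 + y ^+ 2) / C <= A ->
  ln C <= circle_avg (fun t => ln (A - 2 * (x * cos t - y * sin t))).
Proof.
move=> C0 qC CA; rewrite -(circle_avg_ln C0 qC).
have pos t : 0 < C + (x ^+ 2 + y ^+ 2) / C - 2 * (x * cos t - y * sin t).
  have := u_sq x y t; rewrite /u; set v := _ - _ => vq.
  have : 0 < (C - v) ^+ 2 / C.
    rewrite divr_gt0 // exprn_even_gt0 //= subr_eq0; apply: contraTneq vq => <-.
    by rewrite -ltNge.
  move/lt_le_trans; apply; rewrite ler_pdivrMr // !mulrBl mulrDl divfK ?gt_eqF //.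
  by nra.
have cont D : continuous (fun t => D - 2 * (x * cos t - y * sin t)).
  move=> t; apply: cvgB; first exact: cvg_cst.
  by apply: cvgM; [exact: cvg_cst|exact: circle_lin_continuous].
have posA t : 0 < A - 2 * (x * cos t - y * sin t).
  by apply: lt_le_trans (pos t) _; rewrite lerD2r.
apply: circle_avg_le; [exact: continuous_ln_comp..|move=> t].
by rewrite ler_ln ?posrE // lerD2r.
Qed.

End log_circle.

(** * Circle means of functions with values in the extended reals *)

Section ereal_circle.
Variable R : realType.
Implicit Types (phi : R -> R) (u : R -> \bar R).
Let mu := @lebesgue_measure R.
Let per : set R := `[0, 2 * pi].

Let mper : measurable (per : set (measurableTypeR R)). Proof. exact: measurable_itv. Qed.

Lemma continuous_meas (f : R -> R) (D : set (measurableTypeR R)) :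
  measurable D -> continuous f ->
  measurable_fun D (fun t : measurableTypeR R => (f t)%:E).
Proof.
move=> mD cf; apply/measurable_EFinP/measurable_funTS.
exact: continuous_measurable_fun.
Qed.

(** The integral of a nonnegative function is a supremum over the simple functions below it, so
    monotonicity needs no measurability; hence [circle_mean_le] asks none of [u]. *)
Lemma ge0_le_integral_nomeas (u1 u2 : R -> \bar R) (D : set R) :
  (forall t, D t -> (0 <= u1 t)%E) -> (forall t, D t -> (u1 t <= u2 t)%E) ->
  (\int[mu]_(t in D) u1 t <= \int[mu]_(t in D) u2 t)%E.
Proof.
move=> u10 u12.
have u20 t : D t -> (0 <= u2 t)%E by move=> Dt; apply: le_trans (u10 _ Dt) (u12 _ Dt).
rewrite !ge0_integralE //; apply: ereal_sup_le => _ [h /= hh <-].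
exists h => //= t; apply: le_trans (hh t) _.
by rewrite /patch; case: ifPn => // /set_mem; exact: u12.
Qed.

Lemma circle_mean_le (u : R -> \bar R) (phi : R -> R) : continuous phi ->
  (forall t, (u t <= (phi t)%:E)%E) ->
  (((2 * pi)^-1)%:E * \int[mu]_(t in per) u t <= (circle_avg phi)%:E)%E.
Proof.
move=> cphi uphi; rewrite -(circle_avgE cphi).
apply: lee_wpmul2l; first by rewrite lee_fin invr_ge0 ltW // two_pi_gt0.
rewrite [leLHS]integralE [leRHS]integralE.
apply: leeB; apply: ge0_le_integral_nomeas => t _; rewrite ?funepos_ge0 ?funeneg_ge0 //.
  by rewrite !funeposE ge_max !le_max uphi lexx orbT.
by rewrite !funenegE ge_max !le_max leeN2 uphi lexx orbT.
Qed.

(** Monotone convergence is applied to the nonnegative functions v 0 - v k. The common lower bound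
    [m] of the means makes their limit integrable, so that the difference can be integrated term by
    term. *)
Lemma circle_mean_inf (v : nat -> R -> R) (u : R -> \bar R) (m : R) :
  (forall k, continuous (v k)) -> (forall k t, v k.+1 t <= v k t) ->
  (forall t, u t = ereal_inf (range (fun k => (v k t)%:E))) ->
  (forall k, m <= circle_avg (v k)) ->
  (m%:E <= ((2 * pi)^-1)%:E * \int[mu]_(t in per) u t)%E.
Proof.
move=> cv dv uE mv.
have dec t : {homo (fun k => v k t) : i j / (i <= j)%N >-> j <= i}.
  by apply/nonincreasing_seqP => k; exact: dv.
have cu t : (v k t)%:E @[k --> \oo] --> u t.
  rewrite uE; apply: ereal_nonincreasing_cvgn => i j ij.
  by rewrite lee_fin; exact: dec.
pose g k t := (v 0%N t - v k t)%:E.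
have cg k : continuous (fun t => v 0%N t - v k t).
  by move=> t; apply: cvgB; exact: cv.
pose G t := limn (g^~ t).
have g0 k t : (0%R <= g k t)%E by rewrite lee_fin subr_ge0; exact: dec.
have GE t : G t = ((v 0%N t)%:E - u t)%E.
  apply/cvg_lim => //; rewrite /g; under eq_fun do rewrite EFinB.
  apply: cvgeB; [|exact: cvg_cst|exact: cu].
  by rewrite fin_num_adde_defr.
have mg k : measurable_fun per (g k) by exact: continuous_meas.
have iG : (\int[mu]_(t in per) G t <= ((2 * pi) * (circle_avg (v 0%N) - m))%:E)%E.
  rewrite /G monotone_convergence //; last first.
    by move=> t _ i j ij; rewrite lee_fin lerD2l lerN2; exact: dec.
  apply: lime_le.
    apply: ereal_nondecreasing_is_cvgn => i j ij.
    apply: ge0_le_integral_nomeas => t _; first exact: g0.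
    by rewrite lee_fin lerD2l lerN2; exact: dec.
  apply: nearW => k.
  have h : (((2 * pi)^-1)%:E * \int[mu]_(t in per) g k t)%E
           = (circle_avg (v 0%N) - circle_avg (v k))%:E.
    rewrite circle_avgE //; congr EFin.
    have cNv : continuous (fun t => -1 * v k t).
      by move=> t; apply: cvgM; [exact: cvg_cst|exact: cv].
    rewrite -(mulN1r (circle_avg (v k))) -circle_avgZ // -circle_avgD //.
    by apply: eq_circle_avg => t; rewrite mulN1r.
  have -> : (\int[mu]_(t in per) g k t
      = (2 * pi)%:E * (((2 * pi)^-1)%:E * \int[mu]_(t in per) g k t))%E.
    by rewrite muleA -EFinM mulfV ?mul1e // gt_eqF // two_pi_gt0.
  rewrite h -EFinM lee_fin ler_pM2l ?two_pi_gt0 // lerD2l lerN2.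
  exact: mv.
have mG : measurable_fun per G.
  apply: (emeasurable_fun_cvg g) => // t _.
  rewrite GE /g; under eq_fun do rewrite EFinB.
  apply: cvgeB; [|exact: cvg_cst|exact: cu].
  by rewrite fin_num_adde_defr.
have G0 t : (0 <= G t)%E.
  rewrite GE sube_ge0; last by rewrite orbT.
  rewrite uE; apply: ereal_inf_lbound; exists 0%N => //.
have intG : mu.-integrable per G.
  apply/integrableP; split=> //.
  under eq_integral do rewrite gee0_abs //.
  exact: le_lt_trans iG (ltry _).
have uG t : u t = ((v 0%N t)%:E - G t)%E.
  by rewrite GE oppeB ?fin_num_adde_defr // addeA subee // add0e.
under eq_integral do rewrite uG.
rewrite integralB //; last exact: continuous_itv_integrable.
rewrite muleBr ?fin_num_adde_defl //; last first.
  by rewrite fin_numN; exact: integrable_fin_num.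
rewrite circle_avgE //.
have : (((2 * pi)^-1)%:E * \int[mu]_(t in per) G t
        <= (circle_avg (v 0%N) - m)%:E)%E.
  apply: (@le_trans _ _ (((2 * pi)^-1)%:E * ((2 * pi) * (circle_avg (v 0%N) - m))%:E)%E).
    by apply: lee_wpmul2l => //; rewrite lee_fin invr_ge0 ltW // two_pi_gt0.
  by rewrite -EFinM mulrA mulVf ?mul1r // gt_eqF // two_pi_gt0.
have : (((2 * pi)^-1)%:E * \int[mu]_(t in per) G t)%E \is a fin_num.
  by rewrite fin_numM // integrable_fin_num.
move=> /fineK <-; rewrite -EFinB !lee_fin; lra.
Qed.

(** The limit is taken through the infimum of the v k, so approximation at each point separately
    suffices and no uniform convergence is required. *)
Lemma circle_avg_limit (v : nat -> R -> R) (phi : R -> R) (m : R) :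
  (forall k, continuous (v k)) -> (forall k t, v k.+1 t <= v k t) ->
  continuous phi ->
  (forall t e, 0 < e -> exists k, v k t <= phi t + e) ->
  (forall k, m <= circle_avg (v k)) -> m <= circle_avg phi.
Proof.
move=> cv dv cphi lim mv.
have h := circle_mean_inf cv dv (fun t => erefl) mv.
rewrite -lee_fin; apply: le_trans h _; apply: circle_mean_le => // t.
apply/lee_addgt0Pr => e e0; have [k vk] := lim t e e0.
apply: (@le_trans _ _ (v k t)%:E); last by rewrite -EFinD lee_fin.
by apply: ereal_inf_lbound; exists k.
Qed.

End ereal_circle.

(** * The modulus and the topology of the complex plane *)

Section modulus.
Variable R : realType.
Implicit Types z w : R[i].

Definition cabs z : R := Num.sqrt (Re z ^+ 2 + Im z ^+ 2).

Lemma normE z : `|z| = (cabs z)%:C.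
Proof. by rewrite normc_def. Qed.

Lemma cabs_ge0 z : 0 <= cabs z. Proof. exact: sqrtr_ge0. Qed.

Lemma cabs_sqr z : cabs z ^+ 2 = Re z ^+ 2 + Im z ^+ 2.
Proof. by rewrite sqr_sqrtr // addr_ge0 ?sqr_ge0. Qed.

Lemma cabsM z w : cabs (z * w) = cabs z * cabs w.
Proof. by apply: complexI; rewrite rmorphM /= -!normE normrM. Qed.

Lemma cabsV z : cabs z^-1 = (cabs z)^-1.
Proof. by apply: complexI; rewrite fmorphV /= -!normE normfV. Qed.

Lemma cabs_div z w : cabs (z / w) = cabs z / cabs w.
Proof. by rewrite cabsM cabsV. Qed.

Lemma cabsD z w : cabs (z + w) <= cabs z + cabs w.
Proof. by rewrite -lecR rmorphD /= -!normE ler_normD. Qed.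

Lemma cabsN z : cabs (- z) = cabs z.
Proof. by apply: complexI; rewrite -!normE normrN. Qed.

Lemma cabsB z w : cabs (z - w) = cabs (w - z).
Proof. by rewrite -cabsN opprB. Qed.

Lemma cabs0 : cabs 0 = 0.
Proof. by apply: complexI; rewrite -normE normr0. Qed.

Lemma cabs1 : cabs 1 = 1.
Proof. by apply: complexI; rewrite -normE normr1. Qed.

Lemma cabs_eq0 z : (cabs z == 0) = (z == 0).
Proof. by rewrite -(inj_eq (@complexI R)) -normE normr_eq0. Qed.

Lemma cabs_gt0 z : (0 < cabs z) = (z != 0).
Proof. by rewrite lt_neqAle cabs_ge0 andbT eq_sym cabs_eq0. Qed.

Lemma cabsX z n : cabs (z ^+ n) = cabs z ^+ n.
Proof. by elim: n => [|n IH]; rewrite ?cabs1 // !exprS cabsM IH. Qed.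

Lemma cabs_prod (I : Type) (s : seq I) (P : pred I) (F : I -> R[i]) :
  cabs (\prod_(i <- s | P i) F i) = \prod_(i <- s | P i) cabs (F i).
Proof. by apply: (big_morph cabs) => [z w|]; rewrite ?cabsM ?cabs1. Qed.

Lemma cabs_real (x : R) : cabs x%:C = `|x|.
Proof. by rewrite /cabs /= expr0n /= addr0 sqrtr_sqr. Qed.

Lemma cabs_le_sqr z (r : R) : 0 <= r -> (cabs z <= r) = (Re z ^+ 2 + Im z ^+ 2 <= r ^+ 2).
Proof. by move=> r0; rewrite -cabs_sqr ler_pXn2r // nnegrE cabs_ge0. Qed.

Lemma Re_le_cabs z : `|Re z| <= cabs z.
Proof. by rewrite -sqrtr_sqr ler_wsqrtr // lerDl sqr_ge0. Qed.

Lemma Im_le_cabs z : `|Im z| <= cabs z.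
Proof. by rewrite -sqrtr_sqr ler_wsqrtr // lerDr sqr_ge0. Qed.

Lemma cabs_le_ReIm z : cabs z <= `|Re z| + `|Im z|.
Proof.
rewrite cabs_le_sqr ?addr_ge0 // sqrrD !real_normK ?num_real //.
by rewrite -addrA lerD2l lerDr mulrn_wge0 // mulr_ge0.
Qed.

Lemma cabs_sub_le z w : cabs z - cabs w <= cabs (z - w).
Proof. by rewrite lerBlDr -{1}(subrK w z) cabsD. Qed.

Lemma ReB z w : Re (z - w) = Re z - Re w. Proof. by case: z w => [a b] [c d]. Qed.
Lemma ImB z w : Im (z - w) = Im z - Im w. Proof. by case: z w => [a b] [c d]. Qed.
Lemma ReD z w : Re (z + w) = Re z + Re w. Proof. by case: z w => [a b] [c d]. Qed.
Lemma ImD z w : Im (z + w) = Im z + Im w. Proof. by case: z w => [a b] [c d]. Qed.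
Lemma ReM z w : Re (z * w) = Re z * Re w - Im z * Im w.
Proof. by case: z w => [a b] [c d]. Qed.
Lemma ImM z w : Im (z * w) = Re z * Im w + Im z * Re w.
Proof. by case: z w => [a b] [c d] /=; rewrite addrC. Qed.

Lemma complexP z w : Re z = Re w -> Im z = Im w -> z = w.
Proof. by case: z w => [a b] [c d] /= -> ->. Qed.

End modulus.

Section plane_topology.
Variable R : realType.
Local Notation C := (R[i]^o : normedModType R[i]).
Implicit Types z w : R[i]^o.

(** Balls of [R[i]^o] have their radii in R[i], where positive elements are real; this passes to
    real radii and the real modulus [cabs], to which real arithmetic applies. *)
Lemma nbhs_cP z (A : set R[i]^o) :
  nbhs z A <-> exists2 e : R, 0 < e & forall w, cabs (w - z) < e -> A w.
Proof.
split=> [/nbhs_normP[e /= e0 eA]|[e e0 eA]].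
  move: (e0); rewrite ltcE /= => /andP[/eqP ime0 ree0].
  exists (Re e) => // w wz; apply: eA.
  by rewrite /ball_ /= normE ltcE /= ime0 eqxx cabsB.
apply: (nbhs_normP z A).2; exists e%:C; first by rewrite /= ltcR.
by move=> w; rewrite /ball_ /= normE ltcR cabsB; exact: eA.
Qed.

Lemma nbhs_ccP (x : R[i]^o * R[i]^o) (A : set (R[i]^o * R[i]^o)) :
  nbhs x A <-> exists2 e : R, 0 < e &
    forall z w, cabs (z - x.1) < e -> cabs (w - x.2) < e -> A (z, w).
Proof.
split=> [[[P Q] /= [/nbhs_cP[e1 e10 h1] /nbhs_cP[e2 e20 h2]] PQ]|[e e0 h]].
  exists (Num.min e1 e2); first by rewrite lt_min e10.
  move=> z w; rewrite !lt_min => /andP[z1 _] /andP[_ w2].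
  by apply: PQ; split; [exact: h1|exact: h2].
exists ([set z | cabs (z - x.1) < e], [set w | cabs (w - x.2) < e]) => /=.
  by split; apply/nbhs_cP; exists e.
by move=> [z w] /= [? ?]; exact: h.
Qed.

Lemma cvg_realP (T : Type) (F : set_system T) {FF : Filter F} (f : T -> R) (l : R) :
  (forall e : R, 0 < e -> F [set t | `|l - f t| < e]) -> f @ F --> l.
Proof.
move=> h A /nbhs_ballP[e /= e0 eA]; have := h _ e0; rewrite /nbhs /=.
by apply: filterS => t; exact: eA.
Qed.

Lemma Re_continuous : continuous (fun z : R[i]^o => Re z : R).
Proof.
move=> z; apply: (@cvg_realP _ (nbhs z) (nbhs_filter z)) => e e0.
apply/nbhs_cP; exists e => // w wz /=.
by rewrite -ReB (le_lt_trans (Re_le_cabs _)) // cabsB.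
Qed.

Lemma Im_continuous : continuous (fun z : R[i]^o => Im z : R).
Proof.
move=> z; apply: (@cvg_realP _ (nbhs z) (nbhs_filter z)) => e e0.
apply/nbhs_cP; exists e => // w wz /=.
by rewrite -ImB (le_lt_trans (Im_le_cabs _)) // cabsB.
Qed.

Lemma cvg_complexP (T : Type) (F : set_system T) {FF : Filter F} (f : T -> R[i]^o) (l : R[i]^o) :
  f @ F --> l <-> forall e : R, 0 < e -> \forall t \near F, cabs (f t - l) < e.
Proof.
split=> [fl e e0|h].
  by apply: (fl [set w | cabs (w - l) < e]); apply/nbhs_cP; exists e.
move=> A /nbhs_cP[e e0 eA]; have := h _ e0; rewrite /nbhs /=; apply: filterS => t.
exact: eA.
Qed.

Lemma cvg_complex (T : Type) (F : set_system T) {FF : Filter F} (f : T -> R[i]^o) (l : R[i]^o) :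
  Re (f t) @[t --> F] --> Re l -> Im (f t) @[t --> F] --> Im l -> f @ F --> l.
Proof.
move=> /cvgrPdist_lt hr /cvgrPdist_lt hi; apply/cvg_complexP => e e0.
have e20 : 0 < e / 2 by rewrite divr_gt0.
apply: filterS2 (hr _ e20) (hi _ e20) => t h1 h2.
rewrite cabsB (le_lt_trans (cabs_le_ReIm _)) // (splitr e) ReB ImB.
exact: ltrD.
Qed.

Lemma cvg_ReP (T : Type) (F : set_system T) {FF : Filter F} (f : T -> R[i]^o) (l : R[i]^o) :
  f @ F --> l -> Re (f t) @[t --> F] --> Re l.
Proof. by move=> fl; exact: (@cvg_comp _ _ _ f (fun z => Re z) F (nbhs l) (nbhs (Re l)) fl (@Re_continuous l)). Qed.

Lemma cvg_ImP (T : Type) (F : set_system T) {FF : Filter F} (f : T -> R[i]^o) (l : R[i]^o) :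
  f @ F --> l -> Im (f t) @[t --> F] --> Im l.
Proof. by move=> fl; exact: (@cvg_comp _ _ _ f (fun z => Im z) F (nbhs l) (nbhs (Im l)) fl (@Im_continuous l)). Qed.

Lemma cvg_cM (T : Type) (F : set_system T) {FF : Filter F} (f g : T -> R[i]^o) (a b : R[i]^o) :
  f @ F --> a -> g @ F --> b -> (f t * g t : R[i]^o) @[t --> F] --> (a * b : R[i]^o).
Proof.
move=> fa gb; apply: cvg_complex.
  under eq_fun do rewrite ReM; rewrite ReM.
  by apply: cvgB; apply: cvgM; by [apply: cvg_ReP|apply: cvg_ImP].
under eq_fun do rewrite ImM; rewrite ImM.
apply: cvgD; apply: cvgM; by [apply: cvg_ReP|apply: cvg_ImP].
Qed.

Lemma cvg_cD (T : Type) (F : set_system T) {FF : Filter F} (f g : T -> R[i]^o) (a b : R[i]^o) :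
  f @ F --> a -> g @ F --> b -> (f t + g t : R[i]^o) @[t --> F] --> (a + b : R[i]^o).
Proof.
move=> fa gb; apply: cvg_complex.
  by under eq_fun do rewrite ReD; rewrite ReD; apply: cvgD; apply: cvg_ReP.
by under eq_fun do rewrite ImD; rewrite ImD; apply: cvgD; apply: cvg_ImP.
Qed.

Lemma cvg_c_cst (T : Type) (F : set_system T) {FF : Filter F} (a : R[i]^o) :
  (a : R[i]^o) @[t --> F] --> (a : R[i]^o).
Proof. by apply: cvg_complex; exact: cvg_cst. Qed.

Lemma ReIm_continuous (T : topologicalType) (f g : T -> R) :
  continuous f -> continuous g -> continuous (fun t => f t +i* g t : R[i]^o).
Proof. by move=> cf cg t; apply: cvg_complex; [exact: cf|exact: cg]. Qed.

Lemma circle_continuous (r : R) :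
  continuous (fun t : R => (r * cos t) +i* (r * sin t) : R[i]^o).
Proof.
apply: ReIm_continuous => t; apply: cvgM;
  by [exact: cvg_cst|exact: continuous_cos|exact: continuous_sin].
Qed.

Lemma cabs_circle (r t : R) : 0 <= r -> cabs ((r * cos t) +i* (r * sin t)) = r.
Proof.
move=> r0; rewrite /cabs /= !exprMn -mulrDr cos2Dsin2 mulr1 sqrtr_sqr.
by rewrite ger0_norm.
Qed.

Lemma cabs_continuous : continuous (fun z : R[i]^o => cabs z : R).
Proof.
move=> z; apply: (@cvg_realP _ (nbhs z) (nbhs_filter z)) => e e0.
apply/nbhs_cP; exists e => // w wz /=.
rewrite ltr_norml; have := cabs_sub_le z w; have := cabs_sub_le w z.
by rewrite (cabsB z w) => h1 h2; apply/andP; split; lra.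
Qed.

Lemma compact_square (r : R) : compact [set z : R[i]^o | `|Re z| <= r /\ `|Im z| <= r].
Proof.
have -> : [set z : R[i]^o | `|Re z| <= r /\ `|Im z| <= r]
  = (fun p : R * R => p.1 +i* p.2 : R[i]^o) @` (`[- r, r] `*` `[- r, r]).
  apply/seteqP; split=> [[x y] /= [h1 h2]|z [[x y] /= [h1 h2] <-]] /=.
    by exists (x, y) => //; rewrite /= !in_itv /= -!ler_norml.
  by move: h1 h2; rewrite /= !in_itv /= -!ler_norml.
apply: continuous_compact; last by apply: compact_setX; exact: segment_compact.
by apply: continuous_subspaceT; apply: ReIm_continuous => p; [exact: cvg_fst|exact: cvg_snd].
Qed.

Lemma compact_bounded_closed (A : set R[i]^o) (r : R) :
  closed A -> (forall z, A z -> cabs z <= r) -> compact A.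
Proof.
move=> cA hA; apply: (subclosed_compact cA (@compact_square r)) => z /hA zr.
by split; apply: le_trans zr; [exact: Re_le_cabs|exact: Im_le_cabs].
Qed.

Lemma compact_bounded_closed2 (A : set (R[i]^o * R[i]^o)) (r : R) :
  closed A -> (forall x, A x -> cabs x.1 <= r /\ cabs x.2 <= r) -> compact A.
Proof.
move=> cA hA.
apply: (subclosed_compact cA (compact_setX (@compact_square r) (@compact_square r))) => x /hA[h1 h2].
split; split; [exact: le_trans (Re_le_cabs _) h1|exact: le_trans (Im_le_cabs _) h1
  |exact: le_trans (Re_le_cabs _) h2|exact: le_trans (Im_le_cabs _) h2].
Qed.

End plane_topology.

(** * Finite covers and semicontinuous functions on compact sets *)

Section compactness.
Variables (R : realType) (T : topologicalType).

Lemma compact_cover_filter (A : set T) (P : T -> set T) : compact A ->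
  (forall x, A x -> nbhs x (P x)) ->
  exists2 s : seq T, (forall x, x \in s -> A x) &
    forall y, A y -> exists2 x, x \in s & P x y.
Proof.
move=> /compact_near_coveringP cA nP.
pose F (E : set (seq T)) := exists2 s : seq T, (forall x, x \in s -> A x) &
  forall s' : seq T, {subset s <= s'} -> (forall x, x \in s' -> A x) -> E s'.
have FF : Filter F.
  split; first by exists [::].
  - move=> E1 E2 [s1 s1A h1] [s2 s2A h2]; exists (s1 ++ s2).
      by move=> x; rewrite mem_cat => /orP[/s1A|/s2A].
    move=> s' sub s'A; split; [apply: h1|apply: h2] => // x xs;
      by apply: sub; rewrite mem_cat xs ?orbT.
  - by move=> E1 E2 E12 [s sA h]; exists s => // s' sub s'A; apply: E12; exact: h.
have [|s sA h] := cA _ F (fun s y => exists2 x, x \in s & P x y) FF.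
  move=> x Ax; exists (P x, [set s : seq T | x \in s]) => /=.
    split; first exact: nP.
    exists [:: x]; first by move=> y; rewrite inE => /eqP ->.
    by move=> s' sub _; apply: sub; rewrite mem_head.
  by move=> [y s] [/= Py xs]; exists x.
by exists s => // y Ay; exact: (h s (fun x xs => xs) sA y Ay).
Qed.

(** Without a maximum every x has some F x with H x < H (F x), and the sets where H < H (F x) cover
    [A]. In a finite subcover the largest of the H (F x) is attained at a point that no member
    contains. *)
Lemma usc_compact_max (A : set T) (H : T -> \bar R) : compact A -> A !=set0 ->
  (forall x (s : \bar R), A x -> (H x < s)%E -> nbhs x [set y | A y -> (H y < s)%E]) ->
  exists2 x, A x & forall y, A y -> (H y <= H x)%E.
Proof.
move=> cA [x0 Ax0] usc; apply: contrapT => nmax.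
have nx x : A x -> exists2 y, A y & (H x < H y)%E.
  move=> Ax; apply: contrapT => h; apply: nmax; exists x => // y Ay.
  by rewrite leNgt; apply/negP => xy; apply: h; exists y.
have exy x : exists y, A x -> A y /\ (H x < H y)%E.
  by have [/nx[y Ay xy]|nA] := pselect (A x); [exists y|exists x].
have [F FP] := choice exy.
have [s sA cov] := compact_cover_filter (P := fun x => [set y | A y -> (H y < H (F x))%E]) cA
  (fun x Ax => usc x _ Ax (FP x Ax).2).
have [z0 zs _] := cov _ Ax0.
have [z zin zmax] : exists2 z, z \in s & forall y, y \in s -> (H (F y) <= H (F z))%E.
  elim: s z0 zs {sA cov} => // a s IH _ _.
  case: s IH => [|b s] IH.
    by exists a => [|y]; rewrite ?mem_head // inE => /eqP ->.
  have [z zin zm] := IH b (mem_head _ _).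
  have [az|za] := leP (H (F a)) (H (F z)).
    exists z; first by rewrite inE zin orbT.
    by move=> y; rewrite inE => /predU1P[->//|]; exact: zm.
  exists a; first exact: mem_head.
  move=> y; rewrite inE => /predU1P[->//|/zm yz]; apply: le_trans yz _; exact: ltW.
have [AFz _] := FP _ (sA _ zin).
have [y ys /(_ AFz)] := cov _ AFz.
by apply/negP; rewrite -leNgt; exact: zmax.
Qed.

(** Finitely many neighbourhoods suffice, and the least of their constants serves everywhere since
    [Q] only weakens as d decreases. *)
Lemma compact_uniform (A : set T) (Q : R -> T -> Prop) : compact A ->
  (forall d d' x, d' <= d -> Q d x -> Q d' x) ->
  (forall x, A x -> exists2 d, 0 < d & nbhs x [set y | A y -> Q d y]) ->
  exists2 d, 0 < d & forall y, A y -> Q d y.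
Proof.
move=> cA mono loc.
have ex x : exists d, 0 < d /\ (A x -> nbhs x [set y | A y -> Q d y]).
  have [/loc[d d0 dQ]|nA] := pselect (A x); first by exists d.
  by exists 1.
have [f fP] := choice ex.
have [s sA cov] := compact_cover_filter (P := fun x => [set y | A y -> Q (f x) y]) cA
  (fun x Ax => (fP x).2 Ax).
have [d d0 dmin] : exists2 d, 0 < d & forall x, x \in s -> d <= f x.
  elim: (s) => [|a s' [d d0 dmin]]; first by exists 1.
  exists (Num.min d (f a)); first by rewrite lt_min d0 (fP a).1.
  by move=> x; rewrite inE ge_min => /predU1P[->|/dmin ->//]; rewrite lexx orbT.
exists d => // y Ay; have [x xs /(_ Ay)] := cov _ Ay.
by apply: mono; exact: dmin.
Qed.

End compactness.

(** * Plurisubharmonic series of logarithms of polynomials *)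

Section log_poly.
Variable R : realType.
Implicit Types (a : R[i]) (p q : {poly R[i]}) (r t : R).

Definition circ r t : R[i]^o := (r * cos t) +i* (r * sin t).

Lemma circ_continuous r : continuous (circ r).
Proof. exact: circle_continuous. Qed.

Lemma cabs_sqr_continuous (T : topologicalType) (f : T -> R[i]^o) :
  continuous f -> continuous (fun x => cabs (f x) ^+ 2 : R).
Proof.
move=> cf x; have ct : {for x, continuous (fun x => cabs (f x) : R)}.
  by apply: continuous_comp; [exact: cf|exact: cabs_continuous].
under eq_fun do rewrite expr2; exact: cvgM.
Qed.

Lemma cabs_circB a r t : cabs (circ r t - a) ^+ 2
  = r ^+ 2 + cabs a ^+ 2 - 2 * (r * Re a * cos t - (- (r * Im a)) * sin t).
Proof.
rewrite !cabs_sqr ReB ImB /=; have e := sin2cos2 t; ring: e.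
Qed.

(** On the circle |z - a|^2 + k has the shape required by [circle_avg_ln_ge], and C = max(r, |a|)^2
    + k is admissible. The positive [k] keeps the logarithm finite on circles through [a]. *)
Lemma circle_avg_ln_factor a r (k : R) : 0 < r -> 0 < k ->
  ln (cabs a ^+ 2 + k) <= circle_avg (fun t => ln (cabs (circ r t - a) ^+ 2 + k)).
Proof.
move=> r0 k0; have a0 := cabs_ge0 a.
have eq2 : (r * Re a) ^+ 2 + (- (r * Im a)) ^+ 2 = r ^+ 2 * cabs a ^+ 2.
  by rewrite cabs_sqr; ring.
rewrite (@eq_circle_avg _ _ (fun t => ln (r ^+ 2 + cabs a ^+ 2 + k
   - 2 * (r * Re a * cos t - (- (r * Im a)) * sin t)))); last first.
  by move=> t; rewrite cabs_circB addrAC.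
have D0 : 0 < cabs a ^+ 2 + k by rewrite ltr_wpDl // sqr_ge0.
have [ra|ar] := leP r (cabs a).
  apply: circle_avg_ln_ge => //; rewrite eq2.
    by rewrite -exprMn ltrXn2r ?nnegrE //; nra.
  have : r ^+ 2 * cabs a ^+ 2 / (cabs a ^+ 2 + k) <= r ^+ 2.
    by rewrite ler_pdivrMr //; nra.
  lra.
have C0 : 0 < r ^+ 2 + k by rewrite ltr_wpDl // sqr_ge0.
apply: (@le_trans _ _ (ln (r ^+ 2 + k))).
  by rewrite ler_ln ?posrE // lerD2r ler_pXn2r ?nnegrE // ltW.
apply: circle_avg_ln_ge => //; rewrite eq2.
  by rewrite -exprMn ltrXn2r ?nnegrE //; nra.
have : r ^+ 2 * cabs a ^+ 2 / (r ^+ 2 + k) <= cabs a ^+ 2.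
  by rewrite ler_pdivrMr //; have := sqr_ge0 (cabs a); nra.
lra.
Qed.

Lemma continuous_sum_fun (I : Type) (s : seq I) (F : I -> R -> R) :
  (forall i, continuous (F i)) -> continuous (fun t => \sum_(i <- s) F i t).
Proof.
move=> cF; elim: s => [|j s IH].
  by under eq_fun do rewrite big_nil; exact: cst_continuous.
by under eq_fun do rewrite big_cons; move=> t; apply: cvgD; [exact: cF|exact: IH].
Qed.

(** Jensen's inequality for ln |q|^2. The majorant [W] is positive, so zeros of q on the circle do
    no harm: each factor |z - a|^2 is regularized by k_n = 2^-n, and the decreasing regularized
    logarithms fall below ln W + e at every point. *)
Lemma circle_avg_ln_poly q r (W : R -> R) : 0 < r -> q.[0] != 0 ->
  continuous W -> (forall t, 0 < W t) ->
  (forall t, cabs q.[circ r t] ^+ 2 <= W t) ->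
  ln (cabs q.[0] ^+ 2) <= circle_avg (fun t => ln (W t)).
Proof.
move=> r0 q0 cW W0 qW.
have [s qE] := closed_field_poly_normal q.
set l := lead_coef q in qE.
have qxE x : cabs q.[x] ^+ 2 = cabs l ^+ 2 * \prod_(a <- s) (cabs (x - a) ^+ 2).
  rewrite {1}qE hornerZ horner_prod cabsM cabs_prod exprMn -prodrXl.
  by congr (_ * _); apply: eq_bigr => a _; rewrite hornerXsubC.
have l00 : 0 < cabs l.
  by rewrite cabs_gt0; apply: contra q0 => /eqP l0; rewrite qE l0 scale0r horner0.
have l0 : 0 < cabs l ^+ 2 by rewrite exprn_gt0.
pose k n : R := 2^-1 ^+ n.
have k0 n : 0 < k n by rewrite exprn_gt0 // invr_gt0.
have fac0 n a x : 0 < cabs (x - a) ^+ 2 + k n by rewrite ltr_wpDl // sqr_ge0.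
have cfac n a : continuous (fun t => ln (cabs (circ r t - a) ^+ 2 + k n)).
  apply: continuous_ln_comp => // t; apply: cvgD; last exact: cvg_cst.
  apply: (@cabs_sqr_continuous _ (fun t => circ r t - a)) => {}t.
  by apply: (@cvgB _ R[i]^o); [exact: circ_continuous|exact: cvg_cst].
pose v n t := ln (cabs l ^+ 2) + \sum_(a <- s) ln (cabs (circ r t - a) ^+ 2 + k n).
have vE n t : v n t = ln (cabs l ^+ 2 * \prod_(a <- s) (cabs (circ r t - a) ^+ 2 + k n)).
  rewrite lnM ?posrE ?prodr_gt0 //; congr (_ + _).
  elim: (s) => [|a s' IH]; first by rewrite !big_nil ln1.
  by rewrite !big_cons IH lnM ?posrE ?prodr_gt0.
apply: (@circle_avg_limit _ v).
- move=> n t; apply: cvgD; first exact: cvg_cst.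
  exact: continuous_sum_fun.
- move=> n t; rewrite lerD2l; apply: ler_sum => a _.
  rewrite ler_ln ?posrE // lerD2l /k exprS ler_piMl ?exprn_ge0 ?invr_ge0 //.
  by rewrite invf_le1 // ler1n.
- exact: continuous_ln_comp.
- move=> t e e0.
  have cvk : (fun n => cabs l ^+ 2 * \prod_(a <- s) (cabs (circ r t - a) ^+ 2 + k n))
      @ \oo --> (cabs q.[circ r t] ^+ 2).
    rewrite qxE; apply: cvgM; first exact: cvg_cst.
    elim: (s) => [|a s' IH].
      by rewrite big_nil; under eq_fun do rewrite big_nil; exact: cvg_cst.
    rewrite big_cons; under eq_fun do rewrite big_cons.
    apply: cvgM => //; rewrite -[X in _ --> X]addr0; apply: cvgD; first exact: cvg_cst.
    by apply: cvg_expr; rewrite ger0_norm ?invr_ge0 // invf_lt1 // ltr1n.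
  have : cabs q.[circ r t] ^+ 2 < W t * expR e.
    by apply: le_lt_trans (qW t) _; rewrite ltr_pMr // expR_gt1.
  move=> /(cvgr_lt _ cvk) [N _ /(_ N (leqnn _))] /= lt.
  exists N; rewrite vE -[X in _ <= _ + X](expRK e) -lnM ?posrE ?expR_gt0 //.
  rewrite ler_ln ?posrE ?mulr_gt0 ?expR_gt0 ?prodr_gt0 //.
  exact: ltW.
- move=> n; rewrite circle_avgD ?circle_avg_cst ?circle_avg_sum //; last 2 first.
  + exact: cst_continuous.
  + exact: continuous_sum_fun.
  have s0 a : a \in s -> a != 0.
    move=> ains; apply: contra q0 => /eqP a0.
    rewrite qE hornerZ horner_prod (big_rem a) //= hornerXsubC a0 subrr mul0r mulr0 //.
  rewrite qxE lnM ?posrE //; last first.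
    rewrite big_seq prodr_gt0 // => a ains; rewrite sub0r cabsN exprn_gt0 // cabs_gt0.
    exact: s0.
  rewrite lerD2l.
  have -> : ln (\prod_(a <- s) cabs (0 - a) ^+ 2) = \sum_(a <- s) ln (cabs a ^+ 2).
    elim: (s) s0 => [|a s' IH] s0; first by rewrite !big_nil ln1.
    have a0 : 0 < cabs a ^+ 2 by rewrite exprn_gt0 // cabs_gt0 s0 // mem_head.
    rewrite !big_cons sub0r cabsN -IH; last by move=> b bs; rewrite s0 // inE bs orbT.
    rewrite lnM ?posrE // big_seq prodr_gt0 // => b bs.
    by rewrite sub0r cabsN exprn_gt0 // cabs_gt0 s0 // inE bs orbT.
  rewrite big_seq [leRHS]big_seq; apply: ler_sum => a ains.
  apply: le_trans (circle_avg_ln_factor a r0 (k0 n)).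
  have ca : 0 < cabs a by rewrite cabs_gt0 s0.
  by rewrite ler_ln ?posrE ?exprn_gt0 // ?addr_gt0 ?exprn_gt0 // lerDl ltW.
Qed.

Lemma horner_continuous p : continuous (fun z : R[i]^o => p.[z] : R[i]^o).
Proof.
elim/poly_ind: p => [|p c IH].
  by under eq_fun do rewrite horner0; exact: cst_continuous.
under eq_fun do rewrite hornerMXaddC; move=> z.
apply: (@cvg_cD _ _ (nbhs z) (nbhs_filter z)); last exact: cvg_c_cst.
by apply: (@cvg_cM _ _ (nbhs z) (nbhs_filter z)); [exact: IH|exact: cvg_id].
Qed.

Lemma cabs_sqr_conjM_le (u y : R[i]) (d : R) : 0 < d ->
  cabs (conjc u * y + d%:C) ^+ 2 <= (cabs y ^+ 2 + d) * (cabs u ^+ 2 + d).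
Proof.
case: u y => [u v] [x y] d0; rewrite !cabs_sqr /=.
have := mulr_ge0 (ltW d0) (sqr_ge0 (x - u)).
have := mulr_ge0 (ltW d0) (sqr_ge0 (y - v)); nra.
Qed.

(* By Cauchy-Schwarz |p|^2 + d dominates |q|^2 / (|p(0)|^2 + d) for the polynomial
   q = conj(p(0)) p + d, with equality at 0. *)
Lemma circle_avg_ln_sqr_poly p r (d : R) : 0 < r -> 0 < d ->
  ln (cabs p.[0] ^+ 2 + d) <= circle_avg (fun t => ln (cabs p.[circ r t] ^+ 2 + d)).
Proof.
move=> r0 d0; set p0 := p.[0].
have pos z : 0 < cabs z ^+ 2 + d by rewrite ltr_wpDl // sqr_ge0.
pose q := (conjc p0)%:P * p + (d%:C)%:P.
have qz z : q.[z] = conjc p0 * p.[z] + d%:C by rewrite !hornerE.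
have q0 : cabs q.[0] = cabs p0 ^+ 2 + d.
  rewrite qz mulrC -sqr_normc normE -rmorphXn -rmorphD cabs_real ger0_norm //.
  by rewrite ltW.
pose W t := (cabs p.[circ r t] ^+ 2 + d) * (cabs p0 ^+ 2 + d).
have cp : continuous (fun t => cabs p.[circ r t] ^+ 2 + d : R).
  move=> t; apply: cvgD; last exact: cvg_cst.
  apply: (@cabs_sqr_continuous _ (fun t => p.[circ r t])) => {}t.
  apply: (@continuous_comp _ _ _ (circ r) (fun z : R[i]^o => p.[z] : R[i]^o)).
    exact: circ_continuous.
  exact: horner_continuous.
have cW : continuous W by move=> t; apply: cvgM; [exact: cp|exact: cvg_cst].
have W0 t : 0 < W t by rewrite mulr_gt0.
have qW t : cabs q.[circ r t] ^+ 2 <= W t.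
  by rewrite qz; exact: cabs_sqr_conjM_le.
have q00 : q.[0] != 0 by rewrite -cabs_gt0 q0.
have := circle_avg_ln_poly r0 q00 cW W0 qW.
rewrite q0 lnXn // (@eq_circle_avg _ (fun t => ln (W t))
  (fun t => ln (cabs p.[circ r t] ^+ 2 + d) + ln (cabs p0 ^+ 2 + d))); last first.
  by move=> t; rewrite lnM ?posrE.
rewrite circle_avgD; [|exact: continuous_ln_comp|exact: cst_continuous].
by rewrite circle_avg_cst mulr2n lerD2r.
Qed.

End log_poly.

Section psh_series.
Variable R : realType.
Local Notation U := (R[i]^o * R[i]^o)%type.
Implicit Types (a b x : U) (c l : R[i]^o).

Definition series_psh (T : nat -> U -> R) (x : U) : \bar R :=
  limn (fun k => (\sum_(n < k) T n x)%:E).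

Lemma line_continuous a b : continuous (fun l : R[i]^o => a + l *: b).
Proof.
move=> l A /nbhs_ccP[e e0 eA]; apply/nbhs_cP.
have b0 : 0 < 1 + cabs b.1 + cabs b.2 by have := cabs_ge0 b.1; have := cabs_ge0 b.2; lra.
exists (e / (1 + cabs b.1 + cabs b.2)); first by rewrite divr_gt0.
move=> w; rewrite ltr_pdivlMr // => wl; change (A (a + w *: b)); rewrite [a + w *: b]surjective_pairing.
have d c (v v' : R[i]) : c + w * v - (c + l * v) = (w - l) * v by ring.
have := cabs_ge0 (w - l); have := cabs_ge0 b.1; have := cabs_ge0 b.2 => h1 h2 h3.
by apply: eA; rewrite /= d // cabsM; nra.
Qed.

Lemma usc_line (h : U -> \bar R) a b : usc_on setT h ->
  usc_on [set l : R[i]^o | setT (a + l *: b)] (fun l : R[i]^o => h (a + l *: b)).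
Proof.
move=> [h1 h2]; split=> [x _|t]; first exact: h1.
have := h2 t; rewrite !setTI => o; apply: (open_comp _ o) => l _.
exact: line_continuous.
Qed.

Variable T : nat -> U -> R.
Hypothesis cT : forall n, continuous (T n).
Hypothesis subT : forall n a b c r, 0 < r ->
  T n (a + c *: b) <= circle_avg (fun t => T n (a + (c + circ r t) *: b)).
Hypothesis evT : forall rho : R, exists N : nat, forall n x, (N <= n)%N ->
  cabs x.1 <= rho -> cabs x.2 <= rho -> T n x <= 0.

Let S k x := \sum_(n < k) T n x.

Let S_dec N x : (forall n, (N <= n)%N -> T n x <= 0) ->
  forall k, S (k.+1 + N) x <= S (k + N) x.
Proof.
move=> h k; rewrite addSn /S big_ord_recr /= gerDl; apply: h.
by rewrite leq_addl.
Qed.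

(** From N on the partial sums decrease, so the limit is an infimum of continuous functions. This
    form yields upper semicontinuity and is the one [circle_mean_inf] asks for. *)
Let hE N x : (forall n, (N <= n)%N -> T n x <= 0) ->
  series_psh T x = ereal_inf (range (fun k => (S (k + N) x)%:E)).
Proof.
move=> h; apply/cvg_lim => //; rewrite -(cvg_shiftn N) /=.
apply: ereal_nonincreasing_cvgn; apply/nonincreasing_seqP => k.
by rewrite lee_fin; exact: S_dec.
Qed.

Let S_continuous k : continuous (S k).
Proof.
elim: k => [|k IH]; rewrite /S.
  by under eq_fun do rewrite big_ord0; exact: cst_continuous.
by under eq_fun do rewrite big_ord_recr /=; move=> x; apply: cvgD; [exact: IH|exact: cT].
Qed.

Let S_sub k a b c r : 0 < r ->
  S k (a + c *: b) <= circle_avg (fun t => S k (a + (c + circ r t) *: b)).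
Proof.
move=> r0; rewrite /S circle_avg_sum; last first.
  move=> n t.
  apply: (@continuous_comp _ _ _ (fun t => a + (c + circ r t) *: b) (T n)); last exact: cT.
  apply: (@continuous_comp _ _ _ (fun t => c + circ r t : R[i]^o) (fun l : R[i]^o => a + l *: b)).
    by apply: cvg_cD; [exact: cvg_c_cst|exact: circ_continuous].
  exact: line_continuous.
by apply: ler_sum => n _; exact: subT.
Qed.

Let series_usc : usc_on setT (series_psh T).
Proof.
split=> [x _|s].
  have [N hN] := evT (cabs x.1 + cabs x.2).
  rewrite (@hE N); last first.
    by move=> n Nn; apply: hN => //; rewrite ?lerDl ?lerDr ?cabs_ge0.
  by apply: le_lt_trans (ltry (S N x)); apply: ereal_inf_lbound; exists 0%N.
rewrite setTI openE => x /= hx.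
have [N hN] := evT (cabs x.1 + cabs x.2 + 1).
have c1 := cabs_ge0 x.1; have c2 := cabs_ge0 x.2.
have /ereal_inf_lt[_ [k _ <-]] : (ereal_inf (range (fun k => (S (k + N) x)%:E)) < s%:E)%E.
  by rewrite -(@hE N) // => n Nn; apply: hN => //; lra.
rewrite lte_fin => Sks.
have nb : nbhs x [set y : U | cabs (y.1 - x.1) < 1 /\ cabs (y.2 - x.2) < 1].
  by apply/nbhs_ccP; exists 1.
have /(cvgr_lt _ (@S_continuous (k + N) x)) nS := Sks.
apply: filterS2 nb nS => y [y1 y2] Sy /=.
rewrite (@hE N).
  by apply: le_lt_trans (_ : (S (k + N) y)%:E < _)%E; [apply: ereal_inf_lbound; exists k|rewrite lte_fin].
move=> n Nn; apply: hN => //.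
  by have := cabsD (y.1 - x.1) x.1; rewrite subrK; lra.
by have := cabsD (y.2 - x.2) x.2; rewrite subrK; lra.
Qed.

Lemma series_psh_psh : psh setT (series_psh T).
Proof.
split; first exact: series_usc.
move=> a b; split; first by apply: usc_line; exact: series_usc.
move=> c r r0 _; rewrite /circle_mean.
(* Bounds both coordinates on the whole disc of radius r about c in the line, so that a single N
   serves the centre and the circle. *)
pose rho := cabs a.1 + cabs a.2 + (cabs c + r) * (cabs b.1 + cabs b.2).
have [N hN] := evT rho.
have hN' l : cabs l <= cabs c + r -> forall n, (N <= n)%N -> T n (a + l *: b) <= 0.
  move=> lr n Nn.
  have a1 := cabs_ge0 a.1; have a2 := cabs_ge0 a.2.
  have b1 := cabs_ge0 b.1; have b2 := cabs_ge0 b.2.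
  have c0 := cabs_ge0 c; have l0 := cabs_ge0 l.
  have m1 : cabs l * cabs b.1 <= (cabs c + r) * cabs b.1 by rewrite ler_wpM2r.
  have m2 : cabs l * cabs b.2 <= (cabs c + r) * cabs b.2 by rewrite ler_wpM2r.
  have m3 : 0 <= (cabs c + r) * cabs b.1 by rewrite mulr_ge0 // addr_ge0 // ltW.
  have m4 : 0 <= (cabs c + r) * cabs b.2 by rewrite mulr_ge0 // addr_ge0 // ltW.
  apply: hN => //; rewrite /rho mulrDr.
    by have := cabsD a.1 (l * b.1); rewrite cabsM /=; lra.
  by have := cabsD a.2 (l * b.2); rewrite cabsM /=; lra.
have hc : cabs c <= cabs c + r by rewrite lerDl ltW.
have ht t : cabs (c + circ r t) <= cabs c + r.
  by apply: le_trans (cabsD _ _) _; rewrite cabs_circle // ltW.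
set mean := (_ * _)%E.
have main m : (forall k, m <= circle_avg (fun t => S (k + N) (a + (c + circ r t) *: b))) ->
  (m%:E <= mean)%E.
  apply: (@circle_mean_inf _ (fun k t => S (k + N) (a + (c + circ r t) *: b))).
  - move=> k t.
    apply: (@continuous_comp _ _ _ (fun t => a + (c + circ r t) *: b) (S (k + N))); last exact: S_continuous.
    apply: (@continuous_comp _ _ _ (fun t => c + circ r t : R[i]^o) (fun l : R[i]^o => a + l *: b)).
      by apply: cvg_cD; [exact: cvg_c_cst|exact: circ_continuous].
    exact: line_continuous.
  - by move=> k t; apply: S_dec; exact: hN' (ht t).
  - by move=> t; apply: hE; exact: hN' (ht t).
rewrite (hE (hN' _ hc)); case E: (ereal_inf _) => [m| |]; last by rewrite leNye.
  apply: main => k; apply: le_trans (S_sub _ _ _ _ r0).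
  by rewrite -lee_fin -E; apply: ereal_inf_lbound; exists k.
have : (ereal_inf (range (fun k => (S (k + N) (a + c *: b))%:E)) <= (S N (a + c *: b))%:E)%E.
  by apply: ereal_inf_lbound; exists 0%N.
by rewrite E leye_eq.
Qed.

Lemma series_psh_Ny x (N : nat) : (forall n, (N <= n)%N -> T n x <= -1) ->
  series_psh T x = -oo%E.
Proof.
move=> h; have h0 n : (N <= n)%N -> T n x <= 0 by move=> /h hn; lra.
have Sk k : S (k + N) x <= S N x - k%:R.
  elim: k => [|k IH]; first by rewrite subr0.
  have -> : S (k.+1 + N) x = S (k + N) x + T (k + N) x.
    by rewrite /S addSn big_ord_recr.
  have := h _ (leq_addl k N); have -> : k.+1%:R = k%:R + 1 :> R by rewrite natr1.
  by lra.
rewrite (hE h0); apply/eqP; rewrite -leeNy_eq leNgt; apply/negP.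
case E : (ereal_inf _) => [m| |] // _.
  have := archi_boundP (normr_ge0 (S N x - m)); set k := Num.bound _ => kB.
  have := Sk k; have : m <= S (k + N) x.
    by rewrite -lee_fin -E; apply: ereal_inf_lbound; exists k.
  have := ler_norm (S N x - m); lra.
have : (ereal_inf (range (fun k => (S (k + N) x)%:E)) <= (S (0 + N) x)%:E)%E.
  by apply: ereal_inf_lbound; exists 0%N.
by rewrite E leye_eq.
Qed.

Lemma series_psh_gtNy x (m : R) : (forall k, m <= \sum_(n < k) T n x) ->
  series_psh T x != -oo%E.
Proof.
move=> h; have [N hN] := evT (cabs x.1 + cabs x.2).
rewrite (@hE N); last first.
  by move=> n Nn; apply: hN => //; rewrite ?lerDl ?lerDr ?cabs_ge0.
have : (m%:E <= ereal_inf (range (fun k => (S (k + N) x)%:E)))%E.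
  by apply: le_ereal_inf_tmp => _ [k _ <-]; rewrite lee_fin; exact: h.
by case: (ereal_inf _).
Qed.

End psh_series.

(** * A two-constants estimate with excluded discs *)

Section max_principle.
Variable R : realType.
Local Notation U := (R[i]^o * R[i]^o)%type.
Implicit Types (z w l : R[i]) (G : R[i] -> R[i]).

(* Second-order Taylor expansion with a cubic remainder: all that the maximum
   principle below uses of the holomorphy of [G]. *)
Definition tay2 G z := exists (A B : R[i]) (K rho : R),
  [/\ 0 < rho, 0 <= K &
   forall l : R[i], cabs l < rho ->
     cabs (G (z + l) - G z - A * l - B * l ^+ 2) <= K * cabs l ^+ 3].

Lemma tay2_continuous G z : tay2 G z -> forall e : R, 0 < e ->
  exists2 d : R, 0 < d & forall z' : R[i], cabs (z' - z) < d -> cabs (G z' - G z) < e.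
Proof.
move=> [A [B [K [rho [rho0 K0 h]]]]] e e0.
have A0 := cabs_ge0 A; have B0 := cabs_ge0 B.
have S0 : 0 < 1 + cabs A + cabs B + K by lra.
exists (Num.min (Num.min rho 1) (e / (1 + cabs A + cabs B + K))).
  by rewrite !lt_min rho0 ltr01 divr_gt0.
move=> z'; rewrite !lt_min ltr_pdivlMr // => /andP[/andP[zr z1] ze].
have := h (z' - z) zr; rewrite [z + _]addrC subrK => hz.
have -> : G z' - G z = (G z' - G z - A * (z' - z) - B * (z' - z) ^+ 2)
   + (A * (z' - z) + B * (z' - z) ^+ 2) by ring.
apply: le_lt_trans (cabsD _ _) _; apply: le_lt_trans (lerD hz (cabsD _ _)) _.
rewrite (cabsM B) cabsX cabsM; move: ze z1; set x := cabs (z' - z); have := cabs_ge0 (z' - z).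
rewrite -/x => x0 ze z1.
have x2 : x ^+ 2 <= x by rewrite expr2 ler_piMl // ltW.
have x3 : x ^+ 3 <= x by rewrite exprS ler_piMr // exprn_ile1 // ltW.
have := ler_wpM2l K0 x3; have := ler_wpM2l B0 x2; nra.
Qed.

(** This removes the second-order Taylor term of G in the mean taken in [psh_disc_max], leaving an
    error of third order. *)
Lemma circle_avg_Re_sqr (c : R[i]) (r : R) :
  circle_avg (fun t => Re (c * circ r t ^+ 2)) = 0.
Proof.
pose phi t := r ^+ 2 * (Re c * (cos t * cos t - sin t * sin t)
   - Im c * (cos t * sin t + cos t * sin t)) : R.
rewrite (@eq_circle_avg _ _ phi); last first.
  by move=> t; rewrite /circ /phi expr2 {phi}; case: c => [x y] /=; ring.
pose Phi t := r ^+ 2 * (Re c * (sin t * cos t) + Im c * (cos t * cos t)) : R.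
apply: (@circle_avg_deriv _ Phi).
- have cc := @continuous_cos R; have cs := @continuous_sin R.
  move=> t; apply: cvgM; first exact: cvg_cst.
  apply: cvgB; apply: cvgM; try exact: cvg_cst.
    by apply: cvgB; apply: cvgM; by [exact: cc|exact: cs].
  by apply: cvgD; apply: cvgM; by [exact: cc|exact: cs].
- move=> t; apply: is_derive_eq; rewrite /phi /GRing.scale /=; ring.
- by rewrite /Phi mulr_natl sin2pi cos2pi sin0 cos0 !mul0r.
Qed.

Lemma circ_avg_continuous (F : R[i]^o -> R) (z : R[i]^o) r :
  (forall t, {for (z + circ r t : R[i]^o), continuous F}) ->
  continuous (fun t => F (z + circ r t)).
Proof.
move=> cF t.
apply: (@continuous_comp _ _ _ (fun t => z + circ r t : R[i]^o) F); last exact: cF.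
by apply: cvg_cD; [exact: cvg_c_cst|exact: circ_continuous].
Qed.

Lemma nbhs_gt_real (T : topologicalType) (F : T -> R) x (s : R) :
  {for x, continuous F} -> s < F x -> nbhs x [set y | s < F y].
Proof. by move=> cF sF; exact: (cvgr_gt _ cF). Qed.

Lemma nbhs_lt_real (T : topologicalType) (F : T -> R) x (s : R) :
  {for x, continuous F} -> F x < s -> nbhs x [set y | F y < s].
Proof. by move=> cF sF; exact: (cvgr_lt _ cF). Qed.

Lemma ereal_lt_between (x : \bar R) (s : R) : (x < s%:E)%E ->
  exists2 r : R, (x < r%:E)%E & r < s.
Proof.
case: x => [x| |] //; rewrite ?lte_fin => xs.
  by exists ((x + s) / 2); rewrite ?lte_fin; lra.
by exists (s - 1); rewrite ?ltNyr //; lra.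
Qed.

Let tangent_bound (cy cB K r2 r3 : R) : cy <= K * r3 + cB * r2 -> K * r3 <= K * r2 ->
  cy <= (cB + K) * r2.
Proof. by lra. Qed.

Let tube_bound (c cd cy S r r2 et : R) : c <= cd + cy -> cy <= S * r2 -> S * r2 <= S * r ->
  r * (S + 1) <= et - cd -> 0 <= r -> c <= et.
Proof. by lra. Qed.

Let square_bound (D2 Rb Ry Y2 cd K S r3 : R) : - (cd * (K * r3)) <= Ry -> Y2 <= S * r3 ->
  D2 - 2 * (Rb + Ry) + Y2 - D2 <= (2 * cd * K + S) * r3 - 2 * Rb.
Proof. by lra. Qed.

Let shift_bound (v T0 T1 N x y E : R) : N * (y - x) <= N * E ->
  v + (T0 - N * x) - (T1 - N * y) <= v + T0 - T1 + N * E.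
Proof. by lra. Qed.

Let mean_bound (v T0 T1 k c3 r2 r3 : R) : T0 + k * r2 <= T1 -> c3 + r3 < r2 * k -> 0 < r3 ->
  v + T0 + c3 + (-1 * T1 + 0) < v.
Proof. by lra. Qed.

(* Submean inequalities are available on straight discs only, so one maximizes
   h(z, w) + Theta(z) - C |w - G z|^2 in a tube around the graph of [G] and averages
   over circles of the tangent line at the maximum. *)
Lemma psh_disc_max (h : U -> \bar R) (D Dbar : set R[i]^o) G (Theta : R[i]^o -> R)
    (b M MT rho : R) :
  psh setT h ->
  open D -> closed Dbar -> D `<=` Dbar ->
  (forall z, Dbar z -> cabs z <= rho /\ cabs (G z) <= rho) ->
  (forall z, Dbar z -> tay2 G z) ->
  (forall z, Dbar z -> {for z, continuous Theta}) ->
  (forall z, Dbar z -> Theta z <= MT) ->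
  (forall z, D z -> exists kappa r0 : R, [/\ 0 < kappa, 0 < r0 &
     forall r, 0 < r -> r < r0 ->
       Theta z + kappa * r ^+ 2 <= circle_avg (fun t => Theta (z + circ r t))]) ->
  (forall z w, Dbar z -> cabs (w - G z) <= 1 -> (h (z, w) <= M%:E)%E) ->
  (forall z, Dbar z -> ~ D z -> (h (z, G z) < (b - Theta z)%:E)%E) ->
  forall z, Dbar z -> (h (z, G z) <= (b - Theta z)%:E)%E.
Proof.
move=> [[hfin husc] hsub] oD cDbar DD bnd tG cT TM sT hM hbd z0 Dz0.
rewrite leNgt; apply/negP => bad.
have uscn (x : U) (s : R) : (h x < s%:E)%E -> nbhs x [set y | (h y < s%:E)%E].
  move=> hx; have := husc s; rewrite setTI openE => o; exact: o.
have cD : compact Dbar.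
  by apply: (compact_bounded_closed (r := rho)) => // z /bnd[].
(* By upper semicontinuity and compactness the strict boundary inequality on the graph persists in a
   tube of some radius eta. *)
have [eta eta0 tube] : exists2 eta : R, 0 < eta & forall z, (Dbar `\` D) z ->
    forall w, cabs (w - G z) <= eta -> (h (z, w) < (b - Theta z)%:E)%E.
  pose Q (d : R) (z : R[i]^o) :=
    forall w : R[i]^o, cabs (w - G z) <= d -> (h (z, w) < (b - Theta z)%:E)%E.
  apply: (@compact_uniform _ _ (Dbar `\` D) Q).
  - apply: (subclosed_compact _ cD); last by move=> z [].
    by apply: closedI => //; exact: open_closedC.
  - by move=> d d' z dd q w wd; apply: q; exact: le_trans dd.
  - move=> z [Dz nDz]; have [s hs sb] := ereal_lt_between (hbd _ Dz nDz).
    have /nbhs_ccP[e e0 eh] := uscn _ _ hs.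
    have [d d0 dG] := tay2_continuous (tG _ Dz) (divr_gt0 e0 (ltr0n R 2)).
    have Ts : Theta z < b - s by lra.
    have /nbhs_cP[d2 d20 d2T] := nbhs_lt_real (cT _ Dz) Ts.
    exists (e / 3); first by rewrite divr_gt0.
    apply/nbhs_cP; exists (Num.min (Num.min d d2) e); first by rewrite !lt_min d0 d20.
    move=> z'; rewrite !lt_min => /andP[/andP[z'd z'd2] z'e] _ w wz'.
    apply: (@lt_trans _ _ s%:E); last by rewrite lte_fin; have := d2T _ z'd2 => /=; lra.
    apply: (eh z' w) => //=; have := dG _ z'd.
    have := cabsD (w - G z') (G z' - G z); rewrite addrA subrK; lra.
pose et := Num.min eta 1.
have et0 : 0 < et by rewrite lt_min eta0 ltr01.
have et_eta : et <= eta by rewrite ge_min lexx.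
have et_1 : et <= 1 by rewrite ge_min lexx orbT.
(* The penalty is so large that on the lateral boundary |w - G z| = et the functional is at most M +
   MT - N et^2 <= b, whereas the assumed violation makes its maximum exceed b. *)
pose N := `|M + MT - b| / et ^+ 2.
have N0 : 0 <= N by rewrite divr_ge0 // sqr_ge0.
have Net : N * et ^+ 2 >= M + MT - b by rewrite divfK ?ler_norm // gt_eqF // exprn_gt0.
pose X : set U := [set x | Dbar x.1 /\ cabs (x.2 - G x.1) <= et].
pose q (x : U) := Theta x.1 - N * cabs (x.2 - G x.1) ^+ 2.
have cdist (x : U) : Dbar x.1 -> {for x, continuous (fun x : U => cabs (x.2 - G x.1) : R)}.
  move=> Dx; apply: (@cvg_realP _ _ (nbhs x) (nbhs_filter x)) => e e0; apply/nbhs_ccP.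
  have e20 : 0 < e / 2 by rewrite divr_gt0.
  have [d d0 dG] := tay2_continuous (tG _ Dx) e20.
  exists (Num.min d (e / 2)); first by rewrite lt_min d0.
  move=> z w; rewrite !lt_min => /andP[zd _] /andP[_ we] /=.
  have := dG _ zd; have := cabsD (w - G z) (G z - G x.1 - (w - x.2)).
  have := cabsD (x.2 - G x.1) (- (G z - G x.1 - (w - x.2))).
  have := cabsD (G z - G x.1) (- (w - x.2)); rewrite !cabsN.
  have -> : w - G z + (G z - G x.1 - (w - x.2)) = x.2 - G x.1 by ring.
  have -> : x.2 - G x.1 - (G z - G x.1 - (w - x.2)) = w - G z by ring.
  by move=> h1 h2 h3 h4; rewrite ltr_norml; apply/andP; split; lra.
have cq x : X x -> {for x, continuous q}.
  move=> [Dx _]; apply: cvgB.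
    apply: (@continuous_comp _ _ _ (fun x : U => x.1) Theta); last exact: cT.
    exact: cvg_fst.
  apply: cvgM; first exact: cvg_cst.
  rewrite expr2; under eq_fun do rewrite expr2.
  by apply: cvgM; exact: cdist.
have cX : compact X.
  apply: (compact_bounded_closed2 (r := rho + 1)).
    rewrite -openC openE => x nXx.
    have [Dx|nDx] := pselect (Dbar x.1).
      have ex : et < cabs (x.2 - G x.1) by rewrite ltNge; apply/negP => ?; apply: nXx.
      have := nbhs_gt_real (cdist _ Dx) ex; apply: filterS => y ey [_].
      by apply/negP; rewrite -ltNge.
    have oC : open (~` Dbar) by rewrite openC.
    have : nbhs x.1 (~` Dbar) by apply: open_nbhs_nbhs.
    move=> /nbhs_cP[e e0 eC]; apply/nbhs_ccP; exists e => // z w ze _ [/= Dz _].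
    exact: eC _ ze Dz.
  move=> x [/bnd[x1 Gx] x2]; split; first lra.
  by have := cabsD (x.2 - G x.1) (G x.1); rewrite subrK; lra.
pose H (x : U) := (h x + (q x)%:E)%E.
have XG z : Dbar z -> X (z, G z) by move=> Dz; split=> //=; rewrite subrr cabs0 ltW.
have [xs Xxs xmax] : exists2 x, X x & forall y, X y -> (H y <= H x)%E.
  have ne : X !=set0 by exists (z0, G z0); exact: XG.
  apply: (usc_compact_max cX ne).
  move=> x s Xx; case: s => [s| |]; rewrite /H.
  - rewrite -lteBrDr // -EFinB => /ereal_lt_between[r hr rs].
    have q_lt : q x < s - r by lra.
    have := nbhs_lt_real (cq _ Xx) q_lt; have := uscn _ _ hr.
    apply: filterS2 => y /= hy qy _.
    rewrite -lteBrDr // -EFinB; apply: (lt_trans hy); rewrite lte_fin; lra.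
  - move=> _; near=> y => _; have := hfin y I; case: (h y) => //= v _.
    by rewrite -EFinD ltry.
  - by rewrite ltNge leNye.
have Hz0 : (b%:E < H (z0, G z0))%E.
  rewrite /H /q /= subrr cabs0 expr0n /= mulr0 subr0.
  by rewrite -lteBlDr //; exact: bad.
have Hxs : (b%:E < H xs)%E by apply: lt_le_trans Hz0 (xmax _ (XG _ Dz0)).
case: xs Xxs xmax Hxs => [zs ws] [/= Dzs dws] xmax Hxs.
case hsE: (h (zs, ws)) (hfin (zs, ws) I) => [hs| |] // _; last first.
  by move: Hxs; rewrite /H hsE addNye ltNge leNye.
move: Hxs; rewrite /H hsE -EFinD lte_fin /q /= => Hxs.
set d := ws - G zs in dws Hxs.
have hsM : hs <= M.
  by rewrite -lee_fin -hsE; apply: hM => //; rewrite -/d; lra.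
(* The maximum lies in the interior: the penalty excludes the lateral boundary, and the tube
   excludes the points over Dbar minus D. *)
have d_et : cabs d < et.
  rewrite lt_neqAle dws andbT; apply/eqP => de.
  by move: Hxs; rewrite de; have := TM _ Dzs; lra.
have DDzs : D zs.
  apply: contrapT => nD; have := tube zs (conj Dzs nD) ws (le_trans dws et_eta).
  rewrite hsE lte_fin; have := sqr_ge0 (cabs d); nra.
have [A [B [K [r1 [r10 K0 tay]]]]] := tG _ Dzs.
have [kappa [r0 [kappa0 r00 subT]]] := sT _ DDzs.
have /nbhs_cP[r2 r20 r2D] : nbhs zs D by exact: open_nbhs_nbhs.
pose C1 := 2 * cabs d * K + (cabs B + K) ^+ 2.
have B0 := cabs_ge0 B; have d0 := cabs_ge0 d.
have C10 : 0 <= C1 by rewrite addr_ge0 ?sqr_ge0 // mulr_ge0 // mulr_ge0.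
have [r [rpos rr0 rr1 rr2 [rle1 rC rB]]] : exists r : R, [/\ 0 < r, r < r0, r < r1, r < r2 &
    [/\ r <= 1, r * (N * C1 + 1) < kappa & r * (cabs B + K + 1) <= et - cabs d]].
  have k1 : 0 < N * C1 + 1 by rewrite ltr_wpDl // mulr_ge0.
  have k2 : 0 < cabs B + K + 1 by rewrite ltr_wpDl // addr_ge0.
  pose mn := Num.min (Num.min (Num.min r0 r1) (Num.min r2 1))
    (Num.min (kappa / (N * C1 + 1)) ((et - cabs d) / (cabs B + K + 1))).
  have mn0 : 0 < mn by rewrite !lt_min r00 r10 r20 ltr01 !divr_gt0 ?subr_gt0.
  have : mn / 2 < mn by rewrite ltr_pdivrMr // ltr_pMr // ltr1n.
  rewrite /mn !lt_min => /andP[/andP[/andP[a1 a2] /andP[a3 a4]] /andP[a5 a6]].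
  exists (mn / 2); rewrite -/mn in a1 a2 a3 a4 a5 a6 *.
  split=> //; [by rewrite divr_gt0|split; first exact: ltW].
    by rewrite -ltr_pdivlMr.
  by rewrite -ler_pdivlMr // ltW.
pose l t : R[i]^o := circ r t.
have lr t : cabs (l t) = r by apply: cabs_circle; exact: ltW.
have DzsL t : D (zs + l t) by apply: r2D; rewrite addrC addKr lr.
(* The bound that maximality imposes on h along the circle. Its quadratic term has mean zero, the
   cubic one is beaten by kappa r^2 for small r, so its mean falls below h at the centre, against
   the submean inequality. *)
pose phi t := hs + Theta zs - Theta (zs + l t)
   + N * (C1 * r ^+ 3 - 2 * Re (conjc d * B * l t ^+ 2)).
have cTl : continuous (fun t => Theta (zs + l t)).
  by apply: circ_avg_continuous => t; apply: cT; apply: DD; exact: DzsL.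
have cRe : continuous (fun t => Re (conjc d * B * l t ^+ 2) : R).
  move=> t; apply: (@cvg_ReP _ _ (nbhs t) (nbhs_filter t)).
  apply: (@cvg_cM _ _ (nbhs t) (nbhs_filter t)); first exact: cvg_c_cst.
  rewrite expr2; under eq_fun do rewrite expr2.
  by apply: (@cvg_cM _ _ (nbhs t) (nbhs_filter t)); exact: circ_continuous.
have cphi : continuous phi.
  move=> t; apply: cvgD; first by apply: cvgB; [exact: cvg_cst|exact: cTl].
  apply: cvgM; first exact: cvg_cst.
  by apply: cvgB; [exact: cvg_cst|apply: cvgM; [exact: cvg_cst|exact: cRe]].
(* The line through the maximum parallel to the tangent of the graph at zs: along it w - G z changes
   only to second order. *)
pose xs : U := (zs, ws); pose vs : U := (1, A).
have key t : (h (xs + l t *: vs)%R <= (phi t)%:E)%E.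
  set y := G (zs + l t) - G zs - A * l t.
  have yE : ws + A * l t - G (zs + l t) = d - y by rewrite /y /d; ring.
  have l1 : cabs (l t) < r1 by rewrite lr.
  have rem := tay _ l1; rewrite -/y lr in rem.
  have r3r2 : r ^+ 3 <= r ^+ 2 by rewrite exprS ler_piMl // sqr_ge0.
  have r4r3 : r ^+ 4 <= r ^+ 3 by rewrite exprS ler_piMl // exprn_ge0 // ltW.
  have r2r : r ^+ 2 <= r by rewrite expr2 ler_piMl // ltW.
  have By : cabs (B * l t ^+ 2) = cabs B * r ^+ 2 by rewrite cabsM cabsX lr.
  have ybnd : cabs y <= (cabs B + K) * r ^+ 2.
    have := cabsD (y - B * l t ^+ 2) (B * l t ^+ 2); rewrite subrK By => h1.
    by apply: tangent_bound (ler_wpM2l K0 r3r2); apply: le_trans h1 _; rewrite lerD2r.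
  have dy : cabs (d - y) <= et.
    have := cabsD d (- y); rewrite cabsN => h1.
    exact: (tube_bound h1 ybnd (ler_wpM2l (addr_ge0 B0 K0) r2r) rB (ltW rpos)).
  have Xl : X (zs + l t, ws + A * l t).
    by split; [exact: (DD _ (DzsL t))|rewrite /= yE].
  have := xmax _ Xl; rewrite /H hsE /q /= yE -/d -EFinD.
  have -> : xs + l t *: vs = (zs + l t, ws + A * l t).
    by rewrite /xs /vs; congr (_, _) => /=; rewrite /GRing.scale /= ?mulr1 // mulrC.
  rewrite -leeBrDr // -EFinB => /le_trans; apply; rewrite lee_fin /phi.
  have exp1 : cabs (d - y) ^+ 2 = cabs d ^+ 2 - 2 * Re (conjc d * y) + cabs y ^+ 2.
    by rewrite !cabs_sqr; case: (d) => [? ?]; case: (y) => [? ?] /=; ring.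
  have exp2 : Re (conjc d * y) = Re (conjc d * B * l t ^+ 2) + Re (conjc d * (y - B * l t ^+ 2)).
    by rewrite -ReD; congr Re; ring.
  have exp3 : `|Re (conjc d * (y - B * l t ^+ 2))| <= cabs d * (K * r ^+ 3).
    apply: le_trans (Re_le_cabs _) _; rewrite cabsM.
    have -> : cabs (conjc d) = cabs d by case: (d) => [? ?]; rewrite /cabs /= sqrrN.
    exact: ler_wpM2l.
  have exp4 : cabs y ^+ 2 <= (cabs B + K) ^+ 2 * r ^+ 3.
    apply: (@le_trans _ _ (((cabs B + K) * r ^+ 2) ^+ 2)).
      by rewrite ler_pXn2r ?nnegrE ?cabs_ge0 // mulr_ge0 ?sqr_ge0 // addr_ge0.
    by rewrite exprMn -exprM ler_wpM2l // sqr_ge0.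
  have : cabs (d - y) ^+ 2 - cabs d ^+ 2 <= C1 * r ^+ 3 - 2 * Re (conjc d * B * l t ^+ 2).
    rewrite exp1 exp2 /C1; move: exp3; rewrite ler_norml => /andP[exp3 _].
    exact: square_bound.
  by move/(ler_wpM2l N0); exact: shift_bound.
have [_ /(_ 0 r rpos (fun _ _ => I))] := hsub xs vs.
rewrite /circle_mean scale0r addr0 hsE.
under eq_integral do rewrite add0r.
move=> hmean; have := le_trans hmean (circle_mean_le cphi key).
rewrite lee_fin leNgt => /negP; apply.
have cNT : continuous (fun t => -1 * Theta (zs + l t)).
  by move=> t; apply: cvgM; [exact: cvg_cst|exact: cTl].
have cNRe : continuous (fun t => - (N * 2) * Re (conjc d * B * l t ^+ 2)).
  by move=> t; apply: cvgM; [exact: cvg_cst|exact: cRe].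
rewrite (@eq_circle_avg _ phi (fun t => (hs + Theta zs + N * C1 * r ^+ 3)
  + (-1 * Theta (zs + l t) + - (N * 2) * Re (conjc d * B * l t ^+ 2)))); last first.
  by move=> t; rewrite /phi; ring.
rewrite circle_avgD; [|exact: cst_continuous|by move=> t; apply: cvgD; [exact: cNT|exact: cNRe]].
rewrite circle_avg_cst circle_avgD // !circle_avgZ // circle_avg_Re_sqr.
have sub := subT r rpos rr0; have : r ^+ 2 * (r * (N * C1 + 1)) < r ^+ 2 * kappa.
  by rewrite ltr_pM2l // exprn_gt0.
have -> : r ^+ 2 * (r * (N * C1 + 1)) = N * C1 * r ^+ 3 + r ^+ 3 by ring.
rewrite mulr0 => sub3; apply: (mean_bound hs sub sub3); exact: exprn_gt0.
Unshelve. all: by end_near. Qed.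

End max_principle.

Section two_constants.
Variable R : realType.
Local Notation U := (R[i]^o * R[i]^o)%type.

Lemma cont_addR (T : topologicalType) (f g : T -> R) (x : T) :
  {for x, continuous f} -> {for x, continuous g} ->
  {for x, continuous (fun y => f y + g y)}.
Proof. exact: cvgD. Qed.

Lemma cont_subR (T : topologicalType) (f g : T -> R) (x : T) :
  {for x, continuous f} -> {for x, continuous g} ->
  {for x, continuous (fun y => f y - g y)}.
Proof. exact: cvgB. Qed.

Lemma cont_mulR (T : topologicalType) (f g : T -> R) (x : T) :
  {for x, continuous f} -> {for x, continuous g} ->
  {for x, continuous (fun y => f y * g y)}.
Proof. exact: cvgM. Qed.

Lemma cont_sumR (T : topologicalType) (I : Type) (s : seq I) (f : I -> T -> R) (x : T) :
  (forall i, {for x, continuous (f i)}) ->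
  {for x, continuous (fun y => \sum_(i <- s) f i y)}.
Proof.
move=> fl; elim: s => [|i s IH].
  have -> : (fun y => \sum_(i <- [::]) f i y) = fun=> 0.
    by apply/funext => y; rewrite big_nil.
  exact: cst_continuous.
have -> : (fun y => \sum_(i <- i :: s) f i y) = fun y => f i y + \sum_(i <- s) f i y.
  by apply/funext => y; rewrite big_cons.
exact: cont_addR.
Qed.

Lemma cabs_sub_continuous (a : R[i]^o) : continuous (fun z : R[i]^o => cabs (z - a) : R).
Proof.
move=> z; apply: (@continuous_comp _ _ _ (fun z : R[i]^o => z - a : R[i]^o) (fun z : R[i]^o => cabs z : R)).
  by apply: (@cvg_cD _ _ (nbhs z) (nbhs_filter z)); [exact: cvg_id|exact: cvg_c_cst].
exact: cabs_continuous.
Qed.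

Lemma ln_cabs_continuous (a z : R[i]^o) : z != a ->
  {for z, continuous (fun z : R[i]^o => ln (cabs (z - a)) : R)}.
Proof.
move=> za; apply: (@continuous_comp _ _ _ (fun z : R[i]^o => cabs (z - a) : R) (@ln R)).
  exact: cabs_sub_continuous.
by apply: continuous_ln; rewrite cabs_gt0 subr_eq0.
Qed.

(** The case C = |z - a|^2 of [circle_avg_ln], in which the middle expression is exactly |z + r
    e^(it) - a|^2. *)
Lemma circle_avg_ln_cabs (z a : R[i]) (r : R) : 0 < r -> r < cabs (z - a) ->
  circle_avg (fun t => ln (cabs (z + circ r t - a))) = ln (cabs (z - a)).
Proof.
move=> r0 rz; set al := a - z.
have al0 : 0 < cabs al by rewrite cabsB; exact: lt_trans rz.
have ral : r < cabs al by rewrite cabsB.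
have zE t : z + circ r t - a = circ r t - al by rewrite /al; ring.
have C0 : 0 < cabs al ^+ 2 by rewrite exprn_gt0.
have eq2 : (r * Re al) ^+ 2 + (- (r * Im al)) ^+ 2 = r ^+ 2 * cabs al ^+ 2.
  by rewrite cabs_sqr; ring.
have lt2 : (r * Re al) ^+ 2 + (- (r * Im al)) ^+ 2 < (cabs al ^+ 2) ^+ 2.
  by rewrite eq2 -exprMn ltrXn2r ?nnegrE ?mulr_ge0 ?ltW // expr2 ltr_pM2r.
have pos t : 0 < cabs (circ r t - al).
  have := cabs_sub_le al (circ r t); rewrite cabsB (cabs_circle _ (ltW r0)); lra.
have c1 : continuous (fun t => ln (cabs (circ r t - al))).
  apply: continuous_ln_comp => // t.
  by apply: (@continuous_comp _ _ _ (circ r) (fun z : R[i]^o => cabs (z - al) : R));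
    [exact: circ_continuous|exact: cabs_sub_continuous].
apply: (@mulfI _ 2); first by rewrite pnatr_eq0.
rewrite (@eq_circle_avg _ _ (fun t => ln (cabs (circ r t - al)))); last first.
  by move=> t; rewrite zE.
rewrite -circle_avgZ // (cabsB z) -/al mulr_natl -lnXn // -(circle_avg_ln C0 lt2).
apply: eq_circle_avg => t; rewrite [LHS]mulr_natl -lnXn // cabs_circB eq2.
by congr ln; rewrite mulfK ?gt_eqF // [r ^+ 2 + _]addrC.
Qed.

Lemma circle_avg_cabs_sqr (z a : R[i]) (r : R) : 0 < r ->
  circle_avg (fun t => cabs (z + circ r t - a) ^+ 2) = cabs (z - a) ^+ 2 + r ^+ 2.
Proof.
move=> r0; set al := a - z.
have cc := @continuous_cos R; have cs := @continuous_sin R.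
rewrite (@eq_circle_avg _ _ (fun t => (r ^+ 2 + cabs al ^+ 2)
   + (- (2 * (r * Re al)) * cos t + - (2 * (r * Im al)) * sin t))); last first.
  move=> t; have -> : z + circ r t - a = circ r t - al by rewrite /al; ring.
  by rewrite cabs_circB; ring.
have c1 (k : R) : continuous (fun t => k * cos t).
  by move=> t; apply: cvgM; [exact: cvg_cst|exact: cc].
have c2 (k : R) : continuous (fun t => k * sin t).
  by move=> t; apply: cvgM; [exact: cvg_cst|exact: cs].
rewrite circle_avgD; [|exact: cst_continuous|by move=> t; apply: cvgD; [exact: c1|exact: c2]].
rewrite circle_avg_cst circle_avgD // !circle_avgZ // circle_avg_cos circle_avg_sin.
by rewrite (cabsB z) -/al !mulr0 !addr0 addrC.
Qed.

Lemma nbhs_bigand (T : topologicalType) (x : T) (n : nat) (P : nat -> T -> Prop) :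
  (forall j, (j < n)%N -> nbhs x (P j)) -> nbhs x [set y | forall j, (j < n)%N -> P j y].
Proof.
elim: n => [|n IH] h; first by apply: filterS filterT.
apply: filterS2 (IH _) (h n (ltnSn n)) => [y y1 y2 j|j jn]; last by apply: h; rewrite ltnS ltnW.
by rewrite ltnS leq_eqVlt => /predU1P[->|/y1].
Qed.

(* Two constants: the competitor of the harmonic measure of the inner circle is
   ln (rho / |z - e|) - \sum_j c_j ln (4 / |z - m_j|), which is nonpositive on the
   outer circle and on the excluded discs. *)
Lemma disc_estimate (h : U -> \bar R) (e : R[i]) (rho' rho : R) (n : nat)
    (m : nat -> R[i]) (r c : nat -> R) (G : R[i] -> R[i]) (M N rG : R) :
  psh setT h -> 0 < rho' -> rho' < rho -> 0 <= N ->
  (forall j, (j < n)%N -> [/\ 0 < r j, cabs (m j - e) + rho <= 4, 0 <= c j &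
     ln (rho / rho') <= c j * ln (4 / r j)]) ->
  let Dbar := [set z : R[i] | [/\ rho' <= cabs (z - e), cabs (z - e) <= rho &
     forall j, (j < n)%N -> r j <= cabs (z - m j)]] in
  (forall z, Dbar z -> tay2 G z) ->
  (forall z, Dbar z -> cabs (G z) <= rG) ->
  (forall z w, Dbar z -> cabs (w - G z) <= 1 -> (h (z, w) <= M%:E)%E) ->
  (forall z, Dbar z -> cabs (z - e) = rho' ->
     (h (z, G z) <= (M - N * ln (rho / rho'))%:E)%E) ->
  forall z, Dbar z -> (h (z, G z) <= (M - N * (ln (rho / cabs (z - e))
     - \sum_(j < n) c j * ln (4 / cabs (z - m j))))%:E)%E.
Proof.
move=> hpsh rho'0 rho'rho N0 hj Dbar tG bG hM hE.
have rho0 : 0 < rho by exact: lt_trans rho'rho.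
pose om (z : R[i]^o) := ln rho - ln (cabs (z - e))
   - \sum_(j < n) c j * (ln 4 - ln (cabs (z - m j))) : R.
have De0 (z : R[i]) : Dbar z -> 0 < cabs (z - e).
  by move=> [h1 _ _]; exact: lt_le_trans h1.
have Dm0 (z : R[i]) j : Dbar z -> (j < n)%N -> 0 < cabs (z - m j).
  by move=> [_ _ h1] jn; have [r0 _ _ _] := hj j jn; apply: lt_le_trans (h1 j jn).
have omE z : Dbar z -> om z = ln (rho / cabs (z - e))
     - \sum_(j < n) c j * ln (4 / cabs (z - m j)).
  move=> Dz; rewrite ln_div ?posrE ?De0 // /om; congr (_ - _).
  apply: eq_bigr => j _; rewrite ln_div ?posrE //; exact: Dm0.
move=> z0 Dz0; rewrite -omE //.
apply/lee_addgt0Pr => eps eps0; rewrite -EFinD.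
(* The competitor [om] is harmonic, and the maximum principle wants a strictly subharmonic one:
   kappa |z - e|^2 is added, at a total cost of eps. *)
pose kappa := eps / (rho ^+ 2 + 1).
have k1 : 0 < rho ^+ 2 + 1 by rewrite ltr_wpDl // sqr_ge0.
have kappa0 : 0 < kappa by rewrite divr_gt0.
have kE : kappa * rho ^+ 2 + kappa = eps by rewrite /kappa; field; rewrite gt_eqF.
pose Theta (z : R[i]^o) := N * om z + kappa * cabs (z - e) ^+ 2 : R.
pose b := M + kappa * rho ^+ 2 + kappa.
pose D : set R[i]^o := [set z | [/\ rho' < cabs (z - e), cabs (z - e) < rho &
   forall j, (j < n)%N -> r j < cabs (z - m j)]].
(* The constant 4 bounds |z - m_j| on the whole annulus, so that every subtracted logarithm is
   nonnegative. *)
have sum_ge0 z : Dbar z -> 0 <= \sum_(j < n) c j * (ln 4 - ln (cabs (z - m j))).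
  move=> Dz; apply: sumr_ge0 => j _; have [r0 m4 c0 _] := hj j (ltn_ord j).
  apply: mulr_ge0 => //; rewrite subr_ge0 ler_ln ?posrE ?Dm0 //.
  case: Dz => _ ze _; have := cabsD (z - e) (e - m j); rewrite addrA subrK (cabsB e).
  lra.
have leT z : Dbar z -> Theta z <= N * om z + kappa * rho ^+ 2.
  move=> [_ zr _]; rewrite lerD2l ler_pM2l // ler_pXn2r ?nnegrE ?cabs_ge0 //.
  exact: ltW.
have om_le z : Dbar z -> om z <= ln (rho / rho').
  move=> Dz; have := sum_ge0 _ Dz; rewrite /om ln_div ?posrE //.
  have : ln rho' <= ln (cabs (z - e)).
    by rewrite ler_ln ?posrE ?De0 //; case: Dz.
  lra.
have cTheta z : Dbar z -> {for z, continuous Theta}.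
  move=> Dz; have ze : z != e by rewrite -subr_eq0 -cabs_gt0 De0.
  have ccst (k : R) : {for (z : R[i]^o), continuous (fun _ : R[i]^o => k : R)}.
    exact: cst_continuous.
  have com : {for (z : R[i]^o), continuous om}.
    apply: (@cont_subR _ (fun z : R[i]^o => ln rho - ln (cabs (z - e)))
      (fun z : R[i]^o => \sum_(j < n) c j * (ln 4 - ln (cabs (z - m j))))).
      apply: (@cont_subR _ (fun=> ln rho) (fun z : R[i]^o => ln (cabs (z - e)))) => //.
      exact: ln_cabs_continuous.
    apply: (@cont_sumR _ _ _ (fun (j : 'I_n) (z : R[i]^o) => c j * (ln 4 - ln (cabs (z - m j))))) => j.
    apply: (@cont_mulR _ (fun=> c j) (fun z : R[i]^o => ln 4 - ln (cabs (z - m j)))) => //.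
    apply: (@cont_subR _ (fun=> ln 4) (fun z : R[i]^o => ln (cabs (z - m j)))) => //.
    by apply: ln_cabs_continuous; rewrite -subr_eq0 -cabs_gt0; exact: Dm0.
  apply: (@cont_addR _ (fun z : R[i]^o => N * om z) (fun z : R[i]^o => kappa * cabs (z - e) ^+ 2)).
    exact: (@cont_mulR _ (fun=> N) om).
  apply: (@cont_mulR _ (fun=> kappa) (fun z : R[i]^o => cabs (z - e) ^+ 2)) => //.
  apply: (@cont_mulR _ (fun z : R[i]^o => cabs (z - e)) (fun z : R[i]^o => cabs (z - e)));
    exact: cabs_sub_continuous.
suff : (h (z0, G z0) <= (b - Theta z0)%:E)%E.
  move/le_trans; apply; rewrite lee_fin /b /Theta.
  have := sqr_ge0 (cabs (z0 - e)) => /(mulr_ge0 (ltW kappa0)); lra.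
apply: (@psh_disc_max _ h D Dbar G Theta b M (N * ln (rho / rho') + kappa * rho ^+ 2)
   (Num.max (cabs e + rho) rG)) => //.
- rewrite openE => z [h1 h2 h3].
  have g1 := nbhs_gt_real (@cabs_sub_continuous e z) h1.
  have g2 := nbhs_lt_real (@cabs_sub_continuous e z) h2.
  have g3 : nbhs z [set y | forall j, (j < n)%N -> r j < cabs (y - m j)].
    by apply: nbhs_bigand => j jn; apply: (nbhs_gt_real (@cabs_sub_continuous (m j) z)); exact: h3.
  by apply: filterS3 g1 g2 g3 => y y1 y2 y3; split.
- rewrite -openC openE => z nDz.
  have [h1|h1] := ltP (cabs (z - e)) rho'.
    have := nbhs_lt_real (@cabs_sub_continuous e z) h1.
    by apply: filterS => y /= y1 [y2 _ _]; move: y1; rewrite ltNge y2.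
  have [h2|h2] := ltP rho (cabs (z - e)).
    have := nbhs_gt_real (@cabs_sub_continuous e z) h2.
    by apply: filterS => y /= y1 [_ y2 _]; move: y1; rewrite ltNge y2.
  have [j jn h3] : exists2 j, (j < n)%N & cabs (z - m j) < r j.
    apply: contrapT => nex; apply: nDz; split=> // j jn.
    by rewrite leNgt; apply/negP => hj'; apply: nex; exists j.
  have := nbhs_lt_real (@cabs_sub_continuous (m j) z) h3.
  by apply: filterS => y /= y1 [_ _ /(_ j jn) y2]; move: y1; rewrite ltNge y2.
- by move=> z [h1 h2 h3]; split; rewrite ?ltW // => j jn; rewrite ltW // h3.
- move=> z Dz; rewrite !le_max bG // orbT; split=> //; case: Dz => _ zr _.
  by have := cabsD (z - e) e; rewrite subrK => hz; apply/orP; left; lra.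
- by move=> z Dz; apply: le_trans (leT _ Dz) _; rewrite lerD2r ler_wpM2l // om_le.
- move=> z [h1 h2 h3].
  have Dz : Dbar z by split; rewrite ?ltW // => j jn; rewrite ltW // h3.
  (* Circles about z of radius below d enclose none of the poles e and m_j, so the mean value
     property of the logarithms is exact on them. *)
  have [d d0 dP] : exists2 d : R, 0 < d & d <= cabs (z - e) /\
      forall j, (j < n)%N -> d <= cabs (z - m j).
    have [d d0 dj] : exists2 d : R, 0 < d & forall j, (j < n)%N -> d <= cabs (z - m j).
      elim: (n) hj h3 {Dz om De0 Dm0 omE b D sum_ge0 leT om_le cTheta Theta h1 h2 Dbar tG bG hM hE Dz0}
        => [|k IH] hj h3; first by exists 1.
      have [j jk|j jk|d d0 dj] := IH; [by apply: hj; rewrite ltnS ltnW|by apply: h3; rewrite ltnS ltnW|].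
      have [r0 _ _ _] := hj k (ltnSn k).
      exists (Num.min d (r k)); first by rewrite lt_min d0.
      move=> j; rewrite ltnS leq_eqVlt ge_min => /predU1P[->|/dj ->//].
      by rewrite (ltW (h3 k (ltnSn k))) orbT.
    exists (Num.min d rho'); first by rewrite lt_min d0.
    by split=> [|j jn]; rewrite ge_min ?(ltW h1) ?orbT ?dj.
  exists kappa, d; split=> // s s0 sd.
  have ne a t : d <= cabs (z - a) -> z + circ s t != a.
    move=> da; rewrite -subr_eq0 -cabs_gt0.
    have : cabs (circ s t) = s by rewrite cabs_circle // ltW.
    move: (circ s t : R[i]) => y ys; change (0 < cabs (z + y - a)).
    have := cabsD (z + y - a) (- y); rewrite cabsN ys.
    have -> : z + y - a + - y = z - a by ring.
    lra.
  have cln a : d <= cabs (z - a) -> continuous (fun t => ln (cabs (z + circ s t - a))).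
    move=> da; apply: (@circ_avg_continuous _ (fun z : R[i]^o => ln (cabs (z - a)))) => t.
    by apply: ln_cabs_continuous; exact: ne.
  have csq : continuous (fun t => cabs (z + circ s t - e) ^+ 2 : R).
    apply: (@cabs_sqr_continuous _ _ (fun t => z + circ s t - e)) => t.
    apply: (@cvg_cD _ _ (nbhs t) (nbhs_filter t)); last exact: cvg_c_cst.
    by apply: (@cvg_cD _ _ (nbhs t) (nbhs_filter t)); [exact: cvg_c_cst|exact: circ_continuous].
  pose L := N * (ln rho - \sum_(j < n) c j * ln 4).
  rewrite (@eq_circle_avg _ _ (fun t => L + (- N * ln (cabs (z + circ s t - e))
     + (\sum_(j < n) (N * c j) * ln (cabs (z + circ s t - m j))
     + kappa * cabs (z + circ s t - e) ^+ 2)))); last first.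
    move=> t; rewrite /Theta /om /L.
    have -> : \sum_(j < n) c j * (ln 4 - ln (cabs (z + circ s t - m j)))
      = \sum_(j < n) c j * ln 4 - \sum_(j < n) c j * ln (cabs (z + circ s t - m j)).
      by rewrite -sumrB; apply: eq_bigr => j _; rewrite mulrBr.
    have -> : \sum_(j < n) N * c j * ln (cabs (z + circ s t - m j))
      = N * \sum_(j < n) c j * ln (cabs (z + circ s t - m j)).
      by rewrite mulr_sumr; apply: eq_bigr => j _; rewrite mulrA.
    ring.
  have cj (j : 'I_n) : continuous (fun t => N * c j * ln (cabs (z + circ s t - m j))).
    by move=> t; apply: cvgM; [exact: cvg_cst|apply: cln; exact: dP.2].
  have cS : continuous (fun t => \sum_(j < n) N * c j * ln (cabs (z + circ s t - m j))).
    exact: continuous_sum_fun.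
  have cN : continuous (fun t => - N * ln (cabs (z + circ s t - e))).
    by move=> t; apply: cvgM; [exact: cvg_cst|apply: cln; exact: dP.1].
  have cK : continuous (fun t => kappa * cabs (z + circ s t - e) ^+ 2).
    by move=> t; apply: cvgM; [exact: cvg_cst|exact: csq].
  have cSK : continuous (fun t => \sum_(j < n) N * c j * ln (cabs (z + circ s t - m j))
     + kappa * cabs (z + circ s t - e) ^+ 2).
    by move=> t; apply: cvgD; [exact: cS|exact: cK].
  rewrite circle_avgD; [|exact: cst_continuous|by move=> t; apply: cvgD; [exact: cN|exact: cSK]].
  rewrite circle_avg_cst circle_avgD // [X in _ <= _ + (_ + X)]circle_avgD //.
  rewrite circle_avg_sum // !circle_avgZ //; last by apply: cln; exact: dP.1.
  rewrite circle_avg_cabs_sqr // circle_avg_ln_cabs //; last exact: lt_le_trans dP.1.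
  have -> : \sum_(j < n) circle_avg (fun t => N * c j * ln (cabs (z + circ s t - m j)))
    = N * \sum_(j < n) c j * ln (cabs (z - m j)).
    rewrite mulr_sumr; apply: eq_bigr => j _; have dj := dP.2 j (ltn_ord j).
    by rewrite circle_avgZ ?circle_avg_ln_cabs ?mulrA //; [exact: lt_le_trans dj|exact: cln].
  rewrite /Theta /om /L.
  have -> : \sum_(j < n) c j * (ln 4 - ln (cabs (z - m j)))
    = \sum_(j < n) c j * ln 4 - \sum_(j < n) c j * ln (cabs (z - m j)).
    by rewrite -sumrB; apply: eq_bigr => j _; rewrite mulrBr.
  by rewrite le_eqVlt; apply/orP; left; apply/eqP; ring.
- move=> z Dz nDz.
  have lt_b : N * om z <= 0 -> (h (z, G z) < (b - Theta z)%:E)%E.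
    move=> om0; apply: (@le_lt_trans _ _ M%:E).
      by apply: hM => //; rewrite subrr cabs0.
    by rewrite lte_fin /b; have := leT _ Dz; lra.
  have [ze|ze] := eqVneq (cabs (z - e)) rho'.
    apply: le_lt_trans (hE _ Dz ze) _; rewrite lte_fin /b.
    by have := leT _ Dz; have := ler_wpM2l N0 (om_le _ Dz); lra.
  have [ze'|ze'] := eqVneq (cabs (z - e)) rho.
    apply: lt_b; rewrite mulr_ge0_le0 // /om ze' subrr sub0r oppr_le0; exact: sum_ge0.
  have [j jn zj] : exists2 j, (j < n)%N & cabs (z - m j) = r j.
    apply: contrapT => nex; apply: nDz; case: Dz => h1 h2 h3; split.
    + by rewrite lt_neqAle eq_sym ze h1.
    + by rewrite lt_neqAle ze' h2.
    + move=> j jn; rewrite lt_neqAle h3 // andbT; apply/eqP => rj.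
      by apply: nex; exists j.
  have [r0 m4 c0 Lc] := hj j jn.
  apply: lt_b; rewrite mulr_ge0_le0 // /om.
  have le1 : ln rho - ln (cabs (z - e)) <= ln (rho / rho').
    rewrite ln_div ?posrE // lerD2l lerN2 ler_ln ?posrE ?De0 //; by case: Dz.
  rewrite subr_le0; apply: le_trans le1 (le_trans Lc _).
  rewrite (bigD1 (Ordinal jn)) //= zj -ln_div ?posrE // lerDl.
  apply: sumr_ge0 => k _; have [_ m4' c0' _] := hj k (ltn_ord k).
  apply: mulr_ge0 => //; rewrite subr_ge0 ler_ln ?posrE ?Dm0 //.
  case: Dz => _ zr _; have := cabsD (z - e) (e - m k); rewrite addrA subrK (cabsB e).
  lra.
Qed.

End two_constants.

Section hull_limit.
Variable R : realType.
Local Notation U := (R[i]^o * R[i]^o)%type.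

Lemma usc_bounded_above (h : U -> \bar R) (a : R) : usc_on setT h -> 0 <= a ->
  exists M : R, forall z w : R[i], cabs z <= a -> cabs w <= a -> (h (z, w) <= M%:E)%E.
Proof.
move=> [hfin husc] a0.
pose X := [set z : R[i]^o | `|Re z| <= a /\ `|Im z| <= a] `*`
          [set z : R[i]^o | `|Re z| <= a /\ `|Im z| <= a].
have cX : compact X by apply: compact_setX; exact: compact_square.
have neX : X !=set0 by exists (0, 0); split; split; rewrite /= normr0.
have [x Xx xmax] := usc_compact_max (H := h) cX neX
  (fun x s Xx hx => ltac:(
     case: s hx => [s| |] hx; [have := husc s; rewrite setTI openE => o;
        apply: filterS (o x hx) => y hy _; exact: hy
     | apply: filterS filterT => y _ _; exact: hfin
     | by move: hx; rewrite ltNge leNye])).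
have hsq (z : R[i]) : cabs z <= a -> `|Re z| <= a /\ `|Im z| <= a.
  by move=> za; split; apply: le_trans za; [exact: Re_le_cabs|exact: Im_le_cabs].
case hxE : (h x) (hfin x I) => [M| |] // _.
  by exists M => z w za wa; rewrite -hxE; apply: xmax; split; exact: hsq.
exists 0 => z w za wa; have := xmax (z, w) (conj (hsq _ za) (hsq _ wa)).
by rewrite hxE leeNy_eq => /eqP ->; rewrite leNye.
Qed.

Lemma closed_circle (e : R[i]^o) (r : R) : closed [set z : R[i]^o | cabs (z - e) = r].
Proof.
rewrite -openC openE => z /= /eqP; rewrite neq_lt => /orP[lt|lt].
  have := nbhs_lt_real (@cabs_sub_continuous R e z) lt.
  by apply: filterS => y /= lt' /eqP; rewrite lt_eqF.
have := nbhs_gt_real (@cabs_sub_continuous R e z) lt.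
by apply: filterS => y /= lt' /eqP; rewrite gt_eqF.
Qed.

(** For each N some G k is so close to f on the inner circle that h < M - N ln (rho / rho') along
    its graph there; the two-constants estimate then bounds h(z0, w0) by M - N delta. Since rG makes
    M independent of k, N may tend to infinity. The value of G k at z0 is fixed because h cannot be
    passed to the limit there. *)
Lemma psh_hull_limit (h : U -> \bar R) (e : R[i]) (rho' rho : R) (nd : nat -> nat)
    (m : nat -> R[i]) (r c : nat -> R) (G : nat -> R[i] -> R[i]) (f : R[i] -> R[i])
    (z0 w0 : R[i]) (rG delta : R) :
  psh setT h -> 0 < rho' -> rho' < rho ->
  (forall k j, (j < nd k)%N -> [/\ 0 < r j, cabs (m j - e) + rho <= 4, 0 <= c j &
     ln (rho / rho') <= c j * ln (4 / r j)]) ->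
  (forall k z, rho' <= cabs (z - e) -> cabs (z - e) <= rho ->
     (forall j, (j < nd k)%N -> r j <= cabs (z - m j)) ->
     tay2 (G k) z /\ cabs (G k z) <= rG) ->
  (forall z, cabs (z - e) = rho' -> forall eps : R, 0 < eps ->
     exists2 d : R, 0 < d & forall z', cabs (z' - z) < d -> cabs (f z' - f z) < eps) ->
  (forall eps : R, 0 < eps -> exists k, forall z, cabs (z - e) = rho' ->
     cabs (G k z - f z) < eps) ->
  (forall z, cabs (z - e) = rho' -> h (z, f z) = -oo%E) ->
  rho' <= cabs (z0 - e) -> cabs (z0 - e) <= rho ->
  (forall k j, (j < nd k)%N -> r j <= cabs (z0 - m j)) ->
  (forall k, G k z0 = w0) ->
  0 < delta ->
  (forall k, delta <= ln (rho / cabs (z0 - e))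
     - \sum_(j < nd k) c j * ln (4 / cabs (z0 - m j))) ->
  h (z0, w0) = -oo%E.
Proof.
move=> hpsh rho'0 rho'rho hj hG cf Gf hf z0l z0r z0m Gz0 delta0 hdelta.
have [hfin husc] := hpsh.1.
pose a := Num.max (cabs e + rho) (`|rG| + 1).
have a0 : 0 <= a by rewrite le_max; apply/orP; right; rewrite addr_ge0.
have [M hM] := usc_bounded_above hpsh.1 a0.
have est N : 0 <= N -> (h (z0, w0) <= (M - N * delta)%:E)%E.
  move=> N0; set L := ln (rho / rho').
  have [eta eta0 heta] : exists2 eta : R, 0 < eta & forall z, cabs (z - e) = rho' ->
      forall w, cabs (w - f z) < eta -> (h (z, w) < (M - N * L)%:E)%E.
    pose Q (d : R) (z : R[i]^o) :=
      forall w : R[i]^o, cabs (w - f z) < d -> (h (z, w) < (M - N * L)%:E)%E.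
    have cE : compact [set z : R[i]^o | cabs (z - e) = rho'].
      apply: (compact_bounded_closed (r := cabs e + rho')); first exact: closed_circle.
      by move=> z /= ze; have := cabsD (z - e) e; rewrite subrK; lra.
    apply: (compact_uniform (Q := Q) cE).
      by move=> d d' z dd q w wd; apply: q; exact: lt_le_trans dd.
    move=> z ze; have lt : (h (z, f z) < (M - N * L)%:E)%E by rewrite hf // ltNyr.
    have := husc (M - N * L); rewrite setTI openE => o.
    have /nbhs_ccP[eps eps0 he] := o _ lt.
    have e2 : 0 < eps / 2 by rewrite divr_gt0.
    have [d d0 dP] := cf _ ze _ e2.
    exists (eps / 2) => //; apply/nbhs_cP; exists (Num.min d eps); first by rewrite lt_min d0.
    move=> z'; rewrite lt_min => /andP[z'd z'e] _ w wz'; apply: he => //=.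
    have := dP _ z'd; have := cabsD (w - f z') (f z' - f z); rewrite addrA subrK; lra.
  have [k hk] := Gf _ eta0.
  have hest := @disc_estimate R h e rho' rho (nd k) m r c (G k) M N rG hpsh rho'0 rho'rho N0 (hj k).
  rewrite -(Gz0 k).
  apply: le_trans (hest _ _ _ _ z0 _) _.
  - by move=> z [h1 h2 h3]; case: (hG k z h1 h2 h3).
  - by move=> z [h1 h2 h3]; case: (hG k z h1 h2 h3).
  - move=> z w [h1 h2 h3] wG; have [_ bG] := hG k z h1 h2 h3.
    apply: hM; rewrite le_max.
      by have := cabsD (z - e) e; rewrite subrK => hz; apply/orP; left; lra.
    have := cabsD (w - G k z) (G k z); rewrite subrK => hw; apply/orP; right.
    by have := ler_norm rG; lra.
  - by move=> z _ ze; apply: ltW; apply: heta => //; exact: hk.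
  - by split=> //; exact: z0m.
  by rewrite lee_fin lerD2l lerN2 ler_wpM2l.
case: (h (z0, w0)) (hfin (z0, w0) I) est => [v| |] // _ est.
have := est (`|M - v| / delta + 1); rewrite lee_fin mulrDl mul1r divfK ?gt_eqF //.
have := ler_norm (M - v); have h0 : 0 <= `|M - v| / delta + 1.
  by rewrite addr_ge0 // divr_ge0 // ltW.
by move=> h1 /(_ h0) h2; exfalso; lra.
Qed.

End hull_limit.

(** * Cantor sets with prescribed gap lengths *)

Section cantor_construction.
Variable R : realType.
Implicit Types (s : seq (R * R)) (x y : R).

(** The value 0 fills the codes that give no rational of ]-1, 1[, so that every term is a point at
    which a gap can be centred. *)
Let q (k : nat) : R :=
  if @choice.unpickle rat k is Some r then (if -1 < (ratr (r : rat) : R) < 1 then ratr r else 0) else 0.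

Let q_itv k : -1 < q k < 1.
Proof.
rewrite /q; case: (choice.unpickle k) => [r|]; last by rewrite ltrN10 ltr01.
by case: ifP => // _; rewrite ltrN10 ltr01.
Qed.

Let q_dense x y : -1 <= x -> x < y -> y <= 1 -> exists k, x < q k < y.
Proof.
move=> x1 xy y1; have [r] := rat_in_itvoo xy; rewrite in_itv /= => /andP[xr ry].
exists (choice.pickle r); rewrite /q choice.pickleK ifT ?xr //.
by rewrite (le_lt_trans x1 xr) (lt_le_trans ry y1).
Qed.

Let covered s x := has (fun p : R * R => p.1 <= x <= p.2) s.

Let valid s := forall p, p \in s -> [/\ -1 < p.1, p.1 < p.2 & p.2 < 1].

(* The next gap covers the first point of the enumeration [q] of the rationals not
   yet covered: this makes the union of the gaps dense. *)
Let good (eps : nat -> R) s (p : R * R) :=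
  [/\ [/\ -1 < p.1, p.1 < p.2 & p.2 < 1],
      forall p', p' \in s -> p'.2 < p.1 \/ p.2 < p'.1,
      p.2 - p.1 <= eps (size s).+1,
      forall p' s', s = p' :: s' -> p.2 - p.1 <= (p'.2 - p'.1) / 2 &
      forall k, (forall i, (i < k)%N -> covered s (q i)) ->
        covered s (q k) \/ p.1 <= q k <= p.2].

Let exists_good eps s : (forall j, 0 < eps j) -> valid s -> exists p, good eps s p.
Proof.
move=> eps0 vs.
(* All gaps chosen so far start at t or later, so the rationals of ]-1, t[ are uncovered and there
   is a next point to cover. *)
have [t [t1 t1' tP]] : exists t, [/\ -1 < t, t <= 1 & forall p, p \in s -> t <= p.1].
  elim: s vs => [|p s IH] vs; first by exists 1; split => //; lra.
  have [|t [t1 t1' tP]] := IH; first by move=> p' p's; apply: vs; rewrite inE p's orbT.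
  have [p1 p2 p3] := vs p (mem_head _ _).
  exists (Num.min t p.1); split; first by rewrite lt_min t1.
    by rewrite ge_min t1'.
  by move=> p'; rewrite inE ge_min => /predU1P[->|/tP ->//]; rewrite lexx orbT.
have ex : exists k, ~~ covered s (q k).
  have [k /andP[k1 k2]] := q_dense (lexx _) t1 t1'.
  exists k; apply/hasPn => p /tP tp; rewrite negb_and -ltNge.
  by rewrite (lt_le_trans k2 tp).
case: (ex_minnP ex) => k kc kmin; set c := q k in kc.
have [d d0 dP] : exists2 d, 0 < d & forall p, p \in s -> p.2 < c - d \/ c + d < p.1.
  elim: s kc {vs tP ex kmin} => [|p s IH]; first by exists 1.
  rewrite /covered /= negb_or => /andP[pc /IH[d d0 dP]].
  have [d' d'0 d'P] : exists2 d', 0 < d' & p.2 < c - d' \/ c + d' < p.1.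
    move: pc; rewrite negb_and -!ltNge => /orP[lt|lt].
      by exists ((p.1 - c) / 2); [lra|right; lra].
    by exists ((c - p.2) / 2); [lra|left; lra].
  exists (Num.min d d'); first by rewrite lt_min d0.
  have m1 : Num.min d d' <= d by rewrite ge_min lexx.
  have m2 : Num.min d d' <= d' by rewrite ge_min lexx orbT.
  move=> p'; rewrite inE => /predU1P[->|/dP]; [case: d'P|case]; by [left; lra|right; lra].
have [l l0 lP] : exists2 l, 0 < l & forall p' s', s = p' :: s' -> l <= (p'.2 - p'.1) / 2.
  case: s vs {tP ex kc kmin dP} => [|p s] vs; first by exists 1.
  have [_ p12 _] := vs p (mem_head _ _).
  exists ((p.2 - p.1) / 2); first by lra.
  by move=> p' s' [-> _].
have /andP[c1 c2] := q_itv k; rewrite -/c in c1 c2.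
(* One radius for all clauses: d keeps away from the earlier gaps, eps bounds the length, l halves
   the previous length, and the last two terms keep the gap inside ]-1, 1[. *)
pose e := Num.min (Num.min (d / 2) (eps (size s).+1 / 2)) (Num.min (l / 2) (Num.min ((c + 1) / 2) ((1 - c) / 2))).
have e0 : 0 < e by have := eps0 (size s).+1; rewrite !lt_min => ?; do ![apply/andP; split]; lra.
have : e <= e by []; rewrite {2}/e !le_min => /andP[/andP[ed ee] /andP[el /andP[ec1 ec2]]].
exists (c - e, c + e); split => /=.
- by split; lra.
- by move=> p' /dP[h|h]; [left|right]; lra.
- lra.
- by move=> p' s' /lP; lra.
move=> i hi; case: (ltngtP i k) => ik; last first.
- by right; rewrite ik -/c; lra.
- by move: kc; rewrite (hi _ ik).
left; apply: contraT => nc; have := kmin _ nc; by rewrite leqNgt ik.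
Qed.

Lemma cantor_gaps_exist (eps : nat -> R) : (forall j, 0 < eps j) ->
  exists a b : nat -> R, [/\ a 0%N = -1 /\ b 0%N = 1,
    forall j, (0 < j)%N -> [/\ -1 < a j, a j < b j, b j < 1 & b j - a j <= eps j],
    forall j, (0 < j)%N -> b j.+1 - a j.+1 <= (b j - a j) / 2,
    forall i j, (0 < i)%N -> (0 < j)%N -> i != j -> b i < a j \/ b j < a i &
    forall x y, -1 <= x -> x < y -> y <= 1 ->
      exists2 j, (0 < j)%N & exists2 t, a j < t < b j & x < t < y].
Proof.
move=> eps0.
have ex s : exists p, valid s -> good eps s p.
  have [vs|nvs] := pselect (valid s); last by exists (0, 0).
  by have [p gp] := exists_good eps0 vs; exists p.
have [next nextP] := choice ex.
pose st := fix st n := if n is n'.+1 then next (st n') :: st n' else [::].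
have st_valid n : valid (st n).
  elim: n => [|n IH] p; first by rewrite in_nil.
  rewrite inE => /predU1P[->|]; last exact: IH.
  by have [] := nextP _ IH.
have st_size n : size (st n) = n by elim: n => //= n ->.
have st_good n : good eps (st n) (next (st n)) by apply: nextP.
pose a n := if n is n'.+1 then (next (st n')).1 else -1.
pose b n := if n is n'.+1 then (next (st n')).2 else 1.
have in_st i n : (i < n)%N -> next (st i) \in st n.
  elim: n => // n IH; rewrite ltnS leq_eqVlt inE => /predU1P[->|/IH ->]; first by rewrite eqxx.
  by rewrite orbT.
have st_in n p : p \in st n -> exists2 i, (i < n)%N & p = next (st i).
  elim: n => // n IH; rewrite inE => /predU1P[->|/IH[i ni ->]]; first by exists n.
  by exists i => //; exact: ltnW.
exists a, b; split => //.
- move=> [//|j] _ /=; have [[h1 h2 h3] _ h4 _ _] := st_good j.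
  by rewrite st_size in h4; split.
- move=> [//|j] _ /=; have [_ _ _ h _] := st_good j.+1; exact: h.
- have main i j : (i < j)%N -> b i.+1 < a j.+1 \/ b j.+1 < a i.+1.
    by move=> ij; have [_ h _ _ _] := st_good j; exact: (h _ (in_st _ _ ij)).
  move=> [//|i] [//|j] _ _; rewrite eqSS neq_ltn => /orP[/main //|/main[]]; tauto.
(* Each new gap covers the next point of the enumeration unless it is already covered, so any
   initial segment of it is covered after finitely many steps. *)
- have cov k : exists n, forall i, (i < k)%N -> covered (st n) (q i).
    elim: k => [|k [n IH]]; first by exists 0%N.
    have [_ _ _ _ /(_ k IH) ck] := st_good n.
    exists n.+1 => i; rewrite ltnS leq_eqVlt => /predU1P[->|/IH h]; apply/orP; last by right.
    by case: ck => h; [right|left].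
  move=> x y x1 xy y1; have [k /andP[xk ky]] := q_dense x1 xy y1.
  have [n /(_ k (ltnSn k)) /hasP[p /st_in[j jn ->] /andP[p1 p2]]] := cov k.+1.
  have [_ p12 _] := st_valid n.+1 _ (in_st j n.+1 (leqW jn)).
  exists j.+1 => //=.
  set u := (next (st j)).1 in p1 p12 *; set v := (next (st j)).2 in p2 p12 *.
  (* The point q k is only known to lie in the closed gap, possibly at an end; still the open gap
     meets the open interval ]x, y[ around it. *)
  have lt : Num.max x u < Num.min y v by rewrite gt_max !lt_min; do ![apply/andP; split]; lra.
  exists ((Num.max x u + Num.min y v) / 2).
    have m1 : u <= Num.max x u by rewrite le_max lexx orbT.
    have m2 : Num.min y v <= v by rewrite ge_min lexx orbT.
    by apply/andP; split; lra.
  have m1 : x <= Num.max x u by rewrite le_max lexx.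
  have m2 : Num.min y v <= y by rewrite ge_min lexx.
  by apply/andP; split; lra.
Qed.

End cantor_construction.

(** * The compact perfect set that the gaps leave *)

Section cantor_set.
Variables (R : realType) (a b : nat -> R).
Hypotheses (a0 : a 0%N = -1) (b0 : b 0%N = 1).
Hypothesis ab : forall j, (0 < j)%N -> [/\ -1 < a j, a j < b j & b j < 1].
Hypothesis len : forall j, (0 < j)%N -> b j.+1 - a j.+1 <= (b j - a j) / 2.
Hypothesis disj : forall i j, (0 < i)%N -> (0 < j)%N -> i != j -> b i < a j \/ b j < a i.
Hypothesis dense : forall x y, -1 <= x -> x < y -> y <= 1 ->
  exists2 j, (0 < j)%N & exists2 t, a j < t < b j & x < t < y.

Definition gap_set : set R := \bigcup_(j in [set j | (0 < j)%N]) `]a j, b j[.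
Definition cantor_of : set R := `[a 0%N, b 0%N] `\` gap_set.

Lemma cantor_ofP x : cantor_of x <->
  -1 <= x <= 1 /\ forall j, (0 < j)%N -> x <= a j \/ b j <= x.
Proof.
rewrite /cantor_of a0 b0; split=> [[/= x1 nx]|[x1 nx]].
  split; first by rewrite in_itv /= in x1.
  move=> j j0; have [xa|xa] := leP x (a j); first by left.
  have [bx|bx] := leP (b j) x; first by right.
  by exfalso; apply: nx; exists j => //=; rewrite in_itv /= xa.
split; first by rewrite /= in_itv.
by move=> [j /= j0]; rewrite in_itv /= => /andP[h1 h2]; have [] := nx j j0; lra.
Qed.

Lemma cantor_of_endpoints j : (0 < j)%N -> cantor_of (a j) /\ cantor_of (b j).
Proof.
move=> j0; have [h1 h2 h3] := ab j0.
split; apply/cantor_ofP; split; try (apply/andP; split; lra); move=> i i0;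
  have [->|ij] := eqVneq i j; try (by [left|right]);
  have [_ h _] := ab i0; have [] := disj i0 j0 ij; by [left; lra|right; lra].
Qed.

Lemma cantor_of_bounds : cantor_of (-1) /\ cantor_of 1.
Proof.
by split; apply/cantor_ofP; (split; first by apply/andP; split; lra) => j j0;
  have [h1 h2 h3] := ab j0; [left|right]; lra.
Qed.

Lemma closed_cantor_of : closed cantor_of.
Proof.
rewrite /cantor_of setDE; apply: closedI; first exact: itv_closed.
by apply: open_closedC; apply: bigcup_open => j _; exact: itv_open.
Qed.

(** From the right, x is approached by left ends of gaps, unless x is 1 or itself a left end; in
    these cases right ends of gaps approach it from the left. The density of the gaps provides such
    ends. *)
Lemma cantor_of_limit x : cantor_of x -> forall e, 0 < e ->
  exists y, [/\ cantor_of y, y != x & `|y - x| < e].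
Proof.
move=> Kx e e0; have /cantor_ofP[/andP[x1 x2] nx] := Kx.
have [[xlt xa]|right] := pselect (x < 1 /\ forall j, (0 < j)%N -> x != a j).
  pose y := Num.min 1 (x + e).
  have xy : x < y by rewrite lt_min xlt ltrDl.
  have y1 : y <= 1 by rewrite ge_min lexx.
  have ye : y <= x + e by rewrite ge_min lexx orbT.
  have [j j0 [t /andP[at_ tb] /andP[xt ty]]] := dense x1 xy y1.
  exists (a j); split; first exact: (cantor_of_endpoints j0).1.
    by rewrite eq_sym; exact: xa.
  have := xa j j0; rewrite neq_lt; have [h|h] := nx j j0; last by lra.
  by case/orP => h'; rewrite ger0_norm; lra.
(* A point that is 1 or a left end is neither -1 nor a right end, the closed gaps being disjoint and
   inside ]-1, 1[. *)
have [xgt xb] : -1 < x /\ forall j, (0 < j)%N -> x != b j.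
  have [xlt|x1'] := ltP x 1.
    have [i i0 xi] : exists2 i, (0 < i)%N & x = a i.
      apply: contrapT => ni; apply: right; split=> // j j0; apply/eqP => xj.
      by apply: ni; exists j.
    have [h1 h2 h3] := ab i0; split; first by rewrite xi.
    move=> j j0; rewrite xi; have [<-|ij] := eqVneq i j; first by rewrite lt_eqF.
    have [_ h2' _] := ab j0.
    by have [h|h] := disj i0 j0 ij; [rewrite lt_eqF|rewrite gt_eqF] => //; lra.
  split; first by lra.
  by move=> j j0; have [h1 h2 h3] := ab j0; rewrite gt_eqF //; lra.
pose y := Num.max (-1) (x - e).
have yx : y < x by rewrite gt_max xgt gtrBl.
have y1 : -1 <= y by rewrite le_max lexx.
have ye : x - e <= y by rewrite le_max lexx orbT.
have [j j0 [t /andP[at_ tb] /andP[yt tx]]] := dense y1 yx x2.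
exists (b j); split; first exact: (cantor_of_endpoints j0).2.
  by rewrite eq_sym; exact: xb.
have := xb j j0; rewrite neq_lt; have [h|h] := nx j j0; first by lra.
by case/orP => h'; rewrite ltr0_norm; lra.
Qed.

Lemma cantor_type_cantor_of : cantor_type_set cantor_of.
Proof.
split.
- by exists 1; exact: cantor_of_bounds.2.
- apply: (subclosed_compact closed_cantor_of (@segment_compact _ (a 0%N) (b 0%N))).
  by move=> x [].
- split; first exact: closed_cantor_of.
  apply/seteqP; split=> x.
    move=> lx; apply: closed_cantor_of => B /lx[y [yx Ky By]].
    by exists y.
  move=> Kx B /nbhs_ballP[e /= e0 eB].
  have [y [Ky yx ye]] := cantor_of_limit Kx e0.
  by exists y; split => //; apply: eB; rewrite /ball /= distrC.
- apply/seteqP; split=> // x /nbhs_ballP[e /= e0 eK].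
  have xK : cantor_of x by apply: eK; exact: ballxx.
  have /cantor_ofP[/andP[x1 x2] _] := xK.
  have K1 : cantor_of (x + e / 2) by apply: eK; rewrite /ball /= opprD addrA subrr sub0r normrN gtr0_norm; lra.
  have /cantor_ofP[/andP[y1 y2] _] := K1.
  have lt : x < x + e / 2 by lra.
  have [j j0 [t /andP[t1 t2] /andP[t3 t4]]] := dense x1 lt y2.
  have : cantor_of t by apply: eK; rewrite /ball /= ltr0_norm; lra.
  by move/cantor_ofP => [_ /(_ j j0)] []; lra.
Qed.

Lemma gap_length_nonincreasing j k : (0 < j)%N -> (j <= k)%N -> b k - a k <= b j - a j.
Proof.
move=> j0; elim: k => [|k IH]; first by rewrite leqn0 => /eqP ->.
rewrite leq_eqVlt => /predU1P[->//|]; rewrite ltnS => jk.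
have k0 : (0 < k)%N by exact: leq_trans jk.
have := IH jk; have := len k0; have [_ h _] := ab k0; lra.
Qed.

Lemma cantor_gaps_cantor_of : cantor_gaps cantor_of a b.
Proof.
split => //.
- by move=> j j0; have [h1 h2 h3] := ab j0; rewrite a0 b0; split; lra.
- move=> i j /= i0 j0 [x []].
  have cl k : (0 < k)%N -> closure `]a k, b k[ `<=` `[a k, b k].
    move=> k0; rewrite closureE; apply: smallest_sub; first exact: itv_closed.
    by apply: subset_itv; rewrite bnd_simp.
  move=> /(cl i i0); rewrite /= in_itv /= => /andP[h1 h2].
  move=> /(cl j j0); rewrite /= in_itv /= => /andP[h3 h4].
  by apply: contrapT => /eqP ij; have [] := disj i0 j0 ij; lra.
- rewrite a0 b0 => x; rewrite /= in_itv /= => /andP[x1 x2] B /nbhs_ballP[e /= e0 eB].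
  have [z1 [z2 [h1 h2 h3 h4]]] : exists z1 z2, [/\ -1 <= z1, z1 < z2, z2 <= 1 &
      forall t, z1 < t < z2 -> `|x - t| < e].
    have [xlt|x1'] := ltP x 1.
      exists x, (Num.min 1 (x + e)); split=> //.
      - by rewrite lt_min xlt ltrDl.
      - by rewrite ge_min lexx.
      - by move=> t /andP[t1]; rewrite lt_min => /andP[t2 t3]; rewrite ltr0_norm; lra.
    exists (Num.max (-1) (x - e)), x; split=> //.
    - by rewrite le_max lexx.
    - by rewrite gt_max; apply/andP; split; lra.
    - by move=> t /andP[]; rewrite gt_max => /andP[t1 t2] t3; rewrite gtr0_norm; lra.
  have [j j0 [t t1 t2]] := dense h1 h2 h3.
  exists t; split; first by exists j => //=; rewrite in_itv.
  by apply: eB; exact: h4.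
- exact: gap_length_nonincreasing.
Qed.

End cantor_set.

(** * Second-order expansions and branches of square roots *)

Section taylor.
Variable R : realType.
Implicit Types (z w l : R[i]) (F G : R[i] -> R[i]).

Lemma tay2_cst (c : R[i]) z : tay2 (fun=> c) z.
Proof.
exists 0, 0, 0, 1; split=> // l _.
by rewrite !mul0r !subr0 subrr cabs0.
Qed.

Lemma tay2_congr F G z (d : R) : 0 < d -> (forall w, cabs (w - z) < d -> F w = G w) ->
  tay2 F z -> tay2 G z.
Proof.
move=> d0 FG [A [B [K [rho [rho0 K0 h]]]]].
exists A, B, K, (Num.min d rho); split; rewrite ?lt_min ?d0 // => l.
rewrite lt_min => /andP[ld lr]; rewrite -FG; last by rewrite [z + l]addrC addrK.
by rewrite -FG; [exact: h|rewrite subrr cabs0].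
Qed.

Lemma tay2_mul F G z : tay2 F z -> tay2 G z -> tay2 (fun w => F w * G w) z.
Proof.
move=> [A [B [K [rho [rho0 K0 h]]]]] [A' [B' [K' [rho' [rho'0 K'0 h']]]]].
pose N (x : R[i]) := cabs x.
have N0 x : 0 <= N x by exact: cabs_ge0.
pose K2 := N A * N B' + N B * N A' + N B * N B' + K * (N (G z) + N A' + N B' + K')
  + (N (F z) + N A + N B) * K'.
exists (A * G z + F z * A'), (B * G z + A * A' + F z * B'), K2, (Num.min 1 (Num.min rho rho')).
have K20 : 0 <= K2 by rewrite /K2 !addr_ge0 ?mulr_ge0 ?addr_ge0 ?N0.
split; rewrite ?lt_min ?rho0 ?rho'0 ?ltr01 // => l.
rewrite !lt_min => /andP[l1 /andP[lr lr']].
have hl := h l lr; have hl' := h' l lr'.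
set P := F (z + l) - F z - A * l - B * l ^+ 2 in hl.
set P' := G (z + l) - G z - A' * l - B' * l ^+ 2 in hl'.
have -> : F (z + l) * G (z + l) - F z * G z - (A * G z + F z * A') * l
    - (B * G z + A * A' + F z * B') * l ^+ 2
  = (A * B' + B * A') * l ^+ 3 + B * B' * l ^+ 4
    + P * (G z + A' * l + B' * l ^+ 2 + P') + (F z + A * l + B * l ^+ 2) * P'.
  by rewrite /P /P'; ring.
have l0 := cabs_ge0 l; set x := cabs l in l0 l1 hl hl'.
have x2 : x ^+ 2 <= 1 by rewrite exprn_ile1 // ltW.
have x3 : x ^+ 3 <= 1 by rewrite exprn_ile1 // ltW.
have x30 : 0 <= x ^+ 3 by rewrite exprn_ge0.
have x4 : x ^+ 4 <= x ^+ 3 by rewrite exprS ler_piMl // ltW.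
have b1 : cabs ((A * B' + B * A') * l ^+ 3) <= (N A * N B' + N B * N A') * x ^+ 3.
  rewrite cabsM cabsX ler_wpM2r //.
  by apply: le_trans (cabsD _ _) _; rewrite !cabsM.
have b2 : cabs (B * B' * l ^+ 4) <= N B * N B' * x ^+ 3.
  by rewrite cabsM cabsX (cabsM B) ler_wpM2l // mulr_ge0.
have lin (C D E : R[i]) : cabs (C + D * l + E * l ^+ 2) <= N C + N D + N E.
  apply: le_trans (cabsD _ _) _; apply: lerD; last first.
    by rewrite cabsM cabsX ler_piMr // cabs_ge0.
  apply: le_trans (cabsD _ _) _; rewrite lerD2l cabsM ler_piMr ?cabs_ge0 //.
  exact: ltW.
have b3 : cabs (P * (G z + A' * l + B' * l ^+ 2 + P'))
    <= K * (N (G z) + N A' + N B' + K') * x ^+ 3.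
  rewrite cabsM mulrAC; apply: ler_pM; rewrite ?cabs_ge0 //.
  apply: le_trans (cabsD _ _) _; apply: lerD; first exact: lin.
  by apply: le_trans hl' _; rewrite ler_piMr.
have b4 : cabs ((F z + A * l + B * l ^+ 2) * P') <= (N (F z) + N A + N B) * K' * x ^+ 3.
  by rewrite cabsM -mulrA; apply: ler_pM; rewrite ?cabs_ge0.
apply: le_trans (cabsD _ _) _; rewrite /K2 !(mulrDl _ _ (x ^+ 3)).
apply: lerD => //; apply: le_trans (cabsD _ _) _; apply: lerD => //.
by apply: le_trans (cabsD _ _) _; rewrite -mulrDl; apply: lerD.
Qed.

Lemma tay2_prod (n : nat) (F : nat -> R[i] -> R[i]) z :
  (forall j, (j < n)%N -> tay2 (F j) z) -> tay2 (fun w => \prod_(j < n) F j w) z.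
Proof.
elim: n => [|n IH] h.
  apply: (@tay2_congr (fun=> 1) _ _ 1) => // [w _|]; last exact: tay2_cst.
  by rewrite big_ord0.
apply: (@tay2_congr (fun w => \prod_(j < n) F j w * F n w) _ _ 1) => // [w _|].
  by rewrite big_ord_recr.
by apply: tay2_mul; [apply: IH => j jn; apply: h; rewrite ltnS ltnW|exact: h].
Qed.

Lemma tay2_addcst F (c : R[i]) z : tay2 F z -> tay2 (fun w => F w + c) z.
Proof.
move=> [A [B [K [rho [rho0 K0 h]]]]]; exists A, B, K, rho; split=> // l lr.
have -> : F (z + l) + c - (F z + c) = F (z + l) - F z by ring.
exact: h.
Qed.

Lemma tay2_inv (c : R[i]) z : z != c -> tay2 (fun w => (w - c)^-1) z.
Proof.
rewrite -subr_eq0 => d0; set d := z - c in d0.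
have dn0 : 0 < cabs d by rewrite cabs_gt0.
exists (- d ^- 2), (d ^- 3), (2 / cabs d ^+ 4), (cabs d / 2); split.
- by rewrite divr_gt0.
- by rewrite divr_ge0 // exprn_ge0 // ltW.
move=> l ld; have dl : cabs d / 2 <= cabs (d + l).
  by have := cabsD (d + l) (- l); rewrite addrK cabsN; lra.
have dl0 : d + l != 0 by rewrite -cabs_gt0; apply: lt_le_trans dl; rewrite divr_gt0.
have -> : z + l - c = d + l by rewrite /d; ring.
have -> : (d + l)^-1 - d^-1 - - d ^- 2 * l - d ^- 3 * l ^+ 2 = - l ^+ 3 / (d ^+ 3 * (d + l)).
  by field; rewrite d0 dl0.
rewrite cabs_div cabsN cabsX cabsM cabsX [leRHS]mulrC ler_wpM2l ?exprn_ge0 ?cabs_ge0 //.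
have d4 : 0 < cabs d ^+ 4 / 2 by rewrite divr_gt0 ?exprn_gt0.
have d34 : cabs d ^+ 4 / 2 <= cabs d ^+ 3 * cabs (d + l).
  by rewrite exprSr -mulrA ler_wpM2l // exprn_ge0 // ltW.
by rewrite -invf_div lef_pV2 // posrE // (lt_le_trans d4).
Qed.

Lemma tay2_moebius (p q : R[i]) z : z != q -> tay2 (fun w => (w - p) / (w - q)) z.
Proof.
move=> zq; have zq0 : 0 < cabs (z - q) by rewrite cabs_gt0 subr_eq0.
apply: (@tay2_congr (fun w => (q - p) * (w - q)^-1 + 1) _ _ (cabs (z - q))) => //.
  move=> w wz; have wq : w - q != 0.
    rewrite -cabs_gt0; have := cabsD (w - q) (z - w).
    have -> : w - q + (z - w) = z - q by ring.
    by rewrite (cabsB z w); lra.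
  by field.
apply: tay2_addcst; apply: tay2_mul; first exact: tay2_cst.
exact: tay2_inv.
Qed.

(** Let T be the quadratic polynomial whose square matches m to second order. Then T^2 - F^2 is of
    third order, and T + F is bounded away from 0 because F has positive real part and T stays near
    F z; dividing gives the expansion. *)
Lemma tay2_sqrt F (m : R[i] -> R[i]) z (d : R) : 0 < d ->
  (forall w, cabs (w - z) < d -> F w ^+ 2 = m w /\ 0 < Re (F w)) ->
  tay2 m z -> tay2 F z.
Proof.
move=> d0 hF [A [B [K [rho [rho0 K0 h]]]]].
have [F2 F0] : F z ^+ 2 = m z /\ 0 < Re (F z) by apply: hF; rewrite subrr cabs0.
set s := F z in F2 F0; set rs := Re s in F0.
have s0 : s != 0 by apply: contraTneq F0 => s0; rewrite /rs s0 ltxx.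
pose c1 := A / (2 * s); pose c2 := (B - c1 ^+ 2) / (2 * s).
pose Kt := K + 2 * cabs c1 * cabs c2 + cabs c2 ^+ 2.
have n1 := cabs_ge0 c1; have n2 := cabs_ge0 c2.
have Kt0 : 0 <= Kt by rewrite /Kt !addr_ge0 ?mulr_ge0 ?exprn_ge0.
exists c1, c2, (Kt / (rs / 2)), (Num.min (Num.min d rho) (Num.min 1 (rs / (2 * (cabs c1 + cabs c2 + 1))))).
have k1 : 0 < 2 * (cabs c1 + cabs c2 + 1) by lra.
split; first by rewrite !lt_min d0 rho0 ltr01 divr_gt0.
  by rewrite divr_ge0 // divr_ge0 // ltW.
move=> l; rewrite !lt_min => /andP[/andP[ld lr] /andP[l1 lc]].
have [Fl2 Fl0] : F (z + l) ^+ 2 = m (z + l) /\ 0 < Re (F (z + l)).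
  by apply: hF; rewrite [z + l]addrC addrK.
set t := F (z + l) in Fl2 Fl0 *.
pose T := s + c1 * l + c2 * l ^+ 2.
have -> : t - s - c1 * l - c2 * l ^+ 2 = - (T - t) by rewrite /T; ring.
have x0 := cabs_ge0 l; set x := cabs l in x0 l1 lc.
have x21 : x ^+ 2 <= x by rewrite expr2 ler_piMl // ltW.
have x30 : 0 <= x ^+ 3 by rewrite exprn_ge0.
have x4 : x ^+ 4 <= x ^+ 3 by rewrite exprS ler_piMl // ltW.
have Ts : cabs (T - s) <= rs / 2.
  have -> : T - s = c1 * l + c2 * l ^+ 2 by rewrite /T; ring.
  apply: le_trans (cabsD _ _) _; rewrite (cabsM c2) cabsX cabsM -/x.
  by move: lc; rewrite ltr_pdivlMr //; nra.
have Tt : rs / 2 <= cabs (T + t).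
  apply: le_trans (le_trans (ler_norm _) (Re_le_cabs _)); rewrite ReD.
  have := Re_le_cabs (T - s); rewrite ReB ler_norml -/rs => /andP[h1 _]; lra.
have TtE : (T - t) * (T + t) = 2 * c1 * c2 * l ^+ 3 + c2 ^+ 2 * l ^+ 4
   - (m (z + l) - m z - A * l - B * l ^+ 2).
  have -> : (T - t) * (T + t) = T ^+ 2 - t ^+ 2 by ring.
  rewrite Fl2 -F2 /T /c2 /c1; field; exact: s0.
have := h l lr; rewrite -/x => hl.
have bnd : cabs ((T - t) * (T + t)) <= Kt * x ^+ 3.
  rewrite TtE; apply: le_trans (cabsD _ _) _; rewrite cabsN.
  apply: (@le_trans _ _ ((2 * cabs c1 * cabs c2 + cabs c2 ^+ 2) * x ^+ 3 + K * x ^+ 3)).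
    apply: lerD => //; apply: le_trans (cabsD _ _) _; rewrite [leRHS]mulrDl; apply: lerD.
      rewrite (cabsM _ (l ^+ 3)) cabsX (cabsM _ c2) (cabsM 2).
      have -> : cabs (2 : R[i]) = 2.
        by rewrite -[2 : R[i]]/((1 + 1) : R[i]) /cabs /= addr0 expr0n /= addr0 sqrtr_sqr ger0_norm.
      by [].
    by rewrite cabsM !cabsX ler_wpM2l // exprn_ge0.
  by rewrite /Kt; lra.
rewrite cabsN mulrAC ler_pdivlMr ?divr_gt0 //; apply: le_trans bnd.
by rewrite cabsM ler_wpM2l // cabs_ge0.
Qed.

Lemma peano_derivable (f : R[i]^o -> R[i]^o) (z : R[i]^o) (A : R[i]) :
  (forall eps : R, 0 < eps -> exists2 d : R, 0 < d &
    forall l : R[i], cabs l < d -> cabs (f (z + l) - f z - A * l) <= eps * cabs l) ->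
  derivable f z 1.
Proof.
move=> h; apply/cvg_ex; exists (A : R[i]^o).
apply/cvg_complexP => eps eps0.
have e2 : 0 < eps / 2 by rewrite divr_gt0.
have [d d0 hd] := h _ e2.
rewrite /dnbhs /within /=; apply/nbhs_cP; exists d => // l; rewrite subr0 => ld l0.
have -> : l^-1 *: (f (l *: 1 + z) - f z) - A = (f (z + l) - f z - A * l) / l.
  rewrite /GRing.scale /= mulr1 [l + z]addrC; field; exact: l0.
rewrite cabs_div ltr_pdivrMr ?cabs_gt0 //; apply: le_lt_trans (hd _ ld) _.
by rewrite ltr_pM2r ?cabs_gt0 //; lra.
Qed.

Lemma tay2_peano F z : tay2 F z -> exists A : R[i], forall eps : R, 0 < eps ->
  exists2 d : R, 0 < d &
    forall l : R[i], cabs l < d -> cabs (F (z + l) - F z - A * l) <= eps * cabs l.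
Proof.
move=> [A [B [K [rho [rho0 K0 h]]]]]; exists A => eps eps0.
have k0 : 0 < cabs B + K + 1 by have := cabs_ge0 B; lra.
exists (Num.min (Num.min rho 1) (eps / (cabs B + K + 1))).
  by rewrite !lt_min rho0 ltr01 divr_gt0.
move=> l; rewrite !lt_min ltr_pdivlMr // => /andP[/andP[lr l1] le].
have := h l lr; have := cabsD (F (z + l) - F z - A * l - B * l ^+ 2) (B * l ^+ 2).
rewrite subrK cabsM cabsX; have x0 := cabs_ge0 l; set x := cabs l in x0 l1 le *.
have x3 : x ^+ 3 <= x ^+ 2 by rewrite exprS ler_piMl ?sqr_ge0 // ltW.
have := ler_wpM2l K0 x3 => h1 h2 h3; have B0 := cabs_ge0 B.
have h4 : x * (x * (cabs B + K + 1)) <= x * eps by rewrite ler_wpM2l // ltW.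
have := sqr_ge0 x; nra.
Qed.

End taylor.

(** * The branch of the square root of (z - p) / (z - q) off a segment *)

Section sqrt_branch.
Variable R : realType.
Implicit Types (z w : R[i]) (p q : R).

(* Each root is cut along a ray of the real axis, but the cuts cancel off [p, q]. *)
Definition sb p q z : R[i] := sqrtc (z - p%:C) / sqrtc (z - q%:C).

(** Symmetric in p and q, since the factors of f_n have p <= q while the factor [sb (b j) (a j)]
    contributed by a gap has its larger point first. *)
Definition off p q z := Im z != 0 \/ (Re z < p /\ Re z < q) \/ (p < Re z /\ q < Re z).

Lemma sqrtc_uniq (x y : R[i]) : 0 < Re y -> y ^+ 2 = x -> sqrtc x = y.
Proof.
move=> y0 yx; have : (sqrtc x - y) * (sqrtc x + y) = 0.
  have -> : (sqrtc x - y) * (sqrtc x + y) = sqrtc x ^+ 2 - y ^+ 2 by ring.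
  by rewrite sqr_sqrtc yx subrr.
move/eqP; rewrite mulf_eq0 subr_eq0 addr_eq0 => /orP[/eqP //|/eqP e].
have : 0 <= Re (sqrtc x) by case: (x) => [u v] /=; rewrite sqrtr_ge0.
have -> : Re (sqrtc x) = - Re y by rewrite e; case: (y).
by rewrite oppr_ge0 leNgt y0.
Qed.

Lemma Re_div_gt0 (u v : R[i]) : v != 0 -> 0 < Re u * Re v + Im u * Im v -> 0 < Re (u / v).
Proof.
move=> v0 uv; have vv : 0 < Re v ^+ 2 + Im v ^+ 2.
  by rewrite -cabs_sqr exprn_gt0 // cabs_gt0.
have : 0 < (Re u * Re v + Im u * Im v) / (Re v ^+ 2 + Im v ^+ 2) by rewrite divr_gt0.
have -> : (Re u * Re v + Im u * Im v) / (Re v ^+ 2 + Im v ^+ 2) = Re (u / v).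
  by case: u v {uv v0 vv} => [a b] [c d] /=; ring.
by [].
Qed.

(** Two numbers with the same imaginary part b have principal roots in the same closed quadrant, and
    for b = 0 on the same half axis if their signs agree; so the scalar product of the roots is
    positive. *)
Lemma sqrtc_same_side (a1 a2 b : R) : b != 0 \/ (0 < a1 /\ 0 < a2) \/ (a1 < 0 /\ a2 < 0) ->
  0 < Re (sqrtc (a1 +i* b)) * Re (sqrtc (a2 +i* b))
      + Im (sqrtc (a1 +i* b)) * Im (sqrtc (a2 +i* b)).
Proof.
move=> h; rewrite /=.
have r_gt a : b != 0 -> `|a| < Num.sqrt (a ^+ 2 + b ^+ 2).
  move=> b0; have b2 : 0 < b ^+ 2 by rewrite exprn_even_gt0.
  by rewrite -sqrtr_sqr ltr_sqrt ?ltrDl // ltr_wpDl ?sqr_ge0.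
have [b0|b0] := eqVneq b 0.
  rewrite b0 !expr0n /= !addr0 !sqrtr_sqr !mul1r; case: h => [|[[h1 h2]|[h1 h2]]].
  - by rewrite b0 eqxx.
  - rewrite !gtr0_norm // !subrr !mul0r sqrtr0 mulr0 addr0.
    by rewrite mulr_gt0 // sqrtr_gt0 divr_gt0 // addr_gt0.
  - rewrite !ltr0_norm // !addNr !mul0r sqrtr0 mul0r add0r.
    by rewrite mulr_gt0 // sqrtr_gt0 divr_gt0 // -opprD oppr_gt0 -mulr2n pmulrn_llt0.
apply: ltr_pwDl.
  have h1 := r_gt a1 b0; have h2 := r_gt a2 b0.
  have := ler_norm (- a1); have := ler_norm (- a2); rewrite !normrN => n2 n1.
  by rewrite mulr_gt0 // sqrtr_gt0 divr_gt0 //; lra.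
by rewrite mulrACA; apply: mulr_ge0; [rewrite -expr2 sqr_ge0|rewrite mulr_ge0 ?sqrtr_ge0].
Qed.

Lemma off_neq p q z : off p q z -> z != p%:C /\ z != q%:C.
Proof.
move=> h; split; apply/negP => /eqP zE; move: h; rewrite zE /off /= eqxx;
  by case=> [//|[[h1 h2]|[h1 h2]]]; clear zE; lra.
Qed.

(** Positivity singles out one of the two roots: it feeds [tay2_sqrt], and it gives |sb + 1| >= 1,
    whence estimates of sb - 1 can be read off from sb^2. *)
Lemma sb_Re_gt0 p q z : off p q z -> 0 < Re (sb p q z).
Proof.
move=> h; have [zp zq] := off_neq h; apply: Re_div_gt0.
  by rewrite sqrtc_eq0 subr_eq0.
have E r : z - r%:C = (Re z - r) +i* Im z by case: (z) => [a b] /=; rewrite -[LHS]/(_ +i* _) subr0.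
rewrite !E; apply: sqrtc_same_side; case: h => [h|[[h1 h2]|[h1 h2]]]; first by left.
  by right; right; rewrite !subr_lt0.
by right; left; rewrite !subr_gt0.
Qed.

Lemma sb_sqr p q z : sb p q z ^+ 2 = (z - p%:C) / (z - q%:C).
Proof. by rewrite /sb expr_div_n !sqr_sqrtc. Qed.

Lemma sb_cabs_sqr p q z : cabs (sb p q z) ^+ 2 = cabs (z - p%:C) / cabs (z - q%:C).
Proof. by rewrite -cabsX sb_sqr cabs_div. Qed.

Lemma off_open p q z : off p q z ->
  exists2 d : R, 0 < d & forall w, cabs (w - z) < d -> off p q w.
Proof.
case=> [h|[[h1 h2]|[h1 h2]]].
- exists `|Im z|; first by rewrite normr_gt0.
  move=> w wz; left; apply: contraTneq wz => w0; rewrite -leNgt.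
  by apply: le_trans (Im_le_cabs _); rewrite ImB w0 sub0r normrN.
- exists (Num.min (p - Re z) (q - Re z)); first by rewrite lt_min !subr_gt0 h1.
  move=> w; rewrite lt_min => /andP[w1 w2]; right; left.
  by have := ler_norm (Re (w - z)); have := Re_le_cabs (w - z); rewrite ReB; split; lra.
- exists (Num.min (Re z - p) (Re z - q)); first by rewrite lt_min !subr_gt0 h1.
  move=> w; rewrite lt_min => /andP[w1 w2]; right; right.
  have := ler_norm (Re (z - w)); have := Re_le_cabs (z - w).
  by rewrite ReB (cabsB z); split; lra.
Qed.

Lemma sb_tay2 p q z : off p q z -> tay2 (sb p q) z.
Proof.
move=> h; have [d d0 hd] := off_open h; have [_ zq] := off_neq h.
apply: (@tay2_sqrt _ _ (fun w => (w - p%:C) / (w - q%:C)) _ d) => //.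
  by move=> w /hd ow; split; [exact: sb_sqr|exact: sb_Re_gt0].
exact: tay2_moebius.
Qed.

Lemma sb_sub1 p q z : off p q z -> cabs (sb p q z - 1) <= `|p - q| / cabs (z - q%:C).
Proof.
move=> h; have [_ zq] := off_neq h; have s0 := sb_Re_gt0 h.
have zq0 : z - q%:C != 0 by rewrite subr_eq0.
have s1 : 1 <= cabs (sb p q z + 1).
  apply: le_trans (le_trans (ler_norm _) (Re_le_cabs _)).
  by rewrite ReD /= lerDr ltW.
apply: (@le_trans _ _ (cabs (sb p q z - 1) * cabs (sb p q z + 1))).
  by rewrite ler_peMr // cabs_ge0.
rewrite -cabsM.
have -> : (sb p q z - 1) * (sb p q z + 1) = sb p q z ^+ 2 - 1 by ring.
rewrite sb_sqr.
have -> : (z - p%:C) / (z - q%:C) - 1 = - (p - q)%:C / (z - q%:C).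
  by rewrite rmorphB /=; field.
by rewrite cabs_div cabsN cabs_real.
Qed.

(** Both values lie within 1/2 of 1, so their sum has modulus at least 1 and the difference of the
    values is controlled by that of their squares. *)
Lemma sb_lip p q z w (d : R) : off p q z -> off p q w -> 0 < d ->
  d <= cabs (z - q%:C) -> d <= cabs (w - q%:C) -> `|p - q| / d <= 1 / 2 ->
  cabs (sb p q z - sb p q w) <= `|p - q| / d ^+ 2 * cabs (z - w).
Proof.
move=> hz hw d0 dz dw pqd.
have [_ zq] := off_neq hz; have [_ wq] := off_neq hw.
have zq0 : z - q%:C != 0 by rewrite subr_eq0.
have wq0 : w - q%:C != 0 by rewrite subr_eq0.
have half x : off p q x -> d <= cabs (x - q%:C) -> cabs (sb p q x - 1) <= 1 / 2.
  move=> hx dx; apply: le_trans (sb_sub1 hx) _; apply: le_trans pqd.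
  by rewrite ler_wpM2l // lef_pV2 ?posrE // (lt_le_trans d0).
have s1 : 1 <= cabs (sb p q z + sb p q w).
  have := half z hz dz; have := half w hw dw.
  have := Re_le_cabs (sb p q z - 1); have := Re_le_cabs (sb p q w - 1).
  rewrite !ReB /= !ler_norml => /andP[h1 _] /andP[h2 _] h3 h4.
  apply: le_trans (le_trans (ler_norm _) (Re_le_cabs _)); rewrite ReD; lra.
apply: (@le_trans _ _ (cabs (sb p q z - sb p q w) * cabs (sb p q z + sb p q w))).
  by rewrite ler_peMr // cabs_ge0.
rewrite -cabsM.
have -> : (sb p q z - sb p q w) * (sb p q z + sb p q w) = sb p q z ^+ 2 - sb p q w ^+ 2 by ring.
rewrite !sb_sqr.
have -> : (z - p%:C) / (z - q%:C) - (w - p%:C) / (w - q%:C)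
  = (p - q)%:C * (z - w) / ((z - q%:C) * (w - q%:C)).
  by rewrite rmorphB /=; field; rewrite zq0 wq0.
rewrite cabs_div !cabsM cabs_real mulrAC ler_wpM2r ?cabs_ge0 //.
rewrite ler_wpM2l // lef_pV2 ?posrE ?exprn_gt0 ?mulr_gt0 ?cabs_gt0 //.
by rewrite expr2 ler_pM // ltW.
Qed.

Lemma notin_seg_off p q z : p <= q -> (~` in_plane `[p, q]) z -> off p q z.
Proof.
move=> pq nz; have [im0|] := eqVneq (Im z) 0; last by left.
right; have [zp|pz] := ltP (Re z) p; first by left; split; lra.
have [qz|zq] := ltP q (Re z); first by right; split; lra.
exfalso; apply: nz; exists (Re z); first by rewrite /= in_itv /= pz.
by apply: complexP => //=.
Qed.

Lemma sb_is_sqrt_branch p q : p <= q -> is_sqrt_branch p q (sb p q).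
Proof.
move=> pq; split.
- move=> z nz; have [A hA] := tay2_peano (sb_tay2 (notin_seg_off pq nz)).
  exact: (@peano_derivable _ _ z A).
- by move=> z _; exact: sb_sqr.
apply/cvg_complexP => eps eps0.
(* The first bound on |w| puts w^-1 at modulus above 2 B, hence off the segment and at distance at
   least |w^-1| / 2 from q; the second makes the resulting error smaller than eps. *)
pose B := `|p| + `|q| + 1.
have B0 : 0 < B by rewrite /B; have := normr_ge0 p; have := normr_ge0 q; lra.
pose d := Num.min (1 / (2 * B)) (eps / (2 * (`|p - q| + 1))).
have pq0 : 0 < 2 * (`|p - q| + 1) by have := normr_ge0 (p - q); lra.
have d0 : 0 < d by rewrite lt_min !divr_gt0 // mulr_gt0.
rewrite /dnbhs /within /=; apply/nbhs_cP; exists d => // w; rewrite subr0 => wd /= w0.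
have cw0 : 0 < cabs w by rewrite cabs_gt0.
move: wd; rewrite lt_min !ltr_pdivlMr ?mulr_gt0 // => /andP[wB we].
have wV : 2 * B < cabs w^-1 by rewrite cabsV -div1r ltr_pdivlMr // mulrC.
have hoff : off p q w^-1.
  have [im0|] := eqVneq (Im w^-1) 0; last by left.
  have := cabs_le_ReIm w^-1; rewrite im0 normr0 addr0 => h.
  have : 2 * B < `|Re w^-1| by apply: lt_le_trans wV h.
  have := ler_norm p; have := ler_norm q; have := ler_norm (- p); have := ler_norm (- q).
  rewrite !normrN ltr_normr => h1 h2 h3 h4 /orP[h5|h5]; right; [right|left];
    rewrite /B in h5; have := normr_ge0 p; have := normr_ge0 q; by split; lra.
apply: le_lt_trans (sb_sub1 hoff) _.
have qB : cabs (q%:C : R[i]) <= B.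
  by rewrite cabs_real /B; have := normr_ge0 p; lra.
have lb : cabs w^-1 / 2 <= cabs (w^-1 - q%:C).
  by have := cabs_sub_le w^-1 q%:C; lra.
have lb0 : 0 < cabs w^-1 / 2 by lra.
apply: (@le_lt_trans _ _ (`|p - q| / (cabs w^-1 / 2))).
  by rewrite ler_wpM2l // lef_pV2 ?posrE // (lt_le_trans lb0).
rewrite cabsV invf_div invrK mulrA.
by have := normr_ge0 (p - q); nra.
Qed.

End sqrt_branch.

(** * The functions f_n as products over the gaps *)

Section endpoint_product.
Variable R : realType.
Variables a b : nat -> R.
Hypotheses (a0 : a 0%N = -1) (b0 : b 0%N = 1).
Hypothesis ab : forall j, (0 < j)%N -> [/\ -1 < a j, a j < b j & b j < 1].
Hypothesis disj : forall i j, (0 < i)%N -> (0 < j)%N -> i != j -> b i < a j \/ b j < a i.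

Let S z (p : R) : R[i] := sqrtc (z - p%:C).

(* The alternating quotient sqrt(z - s_0) / sqrt(z - s_1) * sqrt(z - s_2) / ...: on
   [endpoints a b n] it is f_n, and inserting the consecutive points a_(n+1),
   b_(n+1) after an odd number of entries multiplies it by sb (b n.+1) (a n.+1). *)
Definition altprod (z : R[i]) (s : seq R) : R[i] := foldr (fun x y => S z x / y) 1 s.

Lemma altprod_cat z s1 s2 : altprod z (s1 ++ s2)
  = altprod z s1 * (if odd (size s1) then (altprod z s2)^-1 else altprod z s2).
Proof.
have consE x s : altprod z (x :: s) = S z x / altprod z s by [].
elim: s1 => [|x s1 IH]; first by rewrite /= mul1r.
rewrite cat_cons !consE IH /=; case: (odd (size s1)) => /=; by rewrite invfM ?invrK mulrA.
Qed.

Lemma altprod_nth z n s : size s = (2 * n)%N ->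
  altprod z s = \prod_(j < n) sb s`_(2 * j) s`_(2 * j).+1 z.
Proof.
elim: n s => [|n IH] s; first by move=> /eqP; rewrite muln0 size_eq0 => /eqP ->; rewrite big_ord0.
rewrite mulnS; case: s => [//|x [//|y s]] /= [sz].
rewrite big_ord_recl /= IH // invfM invrK mulrA; congr (_ * _).
apply: eq_bigr => j _.
by have -> : (0 + j + 1 * bump 0 j)%coq_nat = (2 * j).+1 by rewrite /bump /=; lia.
Qed.

Lemma size_endpoints n : size (endpoints a b n) = (2 * n.+1)%N.
Proof. by rewrite size_sort size_cat !size_map !size_iota addnn mul2n. Qed.

Lemma sorted_endpoints n : sorted <=%R (endpoints a b n).
Proof. by apply: sort_sorted; exact: le_total. Qed.

(** The number of entries below a_(n+1) is odd: -1 counts once, 1 does not count, and an earlier gap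
    lies wholly below or wholly above the new one, contributing two entries or none. *)
Lemma endpointsS n : exists s1 s2, [/\ endpoints a b n = s1 ++ s2,
  endpoints a b n.+1 = s1 ++ a n.+1 :: b n.+1 :: s2, odd (size s1),
  forall t, t \in s1 -> t < a n.+1 & forall t, t \in s2 -> b n.+1 <= t].
Proof.
set x := a n.+1; set y := b n.+1.
have [x1 xy y1] : [/\ -1 < x, x < y & y < 1] := ab (ltn0Sn n).
pose s := endpoints a b n.
pose s1 := [seq t <- s | t < x]; pose s2 := [seq t <- s | ~~ (t < x)].
have mem_s t : t \in s -> exists2 j, (j <= n)%N & t = a j \/ t = b j.
  rewrite /s /endpoints mem_sort mem_cat => /orP[] /mapP[j]; rewrite mem_iota add0n ltnS => jn ->;
    exists j => //; by [left|right].
have s2y t : t \in s2 -> y <= t.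
  rewrite mem_filter /= -leNgt => /andP[xt /mem_s[[|j] jn]].
    by rewrite a0 b0 => -[] tE; rewrite tE in xt *; lra.
  have [j1 j12 j2] := ab (ltn0Sn j).
  have nj : n.+1 != j.+1 by rewrite gtn_eqF // ltnS.
  have := disj (ltn0Sn n) (ltn0Sn j) nj; rewrite -/x -/y.
  by case=> h [] tE; rewrite tE in xt *; lra.
have ss : s = s1 ++ s2.
  apply: (sorted_eq le_trans le_anti (sorted_endpoints n)); last first.
    by rewrite perm_sym; apply/permPl; exact: perm_filterC.
  rewrite (sorted_pairwise le_trans) pairwise_cat.
  have ps : pairwise <=%R s by rewrite -(sorted_pairwise le_trans) sorted_endpoints.
  rewrite !(subseq_pairwise (seq.filter_subseq _ _) ps) !andbT.
  apply/allrelP => u v; rewrite !mem_filter /= -leNgt => /andP[ux _] /andP[xv _].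
  by apply: ltW; exact: lt_le_trans xv.
exists s1, s2; split => //.
- apply: (sorted_eq le_trans le_anti (sorted_endpoints n.+1)); last first.
    apply: (@perm_trans _ (x :: y :: s)).
      rewrite perm_sort -addn1 iotaD !map_cat /= add0n -/x -/y.
      have ps : perm_eq s ([seq a j | j <- iota 0 n.+1] ++ [seq b j | j <- iota 0 n.+1]).
        by rewrite perm_sort.
      apply/permP => P; move/permP: ps => /(_ P); rewrite !count_cat /= => ->.
      do 3 rewrite ?count_cat /=; lia.
    rewrite ss; apply/permP => P; rewrite /= !count_cat /=; lia.
  rewrite (sorted_pairwise le_trans) pairwise_cat.
  have ps : pairwise <=%R s by rewrite -(sorted_pairwise le_trans) sorted_endpoints.
  have p1 : pairwise <=%R s1 by apply: (subseq_pairwise (seq.filter_subseq _ _) ps).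
  have p2 : pairwise <=%R s2 by apply: (subseq_pairwise (seq.filter_subseq _ _) ps).
  rewrite p1 /= p2 (ltW xy) !andbT /=; apply/andP; split.
    apply/allrelP => u v; rewrite mem_filter => /andP[ux _]; rewrite !inE.
    have uy := ltW (lt_trans ux xy).
    case/predU1P => [->|/predU1P[->|vs]]; [exact: ltW|exact: uy|].
    exact: le_trans uy (s2y _ vs).
  apply/andP; split; apply/allP => v /s2y yv //; exact: le_trans (ltW xy) yv.
- rewrite size_filter /s /endpoints count_sort count_cat !count_map.
  have -> : iota 0 n.+1 = 0%N :: iota 1 n by [].
  have f1 : (1 < x) = false by apply/negbTE; rewrite -leNgt ltW // (lt_trans xy y1).
  rewrite /= a0 b0 x1 f1.
  set c1 := count _ _; set c2 := count _ _.
  have -> : c2 = c1.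
    apply: eq_in_count => j; rewrite mem_iota /= => /andP[j0 jn].
    have [j1 j12 j2] := ab j0.
    have nj : n.+1 != j by rewrite gtn_eqF // -add1n.
    have := disj (ltn0Sn n) j0 nj; rewrite -/x -/y.
    by case=> h; apply/idP/idP; rewrite /= => h'; lra.
  by rewrite !oddD /=; case: (odd c1).
- by move=> t; rewrite mem_filter => /andP[].
Qed.

Definition Fn n (z : R[i]) : R[i] := altprod z (endpoints a b n).

Lemma Fn_is_f_n n : is_f_n a b n (Fn n).
Proof.
exists (fun j => sb (alpha a b n j) (beta a b n j)); split=> [j jn|z]; last first.
  by rewrite /Fn (altprod_nth z (size_endpoints n)).
apply: sb_is_sqrt_branch; rewrite /alpha /beta.
have := sorted_endpoints n; move/(sorted_leq_nth le_trans lexx); apply => //; rewrite ?inE ?size_endpoints; lia.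
Qed.

Lemma Fn0 z : Fn 0 z = sb (-1) 1 z.
Proof.
rewrite /Fn; have -> : endpoints a b 0 = [:: -1; 1].
  rewrite /endpoints /= a0 b0 sorted_sort //=; first exact: le_trans.
  by rewrite andbT; lra.
by rewrite /altprod /= invfM invrK mulr1.
Qed.

Lemma FnS n z : Fn n.+1 z = Fn n z * sb (b n.+1) (a n.+1) z.
Proof.
have [s1 [s2 [e1 e2 od _ _]]] := endpointsS n.
rewrite /Fn e1 e2 !altprod_cat od /= /sb -/(S z _) -/(S z _) !invfM !invrK.
by rewrite -!mulrA; congr (_ * _); rewrite mulrCA [RHS]mulrC -mulrA.
Qed.

Lemma altprod_tay2 s z : ~~ odd (size s) ->
  (forall p q, p \in s -> q \in s -> off p q z) -> tay2 (altprod^~ s) z.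
Proof.
move=> es h; pose n := (size s)./2.
have sn : size s = (2 * n)%N by rewrite mul2n /n even_halfK.
apply: (@tay2_congr _ (fun w => \prod_(j < n) sb s`_(2 * j) s`_(2 * j).+1 w) _ _ 1) => //.
  by move=> w _; rewrite (altprod_nth w sn).
apply: (tay2_prod (F := fun j => sb s`_(2 * j) s`_(2 * j).+1)) => j jn.
by apply: sb_tay2; apply: h; apply: mem_nth; rewrite sn; lia.
Qed.

(** Outside the newest gap its factor is holomorphic and induction applies. Inside it the sorted
    list is cut at the gap: both pieces have even length and lie on one side of z, so each consists
    of holomorphic factors. *)
Lemma Fn_tay2 n z : Im z != 0 \/ Re z < -1 \/ 1 < Re z \/
  (exists k, [/\ (0 < k)%N, (k <= n)%N, a k < Re z & Re z < b k]) -> tay2 (Fn n) z.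
Proof.
elim: n => [|n IH] h.
  apply: (@tay2_congr _ (sb (-1) 1) _ _ 1) => // [w _|]; first by rewrite Fn0.
  apply: sb_tay2; case: h => [h|[h|[h|[k [k0 kn _ _]]]]].
  - by left.
  - by right; left; split; lra.
  - by right; right; split; lra.
  - by move: k0; rewrite ltnNge kn.
have [x1 xy y1] := ab (ltn0Sn n).
have [[zx zy]|nz] := pselect (a n.+1 < Re z /\ Re z < b n.+1).
  have [s1 [s2 [e1 e2 od s1x s2y]]] := endpointsS n.
  have sz := size_endpoints n; rewrite e1 size_cat in sz.
  have od2 : odd (size s2).
    have : ~~ odd (size s1 + size s2) by rewrite sz mul2n odd_double.
    by rewrite oddD od /=; case: (odd (size s2)).
  apply: (@tay2_congr _ (fun w => altprod w (rcons s1 (a n.+1)) * altprod w (b n.+1 :: s2)) _ _ 1) => //.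
    by move=> w _; rewrite /Fn e2 -cat_rcons altprod_cat size_rcons /= od.
  apply: tay2_mul; apply: altprod_tay2; rewrite ?size_rcons /= ?od ?od2 // => p q.
    have lt t : t \in rcons s1 (a n.+1) -> t < Re z.
      by rewrite mem_rcons inE => /predU1P[->//|/s1x tx]; apply: lt_trans zx.
    by move=> /lt pz /lt qz; right; right.
  have lt t : t \in b n.+1 :: s2 -> Re z < t.
    by rewrite inE => /predU1P[->//|/s2y yt]; apply: lt_le_trans yt.
  by move=> /lt pz /lt qz; right; left.
have off_z : off (b n.+1) (a n.+1) z.
  case: h => [h|[h|[h|[k [k0 kn k1 k2]]]]].
  - by left.
  - by right; left; split; lra.
  - by right; right; split; lra.
  - have nk : n.+1 != k by apply: contra_notN nz => /eqP ->.
    have [j1 j12 j2] := ab k0.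
    by have [h|h] := disj (ltn0Sn n) k0 nk; right; [right|left]; split; lra.
apply: (@tay2_congr _ (fun w => Fn n w * sb (b n.+1) (a n.+1) w) _ _ 1) => // [w _|].
  by rewrite FnS.
apply: tay2_mul; last exact: sb_tay2.
apply: IH; case: h => [h|[h|[h|[k [k0 kn k1 k2]]]]]; [by left|by right; left|by right; right; left|].
right; right; right; exists k; split => //.
by move: kn; rewrite leq_eqVlt => /predU1P[kn|//]; case: nz; rewrite -kn.
Qed.

End endpoint_product.

(** * The limit function *)

Section complex_limits.
Variable R : realType.

Lemma halving_bound (e : nat -> R) n0 : (forall n, (n0 <= n)%N -> e n.+1 <= e n / 2) ->
  forall n, e (n0 + n)%N <= e n0 * 2^-1 ^+ n.
Proof.
move=> h; elim=> [|n IH]; first by rewrite addn0 mulr1.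
by rewrite addnS exprSr mulrA; apply: le_trans (h _ (leq_addr _ _)) _; rewrite ler_pM2r ?invr_gt0.
Qed.

Lemma halving_small (e : nat -> R) n0 : (forall n, (n0 <= n)%N -> e n.+1 <= e n / 2) ->
  forall eps, 0 < eps -> exists2 N, (n0 <= N)%N & forall n, (N <= n)%N -> e n <= eps.
Proof.
move=> h eps eps0; apply: contrapT => no.
suff : eps <= 0 by rewrite leNgt eps0.
apply: (@halving_le0 _ _ `|e n0|) => k; rewrite leNgt; apply/negP => lt.
apply: no; exists (n0 + k)%N; first exact: leq_addr.
move=> n kn; have -> : n = (n0 + (n - n0))%N by lia.
apply: le_trans (halving_bound h _) _; apply: le_trans (ltW lt).
apply: (@le_trans _ _ (`|e n0| * 2^-1 ^+ (n - n0))).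
  by rewrite ler_wpM2r ?ler_norm // exprn_ge0 // invr_ge0.
rewrite ler_wpM2l // ler_wiXn2l ?invr_ge0 ?invf_le1 ?ler1n //; lia.
Qed.

(** The intervals of radius 2 e n around x n are nested, so the supremum of their left ends lies in
    all of them. *)
Lemma geometric_limit (x e : nat -> R) n0 :
  (forall n, (n0 <= n)%N -> `|x n.+1 - x n| <= e n) ->
  (forall n, (n0 <= n)%N -> e n.+1 <= e n / 2) ->
  exists l, forall n, (n0 <= n)%N -> `|x n - l| <= 2 * e n.
Proof.
move=> hx he.
have e0 n : (n0 <= n)%N -> 0 <= e n by move=> /hx; exact: le_trans.
have dec n m : (n0 <= n)%N -> (n <= m)%N ->
    x n - 2 * e n <= x m - 2 * e m /\ x m + 2 * e m <= x n + 2 * e n.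
  move=> nn; elim: m => [|m IH]; first by rewrite leqn0 => /eqP ->.
  rewrite leq_eqVlt => /predU1P[->//|]; rewrite ltnS => nm.
  have [h1 h2] := IH nm; have nm' := leq_trans nn nm.
  by have := hx _ nm'; have := he _ nm'; rewrite ler_norml => h3 /andP[h4 h5]; split; lra.
have cross n m : (n0 <= n)%N -> (n0 <= m)%N -> x n - 2 * e n <= x m + 2 * e m.
  move=> nn mm; have [nm|mn] := leqP n m.
    by have [h1 h2] := dec _ _ nn nm; have := e0 _ mm; lra.
  by have [h1 h2] := dec _ _ mm (ltnW mn); have := e0 _ nn; lra.
pose A := [set y | exists2 n, (n0 <= n)%N & y = x n - 2 * e n].
have Ane : A !=set0 by exists (x n0 - 2 * e n0); exists n0.
exists (sup A) => n nn.
have h1 : x n - 2 * e n <= sup A.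
  apply: sup_upper_bound; last by exists n.
  by split => //; exists (x n0 + 2 * e n0) => y [m mm ->]; exact: cross.
have h2 : sup A <= x n + 2 * e n.
  by apply: ge_sup => // y [m mm ->]; exact: cross.
by rewrite ler_norml; apply/andP; split; lra.
Qed.

Lemma growth_bound (u x : nat -> R) n0 : (forall n, (n0 <= n)%N -> 0 <= u n) ->
  (forall n, (n0 <= n)%N -> u n.+1 <= u n * (1 + x n)) ->
  (forall n, (n0 <= n)%N -> 0 <= x n) ->
  (forall n, (n0 <= n)%N -> x n.+1 <= x n / 2) ->
  forall n, (n0 <= n)%N -> u n <= u n0 * expR (2 * x n0).
Proof.
move=> u0 ux x0 xh n nn.
suff : u n * expR (2 * x n) <= u n0 * expR (2 * x n0).
  by apply: le_trans; rewrite ler_peMr ?u0 // -[leLHS]expR0 ler_expR mulr_ge0 // x0.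
have -> : n = (n0 + (n - n0))%N by lia.
elim: (n - n0)%N => [|k IH]; first by rewrite addn0.
apply: le_trans IH; set m := (n0 + k)%N; have mm : (n0 <= m)%N by exact: leq_addr.
rewrite addnS -/m.
apply: (@le_trans _ _ (u m * (1 + x m) * expR (x m))).
  apply: ler_pM; rewrite ?u0 ?expR_ge0 ?ux //; first by rewrite (leq_trans mm).
  by rewrite ler_expR; have := xh _ mm; lra.
have -> : expR (2 * x m) = expR (x m) * expR (x m) by rewrite -expRD; congr expR; ring.
by rewrite mulrA ler_wpM2r ?expR_ge0 // ler_wpM2l ?u0 // expR_ge1Dx.
Qed.

Definition climit (u : nat -> R[i]) (l : R[i]) := forall e : R, 0 < e ->
  exists N, forall n, (N <= n)%N -> cabs (u n - l) < e.

Lemma climit_uniq u l l' : climit u l -> climit u l' -> l = l'.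
Proof.
move=> h h'; apply/eqP; rewrite -subr_eq0 -cabs_eq0 eq_le cabs_ge0 andbT leNgt.
apply/negP => lt; have [N hN] := h _ (divr_gt0 lt (ltr0n R 2)).
have [N' hN'] := h' _ (divr_gt0 lt (ltr0n R 2)).
have := hN (maxn N N') (leq_maxl _ _); have := hN' (maxn N N') (leq_maxr _ _).
have := cabsD (l - u (maxn N N')) (u (maxn N N') - l'); rewrite addrA subrK (cabsB l); lra.
Qed.

Lemma climit_geometric u (e : nat -> R) n0 :
  (forall n, (n0 <= n)%N -> cabs (u n.+1 - u n) <= e n) ->
  (forall n, (n0 <= n)%N -> e n.+1 <= e n / 2) ->
  exists l, climit u l /\ forall n, (n0 <= n)%N -> cabs (u n - l) <= 4 * e n.
Proof.
move=> hu he.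
have [x hx] := @geometric_limit (fun n => Re (u n)) e n0
  (fun n nn => le_trans (eq_ind _ (fun v => `|v| <= _) (Re_le_cabs _) _ (ReB _ _)) (hu n nn)) he.
have [y hy] := @geometric_limit (fun n => Im (u n)) e n0
  (fun n nn => le_trans (eq_ind _ (fun v => `|v| <= _) (Im_le_cabs _) _ (ImB _ _)) (hu n nn)) he.
have bnd n : (n0 <= n)%N -> cabs (u n - (x +i* y)) <= 4 * e n.
  move=> nn; apply: le_trans (cabs_le_ReIm _) _; rewrite ReB ImB /=.
  by have := hx _ nn; have := hy _ nn; lra.
exists (x +i* y); split => // eps eps0.
have [N nN hN] := halving_small he (divr_gt0 eps0 (ltr0n R 5)).
exists N => n Nn; apply: le_lt_trans (bnd _ (leq_trans nN Nn)) _.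
by have := hN _ Nn; lra.
Qed.

Lemma climit_bound u (e : nat -> R) n0 l : climit u l ->
  (forall n, (n0 <= n)%N -> cabs (u n.+1 - u n) <= e n) ->
  (forall n, (n0 <= n)%N -> e n.+1 <= e n / 2) ->
  forall n, (n0 <= n)%N -> cabs (u n - l) <= 4 * e n.
Proof.
move=> ul hu he; have [l' [ul' h]] := climit_geometric hu he.
by rewrite (climit_uniq ul ul').
Qed.

Lemma climitB u v l l' : climit u l -> climit v l' -> climit (fun n => u n - v n) (l - l').
Proof.
move=> hu hv e e0; have e2 := divr_gt0 e0 (ltr0n R 2).
have [N hN] := hu _ e2; have [N' hN'] := hv _ e2.
exists (maxn N N') => n; rewrite geq_max => /andP[nN nN'].
have := hN _ nN; have := hN' _ nN'.
have -> : u n - v n - (l - l') = (u n - l) + - (v n - l') by ring.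
by have := cabsD (u n - l) (- (v n - l')); rewrite cabsN; lra.
Qed.

End complex_limits.

(** * Convergence of f_n and holomorphy of the limit *)

Section fK.
Variable R : realType.
Variables a b : nat -> R.
Hypotheses (a0 : a 0%N = -1) (b0 : b 0%N = 1).
Hypothesis ab : forall j, (0 < j)%N -> [/\ -1 < a j, a j < b j & b j < 1].
Hypothesis len : forall j, (0 < j)%N -> b j.+1 - a j.+1 <= (b j - a j) / 2.
Hypothesis disj : forall i j, (0 < i)%N -> (0 < j)%N -> i != j -> b i < a j \/ b j < a i.
Implicit Types (z w : R[i]) (d rho : R).

Let sg j z := sb (b j) (a j) z.
Let gl j := b j - a j.

Definition fK z : R[i] := xget 0 [set l | climit (fun n => Fn a b n z) l].

(* A point of [reg d rho] stays at distance [d] from the Cantor set, hence lies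
   in no gap of length less than [2 * d]. *)
Definition reg d rho z := cabs z <= rho /\ forall x, cantor_of a b x -> d <= cabs (z - x%:C).

Let gl_gt0 j : (0 < j)%N -> 0 < gl j.
Proof. by move=> /ab[_ h _]; rewrite subr_gt0. Qed.

Let gl_ge0 j : (0 < j)%N -> 0 <= gl j.
Proof. by move=> /gl_gt0 /ltW. Qed.

Lemma reg_off d rho z j : 0 < d -> reg d rho z -> (0 < j)%N -> b j - a j < 2 * d ->
  off (b j) (a j) z.
Proof.
move=> d0 [_ hz] j0 jd; have [Ka Kb] := cantor_of_endpoints a0 b0 ab disj j0.
have [_ abj _] := ab j0.
have [im0|] := eqVneq (Im z) 0; last by left.
have cz x : cabs (z - x%:C) = `|Re z - x|.
  by rewrite /cabs ReB ImB /= im0 subr0 expr0n /= addr0 sqrtr_sqr.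
have := hz _ Ka; have := hz _ Kb; rewrite !cz => h1 h2.
right; have [lt|ge] := ltP (Re z) (a j); first by left; split; lra.
have [gt|le] := ltP (b j) (Re z); first by right; split; lra.
by exfalso; rewrite ler0_norm ?subr_le0 // in h1; rewrite ger0_norm ?subr_ge0 // in h2; lra.
Qed.

Lemma reg_sg d rho z j : 0 < d -> reg d rho z -> (0 < j)%N -> b j - a j < 2 * d ->
  cabs (sb (b j) (a j) z - 1) <= (b j - a j) / d.
Proof.
move=> d0 hz j0 jd; have [Ka _] := cantor_of_endpoints a0 b0 ab disj j0.
apply: le_trans (sb_sub1 (reg_off d0 hz j0 jd)) _.
have l0 : 0 <= b j - a j by apply: ltW; exact: gl_gt0.
rewrite ger0_norm // ler_wpM2l // lef_pV2 ?posrE //; first exact: hz.2.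
exact: lt_le_trans d0 (hz.2 _ Ka).
Qed.

Let gl_half n : (0 <= n)%N -> gl n.+2 <= gl n.+1 / 2.
Proof. by move=> _; exact: len. Qed.

(** This serves for the finitely many long gaps, whose factors need not be near 1: |sb|^2 = |z - p|
    / |z - q| <= (rho + 1) / d for every factor. *)
Lemma Fn_crude_bound d rho z n : 0 < d -> reg d rho z ->
  cabs (Fn a b n z) ^+ 2 <= ((rho + 1) / d) ^+ n.+1.
Proof.
move=> d0 hz; have [K1 K2] := cantor_of_bounds a0 b0 ab.
have rho0 : 0 <= rho by apply: le_trans hz.1; exact: cabs_ge0.
have fac p q : `|p| <= 1 -> cantor_of a b q -> cabs (sb p q z) ^+ 2 <= (rho + 1) / d.
  move=> p1 Kq; rewrite sb_cabs_sqr; have h := hz.2 _ Kq.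
  apply: ler_pM; rewrite ?cabs_ge0 ?invr_ge0 ?cabs_ge0 //.
    have := cabsD z (- p%:C); rewrite cabsN cabs_real; have := hz.1; lra.
  by rewrite lef_pV2 ?posrE // (lt_le_trans d0).
elim: n => [|n IH].
  by rewrite (Fn0 a0 b0) expr1; apply: fac => //; rewrite normrN normr1.
rewrite (FnS a0 b0 ab disj) cabsM exprMn [in leRHS]exprSr.
apply: ler_pM; rewrite ?exprn_ge0 ?cabs_ge0 //.
have [Ka _] := cantor_of_endpoints a0 b0 ab disj (ltn0Sn n).
apply: fac => //; have [h1 h2 h3] := ab (ltn0Sn n).
by rewrite ler_norml; apply/andP; split; lra.
Qed.

(** Only finitely many gaps are longer than d / 2, and they obey the crude bound. The other factors
    are at most 1 + l_j / d with l_j at least halving, so [growth_bound] controls their product. *)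
Lemma Fn_uniform d rho : 0 < d -> exists n0 (M : R), [/\ 0 < M,
  (forall j, (n0 < j)%N -> b j - a j <= d / 2) &
  forall z, reg d rho z -> forall n, (n0 <= n)%N -> cabs (Fn a b n z) <= M].
Proof.
move=> d0.
have d2 : 0 < d / 2 by rewrite divr_gt0.
have [n0 _ hn0] := @halving_small _ (fun n => gl n.+1) 0 gl_half _ d2.
pose B := `|((rho + 1) / d) ^+ n0.+1| + 1.
have B0 : 0 < B by have := normr_ge0 (((rho + 1) / d) ^+ n0.+1); rewrite /B; lra.
exists n0, (B * expR (2 * (gl n0.+1 / d))); split.
- by rewrite mulr_gt0 // expR_gt0.
- by move=> [//|j]; rewrite ltnS; exact: hn0.
move=> z hz n nn.
have := @growth_bound _ (fun n => cabs (Fn a b n z)) (fun n => gl n.+1 / d) n0.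
move=> /(_ _ _ _ _ n nn) h; apply: le_trans (h _ _ _ _) _.
- by move=> m _; exact: cabs_ge0.
- move=> m mm; rewrite (FnS a0 b0 ab disj) cabsM ler_wpM2l ?cabs_ge0 //.
  have small : b m.+1 - a m.+1 < 2 * d by have := hn0 _ mm; rewrite /gl; lra.
  have := reg_sg d0 hz (ltn0Sn m) small.
  have := cabsD (sb (b m.+1) (a m.+1) z - 1) 1; rewrite subrK cabs1 /gl; lra.
- by move=> m _; rewrite divr_ge0 ?gl_ge0 ?(ltW d0).
- by move=> m _; rewrite mulrAC ler_wpM2r ?invr_ge0 ?(ltW d0) // gl_half.
rewrite ler_wpM2r ?expR_ge0 //.
have := Fn_crude_bound n0 d0 hz; have := ler_norm (((rho + 1) / d) ^+ n0.+1).
have := cabs_ge0 (Fn a b n0 z); rewrite /B; nra.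
Qed.

Lemma Fn_step d rho z n (M : R) : 0 < d -> reg d rho z -> b n.+1 - a n.+1 <= d / 2 ->
  cabs (Fn a b n z) <= M -> cabs (Fn a b n.+1 z - Fn a b n z) <= M / d * (b n.+1 - a n.+1).
Proof.
move=> d0 hz small FM; rewrite (FnS a0 b0 ab disj).
have -> : Fn a b n z * sb (b n.+1) (a n.+1) z - Fn a b n z
   = Fn a b n z * (sb (b n.+1) (a n.+1) z - 1) by ring.
have small' : b n.+1 - a n.+1 < 2 * d by lra.
rewrite cabsM; apply: (@le_trans _ _ (M * ((b n.+1 - a n.+1) / d))).
  by apply: ler_pM; rewrite ?cabs_ge0 //; exact: reg_sg hz _ _.
by rewrite mulrA mulrAC.
Qed.

Lemma notin_cantor_dist z : (~` in_plane (cantor_of a b)) z ->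
  exists2 d, 0 < d & forall x, cantor_of a b x -> d <= cabs (z - x%:C).
Proof.
move=> nz; have [im0|im0] := eqVneq (Im z) 0; last first.
  exists `|Im z|; first by rewrite normr_gt0.
  by move=> x _; apply: le_trans (Im_le_cabs _); rewrite ImB /= subr0.
have nK : ~ cantor_of a b (Re z).
  by move=> h; apply: nz; exists (Re z) => //; apply: complexP.
have : open (~` cantor_of a b) by rewrite openC; exact: closed_cantor_of.
rewrite openE => /(_ _ nK) /nbhs_ballP[e /= e0 he].
exists e => // x Kx; apply: le_trans (Re_le_cabs _); rewrite ReB /= leNgt.
by apply/negP => lt; exact: (he x lt Kx).
Qed.

Lemma notin_cantor_reg z : (~` in_plane (cantor_of a b)) z ->
  exists d rho r : R, [/\ 0 < d, 0 < r & forall w, cabs (w - z) <= r -> reg d rho w].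
Proof.
move=> /notin_cantor_dist[d d0 hd]; exists (d / 2), (cabs z + d), (d / 2).
split; rewrite ?divr_gt0 // => w wz; split.
  by have := cabsD (w - z) z; rewrite subrK; lra.
move=> x Kx; have := hd x Kx; have := cabsD (z - w) (w - x%:C).
by rewrite addrA subrK (cabsB z w); lra.
Qed.

Lemma reg_notin d rho z : 0 < d -> reg d rho z -> (~` in_plane (cantor_of a b)) z.
Proof.
move=> d0 [_ hz] [x Kx xz]; have := hz x Kx.
by rewrite -xz subrr cabs0 leNgt d0.
Qed.

Lemma reg_Fn_climit d rho z : 0 < d -> reg d rho z -> climit (fun n => Fn a b n z) (fK z).
Proof.
move=> d0 hz; have [n0 [M [M0 small FM]]] := Fn_uniform rho d0.
have [||l [hl _]] := @climit_geometric _ (fun n => Fn a b n z) (fun n => M / d * gl n.+1) n0.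
- by move=> n nn; apply: (Fn_step d0 hz); [exact: small|exact: FM].
- move=> n nn; by rewrite -[leRHS]mulrA ler_wpM2l ?divr_ge0 ?(ltW d0) ?(ltW M0) // gl_half.
rewrite /fK; exact: (xgetPex 0 (ex_intro _ l hl)).
Qed.

Lemma fK_approx d rho : 0 < d -> exists n0 (M : R), [/\ 0 < M,
  (forall j, (n0 < j)%N -> b j - a j <= d / 2) &
  forall z, reg d rho z -> forall n, (n0 <= n)%N ->
    cabs (Fn a b n z) <= M /\ cabs (Fn a b n z - fK z) <= M * (b n.+1 - a n.+1)].
Proof.
move=> d0; have [n0 [M [M0 small FM]]] := Fn_uniform rho d0.
exists n0, (Num.max M (4 * (M / d))); split=> //.
  by rewrite lt_max M0.
move=> z hz n nn; split; first by rewrite le_max FM.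
apply: (@le_trans _ _ (4 * (M / d * gl n.+1))).
  apply: (@climit_bound _ (fun n => Fn a b n z) (fun n => M / d * gl n.+1) n0 _ (reg_Fn_climit d0 hz)) nn.
    by move=> m mm; apply: (Fn_step d0 hz); [exact: small|exact: FM].
  by move=> m mm; rewrite -[leRHS]mulrA ler_wpM2l ?divr_ge0 ?(ltW d0) ?(ltW M0) // gl_half.
by rewrite mulrA ler_wpM2r ?gl_ge0 // le_max lexx orbT.
Qed.

(** A real point of [-1, 1] at distance d from the Cantor set lies in a gap of length at least 2 d,
    which must be one of the first n. *)
Lemma reg_Fn_tay2 d rho z n : 0 < d -> reg d rho z ->
  (forall j, (n < j)%N -> b j - a j <= d / 2) -> tay2 (Fn a b n) z.
Proof.
move=> d0 hz small; apply: (Fn_tay2 a0 b0 ab disj).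
have [im0|] := eqVneq (Im z) 0; last by left.
right; have [?|ge] := ltP (Re z) (-1); first by left.
right; have [?|le] := ltP 1 (Re z); first by left.
right; have nK : ~ cantor_of a b (Re z).
  by move=> h; apply: (reg_notin d0 hz); exists (Re z) => //; apply: complexP.
have [k k0 [k1 k2]] : exists2 k, (0 < k)%N & a k < Re z /\ Re z < b k.
  apply: contrapT => no; apply: nK; apply/(cantor_ofP a0 b0); split; first by rewrite ge.
  move=> j j0; have [aj|aj] := leP (Re z) (a j); first by left.
  by have [bj|bj] := leP (b j) (Re z); [right|case: no; exists j].
exists k; split=> //; rewrite leqNgt; apply/negP => nk.
have sm : b k - a k < 2 * d by have := small _ nk; lra.
by case: (reg_off d0 hz k0 sm) => [|[[h1 h2]|[h1 h2]]]; [rewrite im0 eqxx|lra|lra].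
Qed.

Lemma fK_uniform (L : set R[i]^o) : compact L -> L `<=` ~` in_plane (cantor_of a b) ->
  exists d rho, 0 < d /\ forall z, L z -> reg d rho z.
Proof.
move=> cL LK.
(* A single constant encodes the distance to the Cantor set and the size of z, so that one
   compactness argument gives both; rho is then 1 / d. *)
pose Q (d : R) (z : R[i]^o) := d * cabs z <= 1 /\ forall x, cantor_of a b x -> d <= cabs (z - x%:C).
have [d d0 hd] : exists2 d, 0 < d & forall z, L z -> Q d z.
  apply: (compact_uniform cL).
    move=> d d' z dd [h1 h2]; split; last by move=> x /h2; exact: le_trans.
    by apply: le_trans h1; rewrite ler_wpM2r ?cabs_ge0.
  move=> z /LK /notin_cantor_reg[d [rho [r [d0 r0 hr]]]].
  pose e := Num.min d (1 / (`|rho| + 1)).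
  have rho0 : 0 < `|rho| + 1 by have := normr_ge0 rho; lra.
  have e0 : 0 < e by rewrite lt_min d0 divr_gt0.
  exists e => //; apply/nbhs_cP; exists r => // w /ltW /hr [h1 h2] _; split.
    have : cabs w <= `|rho| + 1 by have := ler_norm rho; lra.
    have : e <= 1 / (`|rho| + 1) by rewrite ge_min lexx orbT.
    rewrite ler_pdivlMr // => h3 h4; apply: le_trans h3.
    by rewrite ler_wpM2l // ltW.
  by move=> x /h2; apply: le_trans; rewrite ge_min lexx.
exists d, (1 / d); split=> // z /hd [h1 h2]; split=> //.
by rewrite ler_pdivlMr // mulrC.
Qed.

(** Convergence is controlled on increments: those of F_(n+1) and F_n from z to w differ by at most
    e_n |w - z| with e_n halving. So the derivatives of the F_n at z are Cauchy, and their limit is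
    the derivative of the limit. *)
Lemma fK_derivable z : (~` in_plane (cantor_of a b)) z -> derivable (fK : R[i]^o -> R[i]^o) z 1.
Proof.
move=> nz; have [d [rho [r [d0 r0 hr]]]] := notin_cantor_reg nz.
have [n0 [M [M0 small hM]]] := fK_approx rho d0.
have hz : reg d rho z by apply: hr; rewrite subrr cabs0 ltW.
have tF n : (n0 <= n)%N -> tay2 (Fn a b n) z.
  by move=> nn; apply: reg_Fn_tay2 d0 hz _ => j nj; apply: small; exact: leq_ltn_trans nj.
pose x n := gl n.+1 / d.
have x0 n : 0 <= x n by rewrite divr_ge0 ?gl_ge0 ?(ltW d0).
have xh n : x n.+1 <= x n / 2 by rewrite /x mulrAC ler_wpM2r ?invr_ge0 ?(ltW d0) // gl_half.
have slip n w : (n0 <= n)%N -> cabs (w - z) <= r ->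
    cabs (sg n.+1 w - sg n.+1 z) <= x n / d * cabs (w - z).
  move=> nn wz; have hw := hr _ wz.
  have [Ka _] := cantor_of_endpoints a0 b0 ab disj (ltn0Sn n).
  have sm : b n.+1 - a n.+1 < 2 * d by have := small n.+1 nn; lra.
  have := sb_lip (reg_off d0 hw (ltn0Sn n) sm) (reg_off d0 hz (ltn0Sn n) sm) d0
    (hw.2 _ Ka) (hz.2 _ Ka).
  rewrite ger0_norm ?gl_ge0 //.
  have -> : x n / d = gl n.+1 / d ^+ 2 by rewrite /x; field; rewrite gt_eqF.
  by apply; rewrite ler_pdivrMr //; have := small n.+1 nn; lra.
have [r1 [La [r10 r1r La0 hLa]]] : exists r1 La : R, [/\ 0 < r1, r1 <= r, 0 <= La &
    forall w, cabs (w - z) <= r1 -> cabs (Fn a b n0 w - Fn a b n0 z) <= La * cabs (w - z)].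
  have [A hA] := tay2_peano (tF _ (leqnn _)); have [dd dd0 hdd] := hA 1 ltr01.
  exists (Num.min r (dd / 2)), (cabs A + 1); split.
  - by rewrite lt_min r0 divr_gt0.
  - by rewrite ge_min lexx.
  - by have := cabs_ge0 A; lra.
  move=> w; rewrite le_min => /andP[_ w2].
  have wd : cabs (w - z) < dd by lra.
  have := hdd _ wd; rewrite [z + _]addrC subrK => h.
  have := cabsD (Fn a b n0 w - Fn a b n0 z - A * (w - z)) (A * (w - z)).
  by rewrite subrK cabsM; lra.
pose La1 := (La + M / d) * expR (2 * x n0).
have Md0 : 0 <= M / d by rewrite divr_ge0 ?(ltW d0) ?(ltW M0).
have La10 : 0 <= La1 by rewrite mulr_ge0 ?expR_ge0 ?addr_ge0.
have lip n w : (n0 <= n)%N -> cabs (w - z) <= r1 ->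
    cabs (Fn a b n w - Fn a b n z) <= La1 * cabs (w - z).
  move=> nn wz; have wr := le_trans wz r1r.
  (* The product rule gives a multiplicative and an additive error; adding M / d |w - z| turns both
     into the single factor 1 + x m. *)
  pose u n := cabs (Fn a b n w - Fn a b n z) + M / d * cabs (w - z).
  have u0 m : 0 <= u m by rewrite addr_ge0 ?cabs_ge0 // mulr_ge0 ?cabs_ge0.
  have step m : (n0 <= m)%N -> u m.+1 <= u m * (1 + x m).
    move=> mm; rewrite /u !(FnS a0 b0 ab disj).
    have -> : Fn a b m w * sb (b m.+1) (a m.+1) w - Fn a b m z * sb (b m.+1) (a m.+1) z
      = (Fn a b m w - Fn a b m z) * sg m.+1 w + Fn a b m z * (sg m.+1 w - sg m.+1 z).
      by rewrite /sg; ring.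
    have sm : b m.+1 - a m.+1 < 2 * d by have := small m.+1 mm; lra.
    have s1 : cabs (sg m.+1 w) <= 1 + x m.
      have := reg_sg d0 (hr _ wr) (ltn0Sn m) sm.
      by have := cabsD (sg m.+1 w - 1) 1; rewrite subrK cabs1 /sg /x /gl; lra.
    have := cabsD ((Fn a b m w - Fn a b m z) * sg m.+1 w) (Fn a b m z * (sg m.+1 w - sg m.+1 z)).
    rewrite (cabsM (Fn a b m w - _)) (cabsM (Fn a b m z)) => h.
    have h1 := ler_wpM2l (cabs_ge0 (Fn a b m w - Fn a b m z)) s1.
    have h2 : cabs (Fn a b m z) * cabs (sg m.+1 w - sg m.+1 z) <= M * (x m / d * cabs (w - z)).
      by apply: ler_pM; rewrite ?cabs_ge0 ?slip //; exact: (hM _ hz _ mm).1.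
    have e1 : M * (x m / d * cabs (w - z)) = M / d * cabs (w - z) * x m by ring.
    lra.
  have := growth_bound (fun m _ => u0 m) step (fun m _ => x0 m) (fun m _ => xh m) nn.
  have h1 : u n0 <= (La + M / d) * cabs (w - z) by rewrite /u mulrDl lerD2r hLa.
  have h2 := ler_wpM2r (expR_ge0 (2 * x n0)) h1.
  have h3 : cabs (Fn a b n w - Fn a b n z) <= u n by rewrite lerDl mulr_ge0 ?cabs_ge0.
  by rewrite /La1; lra.
pose e n := (La1 + M / d) * x n.
have e0 n : 0 <= e n by rewrite mulr_ge0 ?addr_ge0.
have eh n : e n.+1 <= e n / 2 by rewrite /e -mulrA ler_wpM2l ?addr_ge0.
have diff n w : (n0 <= n)%N -> cabs (w - z) <= r1 ->
    cabs ((Fn a b n.+1 w - Fn a b n.+1 z) - (Fn a b n w - Fn a b n z)) <= e n * cabs (w - z).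
  move=> nn wz; have wr := le_trans wz r1r; rewrite !(FnS a0 b0 ab disj).
  have -> : Fn a b n w * sb (b n.+1) (a n.+1) w - Fn a b n z * sb (b n.+1) (a n.+1) z
      - (Fn a b n w - Fn a b n z)
    = (Fn a b n w - Fn a b n z) * (sg n.+1 w - 1) + Fn a b n z * (sg n.+1 w - sg n.+1 z).
    by rewrite /sg; ring.
  have sm : b n.+1 - a n.+1 < 2 * d by have := small n.+1 nn; lra.
  apply: le_trans (cabsD _ _) _; rewrite !cabsM /e mulrDl mulrDl; apply: lerD.
    rewrite mulrAC; apply: ler_pM; rewrite ?cabs_ge0 ?lip //.
    exact: reg_sg (hr _ wr) _ sm.
  have -> : M / d * x n * cabs (w - z) = M * (x n / d * cabs (w - z)) by ring.
  by apply: ler_pM; rewrite ?cabs_ge0 ?slip //; exact: (hM _ hz _ nn).1.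
have lim_diff n w : (n0 <= n)%N -> cabs (w - z) <= r1 ->
    cabs ((Fn a b n w - Fn a b n z) - (fK w - fK z)) <= 4 * e n * cabs (w - z).
  move=> nn wz; have wr := le_trans wz r1r; rewrite -mulrA.
  apply: (@climit_bound _ (fun n => Fn a b n w - Fn a b n z) (fun n => e n * cabs (w - z)) n0) nn.
  - by apply: climitB; apply: (reg_Fn_climit d0); [exact: hr|exact: hz].
  - by move=> m mm; exact: diff.
  - by move=> m mm; rewrite [leRHS]mulrAC ler_wpM2r ?cabs_ge0.
have ex n : exists A : R[i], (n0 <= n)%N -> forall eps : R, 0 < eps -> exists2 d : R, 0 < d &
    forall l : R[i], cabs l < d -> cabs (Fn a b n (z + l) - Fn a b n z - A * l) <= eps * cabs l.
  have [nn|] := leqP n0 n; last by exists 0.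
  by have [A hA] := tay2_peano (tF _ nn); exists A.
have [D hD] := choice ex.
have Dstep n : (n0 <= n)%N -> cabs (D n.+1 - D n) <= e n.
  move=> nn; apply/ler_addgt0Pr => eps eps0; have e2 := divr_gt0 eps0 (ltr0n R 2).
  have [d1 d10 h1] := hD n nn _ e2; have [d2 d20 h2] := hD n.+1 (leqW nn) _ e2.
  pose t := Num.min r1 (Num.min d1 d2) / 2.
  have m0 : 0 < Num.min r1 (Num.min d1 d2) by rewrite !lt_min r10 d10.
  have t0 : 0 < t by rewrite divr_gt0.
  have : t < Num.min r1 (Num.min d1 d2) by rewrite /t; lra.
  rewrite !lt_min => /andP[tr /andP[t1 t2]].
  have ct : cabs (t%:C : R[i]) = t by rewrite cabs_real gtr0_norm.
  have k1 := h1 t%:C; have k2 := h2 t%:C; rewrite ct in k1 k2.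
  have k3 := diff n (z + t%:C) nn; rewrite [z + t%:C]addrC addrK ct in k3.
  rewrite -(ler_pM2r t0) -{1}ct -cabsM.
  have -> : (D n.+1 - D n) * t%:C
    = (Fn a b n.+1 (t%:C + z) - Fn a b n.+1 z - (Fn a b n (t%:C + z) - Fn a b n z))
      + (- (Fn a b n.+1 (z + t%:C) - Fn a b n.+1 z - D n.+1 * t%:C)
         + (Fn a b n (z + t%:C) - Fn a b n z - D n * t%:C)) by rewrite [z + _]addrC; ring.
  apply: le_trans (cabsD _ _) _.
  apply: le_trans (lerD (k3 (ltW tr)) (cabsD _ _)) _; rewrite cabsN.
  by have := k1 t1; have := k2 t2; lra.
have [A [_ hA]] := climit_geometric Dstep (fun n _ => eh n).
apply: (@peano_derivable _ _ z A) => eps eps0.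
(* Three errors: eps / 10 from the expansion of F_N, and twice 4 e_N <= 4 eps / 10, from the
   increments of the limit and from D_N - A. *)
have eps9 : 0 < eps / 10 by rewrite divr_gt0.
have [N nN hN] := halving_small (fun n (_ : (n0 <= n)%N) => eh n) eps9.
have [d1 d10 h1] := hD N nN _ eps9.
exists (Num.min r1 d1); first by rewrite lt_min r10.
move=> l; rewrite lt_min => /andP[lr ld].
have -> : fK (z + l) - fK z - A * l = (Fn a b N (z + l) - Fn a b N z - D N * l)
  + (- (Fn a b N (z + l) - Fn a b N z - (fK (z + l) - fK z)) + (D N - A) * l) by ring.
apply: le_trans (cabsD _ _) _; apply: le_trans (lerD (h1 _ ld) (cabsD _ _)) _.
rewrite cabsN cabsM.
have lr' : cabs (z + l - z) <= r1 by rewrite addrAC subrr add0r ltW.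
have := lim_diff N _ nN lr'; rewrite [z + l - z]addrAC subrr add0r => h2.
have h3 := ler_wpM2r (cabs_ge0 l) (hA N nN).
have h4 := ler_wpM2r (cabs_ge0 l) (hN N (leqnn _)).
have := mulr_ge0 (ltW eps0) (cabs_ge0 l); lra.
Qed.

Lemma fK_is_f_K : is_f_K (cantor_of a b) a b fK.
Proof.
split; first by move=> z; exact: fK_derivable.
exists (Fn a b); split; first by move=> n; exact: Fn_is_f_n.
move=> L cL LK; have [d [rho [d0 hL]]] := fK_uniform cL LK.
have [n0 [M [M0 small hM]]] := fK_approx rho d0.
have half : forall n, (0 <= n)%N -> M * gl n.+2 <= M * gl n.+1 / 2.
  by move=> n _; rewrite -[leRHS]mulrA ler_wpM2l ?(ltW M0) // gl_half.
move=> P /uniform_nbhs[E [entE sub]].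
move: entE; rewrite -(@entourage_ballE _ (R[i]^o : pseudoMetricType R[i])) => -[e /= e0 he].
have e1 : 0 < Re e by move: e0; rewrite ltcE => /andP[].
have [N _ hN] := halving_small half (divr_gt0 e1 (ltr0n R 2)).
near=> n; apply: sub => y Ly; apply: he => /=.
rewrite /ball /= /ball_ normE ltcE /=; move: (e0); rewrite ltcE => /andP[/eqP -> _].
rewrite eqxx cabsB /=; apply: le_lt_trans (_ : Re e / 2 < _); last by rewrite ltr_pdivrMr // ltr_pMr // ltr1n.
have nn : (maxn n0 N <= n)%N by near: n; exact: nbhs_infty_ge.
move: nn; rewrite geq_max => /andP[n1 n2].
exact: le_trans (hM _ (hL _ Ly) _ n1).2 (hN _ n2).
Unshelve. all: by end_near.
Qed.

End fK.

(** * The pole spreads from the graph of f to the graph of -f *)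

Section crossing_root.
Variable R : realType.
Implicit Types z : R[i].

Lemma sqrtc_Re_gt0 (x : R[i]) : Im x != 0 \/ 0 < Re x -> 0 < Re (sqrtc x).
Proof.
case: x => a b /= h; rewrite sqrtr_gt0 divr_gt0 //.
have r2 : Num.sqrt (a ^+ 2 + b ^+ 2) ^+ 2 = a ^+ 2 + b ^+ 2 by rewrite sqr_sqrtr // addr_ge0 ?sqr_ge0.
have := sqrtr_ge0 (a ^+ 2 + b ^+ 2); set r := Num.sqrt _ in r2 * => r0.
case: h => [b0|a0]; last by lra.
have b2 : 0 < b ^+ 2 by rewrite exprn_even_gt0.
by rewrite ltNge; apply/negP => ra; nra.
Qed.

Lemma sqr_inj_Re_gt0 (x y : R[i]) : 0 < Re x -> 0 < Re y -> x ^+ 2 = y ^+ 2 -> x = y.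
Proof. by move=> x0 y0 xy; rewrite -(sqrtc_uniq y0 erefl) -(sqrtc_uniq x0 erefl) xy. Qed.

(* Off the real axis this is [+/- 'i * sb (-1) 1], but it is holomorphic across ]-1, 1[. *)
Definition cross_root z : R[i] := sqrtc ((1 + z) / (1 - z)).

Let nice z := Im z != 0 \/ `|Re z| < 1.

Lemma nice_neq1 z : nice z -> 1 - z != 0.
Proof.
move=> h; apply: contraPneq h => z1; have -> : z = 1 by apply/esym/eqP; rewrite -subr_eq0 z1.
by rewrite /nice /= eqxx normr1 ltxx => -[].
Qed.

Lemma cross_ratio_Im z : 1 - z != 0 -> exists2 c : R, 0 < c & Im ((1 + z) / (1 - z)) = c * Im z.
Proof.
rewrite -cabs_gt0 => z1; have c0 : 0 < Re (1 - z) ^+ 2 + Im (1 - z) ^+ 2.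
  by rewrite -cabs_sqr exprn_gt0.
exists (2 / (Re (1 - z) ^+ 2 + Im (1 - z) ^+ 2)); first by rewrite divr_gt0.
by case: z {z1 c0} => x y /=; ring.
Qed.

Lemma cross_root_Re_gt0 z : nice z -> 0 < Re (cross_root z).
Proof.
move=> nz; apply: sqrtc_Re_gt0; have z1 := nice_neq1 nz.
have [c c0 e] := cross_ratio_Im z1.
case: (eqVneq (Im z) 0) nz => [im0|im0] nz; last first.
  by left; rewrite e mulf_eq0 negb_or im0 gt_eqF.
case: nz => [|]; rewrite ?im0 ?eqxx // ltr_norml => /andP[h1 h2]; right.
apply: Re_div_gt0 => //; rewrite ImD ImB im0 /= subr0 add0r mulr0 addr0.
by rewrite ReD ReB /= mulr_gt0 //; lra.
Qed.

Lemma cross_root_sqr z : cross_root z ^+ 2 = (1 + z) / (1 - z).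
Proof. by rewrite sqr_sqrtc. Qed.

Lemma cross_root_Im z : Im z != 0 -> exists2 c : R, 0 < c & Im (cross_root z) = c * Im z.
Proof.
move=> im0; have nz : nice z by left.
have [c c0 e] := cross_ratio_Im (nice_neq1 nz); have r0 := cross_root_Re_gt0 nz.
exists (c / (2 * Re (cross_root z))); first by rewrite divr_gt0 ?mulr_gt0.
have : Im (cross_root z ^+ 2) = c * Im z by rewrite cross_root_sqr.
rewrite expr2 ImM => h; rewrite mulrAC -h; field; exact: lt0r_neq0.
Qed.

Lemma sb_m11_sqr z : 1 - z != 0 -> sb (-1) 1 z ^+ 2 = - ((1 + z) / (1 - z)).
Proof.
move=> z1; rewrite sb_sqr; have -> : (1 : R)%:C = 1 :> R[i] by [].
have -> : (-1 : R)%:C = -1 :> R[i] by rewrite rmorphN.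
have z1' : z - 1 != 0 by rewrite -oppr_eq0 opprB.
by field; rewrite z1.
Qed.

(** The real part of -i T is Im T, which has the sign of Im z. As [sb] is the root with positive
    real part of the same square, the two agree above the real axis and are opposite below: this is
    the change of sign of f. *)
Lemma cross_root_up z : 0 < Im z -> - 'i%C * cross_root z = sb (-1) 1 z.
Proof.
move=> im0; have im1 : Im z != 0 by rewrite gt_eqF.
have [c c0 e] := cross_root_Im im1.
apply: sqr_inj_Re_gt0.
- rewrite ReM /=; have := mulr_gt0 c0 im0; lra.
- by apply: sb_Re_gt0; left.
rewrite sb_m11_sqr; last by apply: nice_neq1; left.
by rewrite exprMn sqrrN sqr_i mulN1r cross_root_sqr.
Qed.

Lemma cross_root_down z : Im z < 0 -> - 'i%C * cross_root z = - sb (-1) 1 z.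
Proof.
move=> im0; have im1 : Im z != 0 by rewrite lt_eqF.
have [c c0 e] := cross_root_Im im1.
rewrite mulNr; congr (- _); apply: sqr_inj_Re_gt0.
- rewrite ReM /=; have : 0 < c * - Im z by rewrite mulr_gt0 // oppr_gt0.
  lra.
- by apply: sb_Re_gt0; left.
rewrite sb_m11_sqr; last by apply: nice_neq1; left.
by rewrite exprMn sqr_i mulN1r cross_root_sqr.
Qed.

Lemma cross_root_tay2 z : nice z -> tay2 cross_root z.
Proof.
move=> nz; have [d d0 hd] : exists2 d : R, 0 < d & forall w, cabs (w - z) < d -> nice w.
  case: nz => h.
    exists `|Im z|; first by rewrite normr_gt0.
    move=> w wz; left; apply: contraTneq wz => w0; rewrite -leNgt.
    by apply: le_trans (Im_le_cabs _); rewrite ImB w0 sub0r normrN.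
  exists (1 - `|Re z|); first by rewrite subr_gt0.
  move=> w wz; right; have := Re_le_cabs (w - z); rewrite ReB => h1.
  have := ler_normD (Re w - Re z) (Re z); rewrite subrK; lra.
apply: (@tay2_sqrt _ _ (fun w => (1 + w) / (1 - w)) _ d) => //.
  by move=> w /hd nw; split; [exact: cross_root_sqr|exact: cross_root_Re_gt0].
apply: (@tay2_congr _ (fun w => -1 * ((w - -1) / (w - 1))) _ _ d) => //.
  move=> w /hd /nice_neq1 w1; have w1' : w - 1 != 0 by rewrite -oppr_eq0 opprB.
  by field; rewrite w1.
apply: tay2_mul; first exact: tay2_cst.
by apply: tay2_moebius; rewrite eq_sym -subr_eq0 nice_neq1.
Qed.

End crossing_root.

(** * Propagation of the pole along the graph of -f *)

Section hull_of_fK.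
Variable R : realType.
Variables a b : nat -> R.
Hypotheses (a0 : a 0%N = -1) (b0 : b 0%N = 1).
Hypothesis ab : forall j, (0 < j)%N -> [/\ -1 < a j, a j < b j & b j < 1].
Hypothesis len : forall j, (0 < j)%N -> b j.+1 - a j.+1 <= (b j - a j) / 2.
Hypothesis disj : forall i j, (0 < i)%N -> (0 < j)%N -> i != j -> b i < a j \/ b j < a i.
Local Notation U := (R[i]^o * R[i]^o)%type.
Variable h : U -> \bar R.
Hypothesis psh_h : psh setT h.
Implicit Types (z w : R[i]) (d rho : R).

Let f := fK a b.
Let F := Fn a b.
Let appr := fK_approx a0 b0 ab len disj.

Let gap_small eps : 0 < eps -> exists N, forall n, (N <= n)%N -> b n.+1 - a n.+1 <= eps.
Proof.
move=> eps0; have [N _ hN] := @halving_small _ (fun n => b n.+1 - a n.+1) 0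
  (fun n _ => len (ltn0Sn n)) _ eps0.
by exists N.
Qed.

Lemma fK_uniform_approx d rho eps : 0 < d -> 0 < eps -> exists N, forall n, (N <= n)%N ->
  forall z, reg a b d rho z -> cabs (F n z - f z) <= eps.
Proof.
move=> d0 eps0; have [n0 [M [M0 small hM]]] := appr rho d0.
have [N hN] := gap_small (divr_gt0 eps0 M0).
exists (maxn n0 N) => n; rewrite geq_max => /andP[n1 n2] z hz.
apply: le_trans (hM _ hz _ n1).2 _; rewrite mulrC -ler_pdivlMr //; exact: hN.
Qed.

Lemma fK_cont z : (~` in_plane (cantor_of a b)) z -> forall eps : R, 0 < eps ->
  exists2 d : R, 0 < d & forall w, cabs (w - z) < d -> cabs (f w - f z) < eps.
Proof.
move=> nz eps eps0; have [d [rho [r [d0 r0 hr]]]] := notin_cantor_reg nz.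
have [n0 [M [M0 small hM]]] := appr rho d0.
have e4 : 0 < eps / 4 by rewrite divr_gt0.
have [N hN] := fK_uniform_approx rho d0 e4.
have hz : reg a b d rho z by apply: hr; rewrite subrr cabs0 ltW.
have tF : tay2 (F (maxn n0 N)) z.
  apply: (reg_Fn_tay2 a0 b0 ab disj d0 hz) => j nj.
  by apply: small; apply: leq_ltn_trans nj; exact: leq_maxl.
have [d1 d10 h1] := tay2_continuous tF e4.
exists (Num.min d1 r); first by rewrite lt_min d10.
move=> w; rewrite lt_min => /andP[w1 w2].
have k1 := h1 _ w1; have k2 := hN _ (leq_maxr n0 N) _ (hr _ (ltW w2)); have k3 := hN _ (leq_maxr n0 N) _ hz.
set n := maxn n0 N in k1 k2 k3.
have -> : f w - f z = - (F n w - f w) + ((F n w - F n z) + (F n z - f z)) by ring.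
apply: le_lt_trans (cabsD _ _) _; rewrite cabsN.
have := cabsD (F n w - F n z) (F n z - f z); lra.
Qed.

(** A whole ball is asked for because the estimate starts from a circle around z on which h is
    -oo. *)
Definition lower_pole z := exists2 r : R, 0 < r &
  forall w, cabs (w - z) < r -> h (w, - f w) = -oo%E.

(** The annulus has its inner circle in the known ball and outer radius d / 2. The gain is that d /
    2 depends only on the distance from z to the Cantor set, not on r, so finitely many steps cross
    a compact segment. *)
Lemma lower_pole_ball d rho z w : 0 < d -> reg a b d rho z -> lower_pole z ->
  cabs (w - z) < d / 2 -> h (w, - f w) = -oo%E.
Proof.
move=> d0 hz [r r0 hr] wz.
have [wr|wr] := ltP (cabs (w - z)) (Num.min r (d / 2) / 2).
  by apply: hr; apply: lt_le_trans wr _; have := ge_min r r (d / 2); rewrite lexx /= => ?; lra.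
set rho' := Num.min r (d / 2) / 2 in wr.
have d2 : 0 < d / 2 by rewrite divr_gt0.
have m0 : 0 < Num.min r (d / 2) by rewrite lt_min r0.
have rho'0 : 0 < rho' by rewrite divr_gt0.
have rho'd : rho' < d / 2.
  by have := ge_min (d / 2) r (d / 2); rewrite lexx orbT /rho' => ?; lra.
have rho'r : rho' < r.
  by have := ge_min r r (d / 2); rewrite lexx /rho' => ?; lra.
have regb v : cabs (v - z) <= d / 2 -> reg a b (d / 2) (rho + d) v.
  move=> vz; split; first by have := cabsD (v - z) z; rewrite subrK; have := hz.1; lra.
  move=> x Kx; have := hz.2 x Kx; have := cabsD (z - v) (v - x%:C).
  by rewrite addrA subrK (cabsB z v); lra.
have [n0 [M [M0 small hM]]] := appr (rho + d) d2.
have hw := regb w (ltW wz).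
(* The added constant makes the value at w equal to - f w for every k and tends to 0; starting at n0
   secures the expansions and the uniform bound. *)
pose G k v := -1 * F (n0 + k)%N v + (F (n0 + k)%N w - f w).
apply: (@psh_hull_limit _ h z rho' (d / 2) (fun=> 0%N) (fun=> 0) (fun=> 0) (fun=> 0) G
  (fun v => - f v) w (- f w) (M + (M + (M + cabs (f w)))) (ln (d / 2 / cabs (w - z)))) => //.
- move=> k v v1 v2 _; split.
    apply: tay2_addcst; apply: tay2_mul; first exact: tay2_cst.
    apply: (reg_Fn_tay2 a0 b0 ab disj d2 (regb _ v2)) => j nj; apply: small.
    by apply: leq_ltn_trans nj; exact: leq_addr.
  have k1 := (hM _ (regb _ v2) _ (leq_addr k n0)).1.
  have k2 := (hM _ hw _ (leq_addr k n0)).1.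
  rewrite /G mulN1r; apply: le_trans (cabsD _ _) _; rewrite cabsN -/F in k1 k2 *.
  have := cabsD (F (n0 + k)%N w) (- f w); rewrite cabsN; lra.
- move=> v vz eps eps0; have nv : (~` in_plane (cantor_of a b)) v.
    by apply: (reg_notin d2 (regb v _)); rewrite vz ltW.
  have [e e0 he] := fK_cont nv eps0; exists e => // v' /he.
  by rewrite opprK [- f v' + _]addrC cabsB.
- move=> eps eps0; have e3 : 0 < eps / 3 by rewrite divr_gt0.
  have [N hN] := fK_uniform_approx (rho + d) d2 e3.
  exists N => v vz; have v2 : cabs (v - z) <= d / 2 by rewrite vz ltW.
  have k1 := hN _ (leq_addl n0 N) _ (regb _ v2); have k2 := hN _ (leq_addl n0 N) _ hw.
  have -> : G N v - - f v = - (F (n0 + N)%N v - f v) + (F (n0 + N)%N w - f w) by rewrite /G; ring.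
  by apply: le_lt_trans (cabsD _ _) _; rewrite cabsN; lra.
- by move=> v vz; apply: hr; rewrite vz.
- exact: ltW.
- by move=> k; rewrite /G; ring.
- have w0 : 0 < cabs (w - z) by exact: lt_le_trans wr.
  by rewrite ln_gt0 // ltr_pdivlMr // mul1r.
- by move=> k; rewrite big_ord0 subr0.
Qed.

Lemma lower_pole_step d rho z w : 0 < d -> reg a b d rho z -> lower_pole z ->
  cabs (w - z) < d / 2 -> lower_pole w.
Proof.
move=> d0 hz lz wz; exists (d / 2 - cabs (w - z)); first by rewrite subr_gt0.
move=> v vw; apply: (lower_pole_ball d0 hz lz).
by have := cabsD (v - w) (w - z); rewrite addrA subrK; lra.
Qed.

Lemma lower_pole_segment (p q : R[i]) :
  (forall t : R, 0 <= t <= 1 -> (~` in_plane (cantor_of a b)) (p + t%:C * (q - p))) ->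
  lower_pole p -> lower_pole q.
Proof.
move=> hpq lp.
pose L : set R[i]^o := (fun t : R => p + t%:C * (q - p)) @` `[0, 1].
have cL : compact L.
  apply: continuous_compact; last exact: segment_compact.
  apply: continuous_subspaceT => t; apply: cvg_cD; first exact: cvg_c_cst.
  apply: cvg_cM; last exact: cvg_c_cst.
  by apply: (@ReIm_continuous _ _ id (fun=> 0)) => s; [exact: cvg_id|exact: cvg_cst].
have LK : L `<=` ~` in_plane (cantor_of a b).
  by move=> _ [t /= t1 <-]; apply: hpq; rewrite in_itv /= in t1.
have [d [rho [d0 hL]]] := fK_uniform cL LK.
have [n hn] : exists n : nat, cabs (q - p) < d / 2 * n.+1%:R.
  have := archi_boundP (divr_ge0 (cabs_ge0 (q - p)) (ltW (divr_gt0 d0 (ltr0n R 2)))).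
  set n := Num.bound _ => hn; exists n; rewrite mulrC -ltr_pdivrMr ?divr_gt0 //.
  by apply: lt_trans hn _; rewrite ltr_nat.
pose x k := p + (k%:R / n.+1%:R : R)%:C * (q - p).
have n10 : 0 < n.+1%:R :> R by [].
have hx k : (k <= n.+1)%N -> lower_pole (x k).
  elim: k => [|k IH] kn; first by rewrite /x mul0r mul0r addr0.
  apply: (@lower_pole_step d rho (x k)) => //; last 2 first.
  - exact: IH (ltnW kn).
  - have -> : x k.+1 - x k = (n.+1%:R^-1 : R)%:C * (q - p).
      rewrite /x; have -> : k.+1%:R / n.+1%:R = k%:R / n.+1%:R + n.+1%:R^-1 :> R.
        by rewrite -natr1 mulrDl mul1r.
      by rewrite rmorphD /=; ring.
    by rewrite cabsM cabs_real gtr0_norm ?invr_gt0 // mulrC ltr_pdivrMr.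
  apply: hL; exists (k%:R / n.+1%:R) => //=; rewrite in_itv /= divr_ge0 //=.
  by rewrite ler_pdivrMr // mul1r ler_nat ltnW.
have := hx _ (leqnn _); rewrite /x divff ?pnatr_eq0 //.
by rewrite mul1r addrC subrK.
Qed.

Lemma lower_pole_all (p : R[i]) : Im p < 0 -> lower_pole p ->
  forall z, (~` in_plane (cantor_of a b)) z -> h (z, - f z) = -oo%E.
Proof.
move=> p0 l0 z nz.
suff : lower_pole z by case=> e e0; apply; rewrite subrr cabs0.
have notK (w : R[i]) : Im w != 0 \/ 1 < Re w -> (~` in_plane (cantor_of a b)) w.
  move=> hw [x /(cantor_ofP a0 b0)[/andP[x1 x2] _] xw]; move: hw; rewrite -xw /= eqxx.
  by case=> //; lra.
have imE (p1 q : R[i]) t : Im (p1 + t%:C * (q - p1)) = Im p1 + t * (Im q - Im p1).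
  by rewrite ImD ImM ImB /=; ring.
have reE (p1 q : R[i]) t : Re (p1 + t%:C * (q - p1)) = Re p1 + t * (Re q - Re p1).
  by rewrite ReD ReM ReB /=; ring.
have [imz|imz] := leP (Im z) 0.
  apply: (lower_pole_segment _ l0) => t /andP[t0 t1].
  have [->|t1'] := eqVneq t 1; first by rewrite mul1r addrC subrK.
  have {}t1 : t < 1 by rewrite lt_neqAle t1'.
  by apply: notK; left; rewrite imE /= lt_eqF //; nra.
(* The upper half plane is reached by going around the Cantor set on its right, through 2 - i and 2
   + i; the other points are joined to p by a segment that stays below the real axis except perhaps
   at its end. *)
have l1 : lower_pole (2 -i* 1).
  apply: (lower_pole_segment _ l0) => t /andP[t0 t1].
  by apply: notK; left; rewrite imE /= lt_eqF //; nra.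
have l2 : lower_pole (2 +i* 1).
  apply: (lower_pole_segment _ l1) => t /andP[t0 t1].
  by apply: notK; right; rewrite reE /=; lra.
apply: (lower_pole_segment _ l2) => t /andP[t0 t1].
by apply: notK; left; rewrite imE /= gt_eqF //; nra.
Qed.

End hull_of_fK.

(** * Crossing the Cantor set from the upper to the lower half plane *)

Section crossing.
Variable R : realType.
Variables a b : nat -> R.
Hypotheses (a0 : a 0%N = -1) (b0 : b 0%N = 1).
Hypothesis ab : forall j, (0 < j)%N -> [/\ -1 < a j, a j < b j & b j < 1].
Hypothesis len : forall j, (0 < j)%N -> b j.+1 - a j.+1 <= (b j - a j) / 2.
Hypothesis disj : forall i j, (0 < i)%N -> (0 < j)%N -> i != j -> b i < a j \/ b j < a i.
(** Being at least 16 makes every r_j at most 1 / 16, so the target disc, which has Im <= -1 / 16,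
    avoids all excluded discs. [Aln] keeps the loss caused by these discs below half of the
    available ln (12 / 11). *)
Variable A : R.
Hypothesis A16 : 16 <= A.
Hypothesis Aln : 2 * (ln 3 * ln 64 / A) <= ln (12 / 11) / 2.
Hypothesis tiny : forall j, b j.+1 - a j.+1 <= expR (- (A * 8 ^+ j)) ^+ 2.
Local Notation U := (R[i]^o * R[i]^o)%type.
Implicit Types (z w : R[i]).

Lemma Fn_prod n z : Fn a b n z = sb (-1) 1 z * \prod_(j < n) sb (b j.+1) (a j.+1) z.
Proof.
elim: n => [|n IH]; first by rewrite (Fn0 a0 b0) big_ord0 mulr1.
by rewrite (FnS a0 b0 ab disj) big_ord_recr /= IH mulrA.
Qed.

Lemma prod_le_expR2 (s : nat -> R) k : (forall j, (j < k)%N -> 0 <= s j <= 1 + 8^-1 ^+ j) ->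
  \prod_(j < k) s j <= expR 2.
Proof.
move=> hs; apply: (@le_trans _ _ (\prod_(j < k) (1 + 8^-1 ^+ j))).
  by apply: ler_prod => j _; exact: hs.
have e0 (n : nat) : 0 <= 8^-1 ^+ n :> R by rewrite exprn_ge0 // invr_ge0.
have := @growth_bound _ (fun n => \prod_(j < n) (1 + 8^-1 ^+ j)) (fun n => 8^-1 ^+ n : R) 0%N.
rewrite big_ord0 mul1r expr0 mulr1; apply => //.
- by move=> n _; apply: prodr_ge0 => j _; rewrite addr_ge0.
- by move=> n _; rewrite big_ord_recr.
- by move=> n _; rewrite exprSr ler_wpM2l // lef_pV2 ?posrE // ler_nat.
Qed.

Lemma sum_inv8_le k : \sum_(j < k) 8^-1 ^+ j <= 2 :> R.
Proof.
suff : \sum_(j < k) 8^-1 ^+ j <= 2 - 2 * 8^-1 ^+ k :> R.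
  by move=> /le_trans; apply; rewrite gerBl mulr_ge0 // exprn_ge0 // invr_ge0.
elim: k => [|k IH]; first by rewrite big_ord0 expr0; lra.
have e0 : 0 <= 8^-1 ^+ k :> R by rewrite exprn_ge0 // invr_ge0.
by rewrite big_ord_recr /= exprSr; lra.
Qed.

Let y j := A * 8 ^+ j.
Let A0 : 0 < A. Proof. by apply: lt_le_trans A16. Qed.
Let y_gt0 j : 0 < y j. Proof. by rewrite mulr_gt0 // exprn_gt0. Qed.

(** The radius of the disc around a_(j+1), with ln (1 / r j) = y j; the gap there has length at most
    (r j)^2. *)
Let r j := expR (- y j).
Let r_gt0 j : 0 < r j. Proof. exact: expR_gt0. Qed.

Let r_le j : r j <= 1 / 16 /\ r j <= 8^-1 ^+ j.
Proof.
have h1 : 1 <= 8 ^+ j :> R by apply: exprn_ege1; rewrite ler1n.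
have hr : r j <= (y j)^-1.
  rewrite /r expRN lef_pV2 ?posrE ?expR_gt0 //.
  by have := expR_ge1Dx (y j); lra.
split; apply: le_trans hr _.
  rewrite div1r lef_pV2 ?posrE // /y; apply: le_trans A16 _.
  by rewrite ler_peMr ?(ltW A0).
rewrite exprVn lef_pV2 ?posrE ?exprn_gt0 // /y ler_peMl ?exprn_ge0 //.
by apply: le_trans A16; rewrite ler1n.
Qed.

Variable h : U -> \bar R.
Hypothesis psh_h : psh setT h.
Hypothesis pole : forall z, (~` in_plane (cantor_of a b)) z -> h (z, fK a b z) = -oo%E.

(** The circle of radius 1 / 4 about e stays in Im >= 1 / 4. The disc of radius 3 / 4 stays in |Re|
    <= 3 / 4, away from the singularities -1 and 1 of [cross_root], and contains the target disc,
    since 5 / 8 + 1 / 16 = 11 / 16. *)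
Let e : R[i] := 0 +i* (1 / 2).

Lemma off_gap_disc j z : r j <= cabs (z - (a j.+1)%:C) ->
  off (b j.+1) (a j.+1) z /\ cabs (sb (b j.+1) (a j.+1) z) <= 1 + 8^-1 ^+ j.
Proof.
move=> rz; have [_ abj _] := ab (ltn0Sn j); have [r1 r2] := r_le j.
have lr : b j.+1 - a j.+1 < r j.
  by have := tiny j; rewrite -/(y j) -/(r j); have := r_gt0 j; nra.
have ofz : off (b j.+1) (a j.+1) z.
  have [im0|] := eqVneq (Im z) 0; last by left.
  have cz : cabs (z - (a j.+1)%:C) = `|Re z - a j.+1|.
    by rewrite /cabs ReB ImB /= im0 subr0 expr0n /= addr0 sqrtr_sqr.
  rewrite cz ler_normr in rz; right; case/orP: rz => rz; last by left; split; lra.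
  by right; split; lra.
split=> //; have := sb_sub1 ofz; rewrite ger0_norm ?subr_ge0 ?(ltW abj) // => h1.
have h2 : (b j.+1 - a j.+1) / cabs (z - (a j.+1)%:C) <= r j.
  rewrite ler_pdivrMr ?(lt_le_trans (r_gt0 j)) //; apply: le_trans (tiny j) _.
  by rewrite -/(y j) -/(r j) expr2 ler_wpM2l // ltW.
by have := cabsD (sb (b j.+1) (a j.+1) z - 1) 1; rewrite subrK cabs1; lra.
Qed.

Lemma cross_root_le z : cabs (z - e) <= 3 / 4 -> cabs (cross_root z) <= 3.
Proof.
move=> ze; have e1 : cabs e = 1 / 2.
  by rewrite /e /cabs /= expr0n /= add0r sqrtr_sqr ger0_norm.
have h1 : cabs (1 + z) <= 9 / 4.
  have := cabsD 1 z; have := cabsD (z - e) e; rewrite subrK cabs1; lra.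
have h2 : 1 / 4 <= cabs (1 - z).
  have := Re_le_cabs (z - e); rewrite ReB /= subr0 ler_norml => /andP[h3 h4].
  apply: le_trans (le_trans (ler_norm _) (Re_le_cabs _)); rewrite ReB /=; lra.
rewrite -(ler_pXn2r (ltn0Sn 1)) ?nnegrE ?cabs_ge0 // -cabsX cross_root_sqr cabs_div.
by rewrite ler_pdivrMr; [lra|exact: lt_le_trans h2].
Qed.

(** Here 64 = 4 / (1 / 16), ln 3 comes from the ratio of the radii 3 / 4 and 1 / 4, and 12 / 11 = (3
    / 4) / (11 / 16). Half of ln (12 / 11) is spent on the discs, the other half remains as
    delta. *)
Lemma gap_sum_le k w : (forall j, 1 / 16 <= cabs (w - (a j.+1)%:C)) ->
  \sum_(j < k) ln 3 / y j * ln (4 / cabs (w - (a j.+1)%:C)) <= ln (12 / 11) / 2.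
Proof.
move=> wm; have ln3 : 0 < ln 3 :> R by rewrite ln_gt0 // ltr1n.
have l64 : 0 <= ln 64 :> R by rewrite ln_ge0 // ler1n.
apply: le_trans Aln.
apply: (@le_trans _ _ (\sum_(j < k) ln 3 * ln 64 / A * 8^-1 ^+ j)).
  apply: ler_sum => j _; have -> : ln 3 * ln 64 / A * 8^-1 ^+ j = ln 3 / y j * ln 64.
    by rewrite /y invfM exprVn; ring.
  rewrite ler_wpM2l ?divr_ge0 ?(ltW ln3) ?(ltW (y_gt0 j)) //.
  have w0 : 0 < cabs (w - (a j.+1)%:C) by apply: lt_le_trans (wm j).
  rewrite ler_ln ?posrE ?divr_gt0 // ler_pdivrMr //; have := wm j; lra.
rewrite -mulr_sumr [leRHS]mulrC ler_wpM2l ?sum_inv8_le //.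
by rewrite divr_ge0 ?mulr_ge0 ?(ltW A0) ?(ltW ln3).
Qed.

Lemma off_axis_reg z d : d <= `|Im z| -> cabs z <= 1 -> reg a b d 1 z.
Proof.
move=> dz z1; split=> // x _; apply: le_trans (Im_le_cabs _).
by rewrite ImB /= subr0.
Qed.

Lemma lower_pole_near w : cabs (w - (0 -i* (1 / 8))) < 1 / 16 -> h (w, - fK a b w) = -oo%E.
Proof.
move=> hw.
have imw : Im w <= - (1 / 16).
  by have := Im_le_cabs (w - (0 -i* (1 / 8))); rewrite ImB /= ler_norml => /andP[_]; lra.
have d16 : 0 < 1 / 16 :> R by [].
have c8 : cabs (0 -i* (1 / 8)) = 1 / 8 :> R.
  by rewrite /cabs /= expr0n /= add0r sqrrN sqrtr_sqr ger0_norm.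
have c58 : cabs (0 -i* (1 / 8) - e) = 5 / 8 :> R.
  by rewrite /cabs ReB ImB /= subrr expr0n /= add0r sqrtr_sqr ler0_norm; lra.
have regw : reg a b (1 / 16) 1 w.
  apply: off_axis_reg; first by rewrite ler0_norm; lra.
  by have := cabsD (w - (0 -i* (1 / 8))) (0 -i* (1 / 8)); rewrite subrK; lra.
have we : cabs (w - e) <= 11 / 16.
  by have := cabsD (w - (0 -i* (1 / 8))) (0 -i* (1 / 8) - e); rewrite addrA subrK; lra.
have we1 : 9 / 16 <= cabs (w - e).
  by apply: le_trans (Im_le_cabs _); rewrite ImB /= ler0_norm; lra.
have regc z : cabs (z - e) = 1 / 4 -> reg a b (1 / 16) 1 z /\ 0 < Im z.
  move=> ze; have := Im_le_cabs (z - e); rewrite ImB /= ler_norml ze => /andP[h1 h2].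
  split; last by lra.
  apply: off_axis_reg; first by rewrite ger0_norm; lra.
  have := cabsD (z - e) e; rewrite subrK /e {3}/cabs /= expr0n /= add0r sqrtr_sqr ger0_norm //.
  by rewrite -/e ze; lra.
pose P k z := \prod_(j < k) sb (b j.+1) (a j.+1) z.
(* Above the real axis this is F_k, below it - F_k, up to a constant that tends to 0 and makes the
   value at w exactly - f w. *)
pose G k z := - 'i%C * cross_root z * P k z + (Fn a b k w - fK a b w).
have Gw k : G k w = - fK a b w.
  rewrite /G cross_root_down; last by lra.
  by rewrite Fn_prod /P; ring.
have [n0 [M [M0 small hM]]] := fK_approx a0 b0 ab len disj 1 d16.
have wm j : 1 / 16 <= cabs (w - (a j.+1)%:C).
  by apply: le_trans (Im_le_cabs _); rewrite ImB /= subr0 ler0_norm; lra.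
have Pbound k z : (forall j, (j < k)%N -> r j <= cabs (z - (a j.+1)%:C)) -> cabs (P k z) <= expR 2.
  move=> hz; rewrite cabs_prod; apply: (@prod_le_expR2 (fun j => cabs (sb (b j.+1) (a j.+1) z))).
  by move=> j jk; rewrite cabs_ge0 /=; exact: (off_gap_disc (hz j jk)).2.
have ln3 : 0 < ln 3 :> R by rewrite ln_gt0 // ltr1n.
apply: (@psh_hull_limit _ h e (1 / 4) (3 / 4) id (fun j => (a j.+1)%:C) r
  (fun j => ln 3 / y j) G (fK a b) w (- fK a b w)
  (3 * expR 2 + (3 * expR 2 + cabs (sb (-1) 1 w) * expR 2 + cabs (fK a b w)))
  (ln (12 / 11) / 2)) => //.
- lra.
- move=> k j _; split => //.
  + have [h1 h2 h3] := ab (ltn0Sn j).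
    apply: (@le_trans _ _ ((1 + 1 / 2) + 3 / 4)); last by lra.
    rewrite lerD2r; apply: le_trans (cabs_le_ReIm _) _; rewrite ReB ImB /= subr0 sub0r normrN.
    apply: lerD; last by rewrite ger0_norm.
    by rewrite ler_norml; apply/andP; split; lra.
  + by rewrite divr_ge0 ?ltW.
  (* The weight is chosen so that c_j ln (1 / r_j) equals ln 3; the factor 4 only increases the
     right-hand side. *)
  + have -> : 3 / 4 / (1 / 4) = 3 :> R by field.
    rewrite -[leLHS](@divfK _ (y j)) ?gt_eqF // ler_wpM2l ?divr_ge0 ?(ltW ln3) ?(ltW (y_gt0 j)) //.
    rewrite -[leLHS]expRK ler_ln ?posrE ?expR_gt0 ?divr_gt0 //.
    by rewrite /r expRN invrK ler_peMl ?expR_ge0 // ler1n.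
- move=> k z z1 z2 zm; have nz : Im z != 0 \/ `|Re z| < 1.
    right; have := Re_le_cabs (z - e); rewrite ReB /= subr0; lra.
  have e2 := expR_gt0 (2 : R).
  split.
    apply: tay2_addcst; apply: tay2_mul.
      by apply: tay2_mul; [exact: tay2_cst|exact: cross_root_tay2].
    apply: (@tay2_prod _ k (fun j => sb (b j.+1) (a j.+1))) => j jk.
    by apply: sb_tay2; exact: (off_gap_disc (zm j jk)).1.
  have k1 := Pbound _ _ zm; have k2 := cross_root_le z2.
  have k3 : cabs (P k w) <= expR 2.
    by apply: Pbound => j _; apply: le_trans (wm j); exact: (r_le j).1.
  have ii : cabs (- 'i%C) = 1 :> R by rewrite cabsN /cabs /= expr0n expr1n /= add0r sqrtr1.
  have k4 : cabs (- 'i%C * cross_root z * P k z) <= 3 * expR 2.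
    by rewrite !cabsM ii mul1r; apply: ler_pM; rewrite ?cabs_ge0.
  have k5 : cabs (Fn a b k w) <= cabs (sb (-1) 1 w) * expR 2.
    by rewrite Fn_prod cabsM ler_wpM2l ?cabs_ge0.
  apply: le_trans (cabsD _ _) _; apply: lerD => //; apply: le_trans (cabsD _ _) _.
  by rewrite cabsN lerD2r; lra.
- by move=> z /regc[hz _]; apply: (fK_cont a0 b0 ab len disj); exact: reg_notin hz.
- move=> eps eps0; have e3 : 0 < eps / 3 by rewrite divr_gt0.
  have [k hk] := fK_uniform_approx a0 b0 ab len disj 1 d16 e3.
  exists k => z /regc[hz imz]; have k1 := hk _ (leqnn _) _ hz; have k2 := hk _ (leqnn _) _ regw.
  have -> : G k z - fK a b z = (Fn a b k z - fK a b z) + (Fn a b k w - fK a b w).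
    by rewrite /G cross_root_up // (Fn_prod k z) -/(P k z); ring.
  by apply: le_lt_trans (cabsD _ _) _; lra.
- by move=> z /regc[hz _]; apply: pole; exact: reg_notin hz.
- lra.
- lra.
- by move=> k j _; apply: le_trans (wm j); exact: (r_le j).1.
- by rewrite divr_gt0 // ln_gt0 // ltr_pdivlMr // mul1r ltr_nat.
- move=> k; have h1 : ln (12 / 11) <= ln (3 / 4 / cabs (w - e)).
    have w0 : 0 < cabs (w - e) by apply: lt_le_trans we1.
    rewrite ler_ln ?posrE ?divr_gt0 // ler_pdivlMr //; lra.
  have := gap_sum_le k wm; lra.
Qed.

Lemma fK_neg_pole z : (~` in_plane (cantor_of a b)) z -> h (z, - fK a b z) = -oo%E.
Proof.
apply: (@lower_pole_all _ _ _ a0 b0 ab len disj _ psh_h (0 -i* (1 / 8))); first by rewrite /= oppr_lt0.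
by exists (1 / 16) => // w; exact: lower_pole_near.
Qed.

End crossing.

(** * The potential that separates other points *)

Section real_estimates.
Variable R : realType.

Lemma add4_le_pow2 n : (n + 4)%:R <= 4 * 2 ^+ n :> R.
Proof. by rewrite -natrX -natrM ler_nat; elim: n => [//|k IH]; rewrite expnS; lia. Qed.

Lemma linear_le_pow4 (c : R) : exists N, forall n, (N <= n)%N -> (n + 4)%:R * c <= 4 ^+ n.
Proof.
have hh n : (0 <= n)%N -> `|c| * 4 * 2^-1 ^+ n.+1 <= `|c| * 4 * 2^-1 ^+ n / 2.
  by move=> _; rewrite exprSr mulrA.
have [N _ hN] := halving_small hh (ltr01 : 0 < 1 :> R).
exists N => n /hN; have p2 : 0 < 2 ^+ n :> R by rewrite exprn_gt0.
rewrite exprVn ler_pdivrMr // mul1r => h.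
have -> : 4 ^+ n = 2 ^+ n * 2 ^+ n :> R by rewrite -exprMn; congr (_ ^+ _); ring.
have n4 := add4_le_pow2 n.
apply: (@le_trans _ _ (4 * 2 ^+ n * `|c|)).
  apply: le_trans (_ : (n + 4)%:R * `|c| <= _); first by rewrite ler_wpM2l ?ler_norm.
  by rewrite ler_wpM2r.
have := ler_wpM2r (ltW p2) h; lra.
Qed.

Lemma partial_sum_lower (u : nat -> R) (D : R) (N : nat) : 0 <= D ->
  (forall n, (N <= n)%N -> - (D * 2^-1 ^+ n) <= u n) ->
  exists m, forall k, m <= \sum_(n < k) u n.
Proof.
move=> D0 hu; pose s k := \sum_(n < k) `|u n|.
exists (- s N - 2 * D) => k.
suff : forall k, - s N - 2 * D + 2 * D * 2^-1 ^+ k <= \sum_(n < k) u n.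
  move=> /(_ k); apply: le_trans; rewrite lerDl mulr_ge0 ?exprn_ge0 ?invr_ge0 ?mulr_ge0 //.
move=> {}k; have [kN|/ltnW Nk] := leqP k N.
  apply: (@le_trans _ _ (- s k)); last first.
    rewrite lerNl -sumrN; apply: ler_sum => n _; rewrite -[leLHS]opprK; rewrite opprK.
    by apply: le_trans (ler_norm _) _; rewrite normrN.
  have sk : s k <= s N.
    elim: N kN {hu} => [|N IH]; first by rewrite leqn0 => /eqP ->.
    rewrite leq_eqVlt => /predU1P[->//|]; rewrite ltnS => /IH h.
    by apply: le_trans h _; rewrite [leRHS]/s big_ord_recr lerDl.
  have : 2 * D * 2^-1 ^+ k <= 2 * D.
    by rewrite ler_piMr ?mulr_ge0 // exprn_ile1 ?invr_ge0 // invf_le1 // ler1n.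
  lra.
elim: k Nk => [|k IH]; first by rewrite leqn0 => /eqP ->; rewrite /s !big_ord0 expr0; lra.
rewrite leq_eqVlt => /predU1P[<-|].
  have : - s N <= \sum_(n < N) u n.
    rewrite lerNl -sumrN; apply: ler_sum => n _.
    by apply: le_trans (ler_norm _) _; rewrite normrN.
  have : 2 * D * 2^-1 ^+ N <= 2 * D.
    by rewrite ler_piMr ?mulr_ge0 // exprn_ile1 ?invr_ge0 // invf_le1 // ler1n.
  lra.
rewrite ltnS => Nk; rewrite big_ord_recr /= exprSr; have := IH Nk; have := hu _ Nk; lra.
Qed.

Lemma weighted_sum_le (B c q q' p : R) : 2 <= B -> 0 <= c <= B - 1 -> 0 <= q <= p -> q' <= p ->
  c ^+ 2 * q + q' <= B ^+ 2 * p.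
Proof.
move=> B2 /andP[c0 cB] /andP[q0 qp] q'p.
have c2 : c ^+ 2 <= (B - 1) ^+ 2 by nra.
have : c ^+ 2 * q <= (B - 1) ^+ 2 * p by apply: ler_pM; rewrite ?sqr_ge0.
nra.
Qed.

Lemma sqr_shift_le (B X D d : R) : 2 <= B -> 1 <= X -> 0 <= D <= X -> d <= 1 ->
  D ^+ 2 + d <= (B * X) ^+ 2.
Proof.
move=> B2 X1 /andP[D0 DX] d1.
have h1 : D ^+ 2 <= X ^+ 2 by nra.
have h2 : 1 <= X ^+ 2 by exact: exprn_ege1.
have h3 : 4 * X ^+ 2 <= B ^+ 2 * X ^+ 2 by rewrite ler_wpM2r ?sqr_ge0 //; nra.
rewrite exprMn; lra.
Qed.

End real_estimates.

(** * The numerator and denominator of f_n^2 as polynomials *)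

Section root_polynomials.
Variable R : realType.
Implicit Types (p : R) (u : nat -> R) (z : R[i]).

Definition root_poly p u n : {poly R[i]} :=
  ('X - (p%:C)%:P) * \prod_(j < n) ('X - ((u j.+1)%:C)%:P).

Lemma root_poly0 p u z : (root_poly p u 0).[z] = z - p%:C.
Proof. by rewrite /root_poly big_ord0 mulr1 hornerXsubC. Qed.

Lemma root_polyS p u n z :
  (root_poly p u n.+1).[z] = (root_poly p u n).[z] * (z - (u n.+1)%:C).
Proof. by rewrite /root_poly big_ord_recr /= mulrA hornerM hornerXsubC. Qed.

Lemma root_poly_le p u n z : `|p| <= 1 -> (forall j, (0 < j)%N -> `|u j| <= 1) ->
  cabs (root_poly p u n).[z] <= (cabs z + 1) ^+ n.+1.
Proof.
move=> p1 u1; have z1 : 0 <= cabs z + 1 by rewrite addr_ge0 ?cabs_ge0.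
have fac x : `|x| <= 1 -> cabs (z - x%:C) <= cabs z + 1.
  by move=> x1; apply: le_trans (cabsD _ _) _; rewrite cabsN cabs_real lerD2l.
elim: n => [|n IH]; first by rewrite root_poly0 expr1 fac.
by rewrite root_polyS cabsM exprSr ler_pM ?cabs_ge0 ?exprn_ge0 // fac ?u1.
Qed.

Lemma root_poly_ge p u n z (d : R) : 0 <= d -> d <= cabs (z - p%:C) ->
  (forall j, (0 < j)%N -> d <= cabs (z - (u j)%:C)) ->
  d ^+ n.+1 <= cabs (root_poly p u n).[z].
Proof.
move=> d0 dp du; elim: n => [|n IH]; first by rewrite root_poly0 expr1.
by rewrite root_polyS cabsM [in leLHS]exprSr ler_pM ?exprn_ge0 // du.
Qed.

(** The identity Q_n f_n^2 = P_n: each factor satisfies (z - u) sb(v, u)^2 = z - v, so every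
    denominator is cleared by its own root. *)
Lemma root_poly_sb u v n z : z != (1 : R)%:C -> (forall j, (0 < j)%N -> z != (u j)%:C) ->
  (root_poly 1 u n).[z] * (sb (-1) 1 z * \prod_(j < n) sb (v j.+1) (u j.+1) z) ^+ 2
  = (root_poly (-1) v n).[z].
Proof.
move=> z1 zu; have frac x y : z != y%:C -> (z - y%:C) * sb x y z ^+ 2 = z - x%:C.
  by move=> zy; rewrite sb_sqr mulrCA divff ?mulr1 // subr_eq0.
elim: n => [|n IH]; first by rewrite !root_poly0 big_ord0 mulr1 frac.
rewrite !root_polyS -IH big_ord_recr /= -(frac (v n.+1) (u n.+1)) ?zu //; ring.
Qed.

End root_polynomials.

Section potential.
Variable R : realType.
Variables a b : nat -> R.
Hypotheses (a0 : a 0%N = -1) (b0 : b 0%N = 1).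
Hypothesis ab : forall j, (0 < j)%N -> [/\ -1 < a j, a j < b j & b j < 1].
Hypothesis len : forall j, (0 < j)%N -> b j.+1 - a j.+1 <= (b j - a j) / 2.
Hypothesis disj : forall i j, (0 < i)%N -> (0 < j)%N -> i != j -> b i < a j \/ b j < a i.
Variable A : R.
Hypothesis A16 : 16 <= A.
Hypothesis tiny : forall j, b j.+1 - a j.+1 <= expR (- (A * 8 ^+ j)) ^+ 2.
Local Notation U := (R[i]^o * R[i]^o)%type.
Implicit Types (z w : R[i]) (x : U).

Definition defect n x : R[i] :=
  x.2 ^+ 2 * (root_poly 1 a n).[x.1] - (root_poly (-1) b n).[x.1].

(** The regularization keeps the terms finite and continuous. On the graph it decides their size:
    weighted by 8^-n / 2 its logarithm is -2, while for a polynomial bounded by B^(n+3) the weight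
    leaves only (n + 4) 8^-n, which 2^-n absorbs. *)
Let dn n : R := expR (- (4 * 8 ^+ n)).

Definition potential n x : R :=
  8^-1 ^+ n / 2 * ln (cabs (defect n x) ^+ 2 + dn n) - 2^-1 ^+ n.

Let pos n x : 0 < cabs (defect n x) ^+ 2 + dn n.
Proof. by rewrite ltr_wpDl ?sqr_ge0 // expR_gt0. Qed.

Let w8_gt0 n : 0 < 8^-1 ^+ n / 2 :> R.
Proof. by rewrite divr_gt0 // exprn_gt0 // invr_gt0. Qed.

Let potential_le n x y : cabs (defect n x) ^+ 2 + dn n <= expR y ->
  potential n x <= 8^-1 ^+ n / 2 * y - 2^-1 ^+ n.
Proof.
move=> h; rewrite lerD2r ler_wpM2l ?(ltW (w8_gt0 n)) //.
by rewrite -[leRHS]expRK ler_ln ?posrE ?pos ?expR_gt0.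
Qed.

Let potential_ge n x y : expR y <= cabs (defect n x) ^+ 2 + dn n ->
  8^-1 ^+ n / 2 * y - 2^-1 ^+ n <= potential n x.
Proof.
move=> h; rewrite lerD2r ler_wpM2l ?(ltW (w8_gt0 n)) //.
by rewrite -[leLHS]expRK ler_ln ?posrE ?pos ?expR_gt0.
Qed.

Lemma potential_continuous n : continuous (potential n).
Proof.
have cD : continuous (defect n : U -> R[i]^o).
  move=> x; have c1 : (fun y : U => y.1) @ nbhs x --> (x.1 : R[i]^o) by exact: cvg_fst.
  have c2 : (fun y : U => y.2) @ nbhs x --> (x.2 : R[i]^o) by exact: cvg_snd.
  have cp (p : {poly R[i]}) : (fun y : U => p.[y.1] : R[i]^o) @ nbhs x --> (p.[x.1] : R[i]^o).
    exact: (@cvg_comp _ _ _ (fun y : U => y.1) (fun z => p.[z] : R[i]^o) _ _ _ c1 (@horner_continuous _ p x.1)).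
  have -> : (defect n : U -> R[i]^o)
      = fun y : U => y.2 * y.2 * (root_poly 1 a n).[y.1] + (- root_poly (-1) b n).[y.1].
    by apply/funext => y; rewrite /defect hornerN expr2.
  apply: (@cvg_cD _ _ (nbhs x) (nbhs_filter x)); last exact: cp.
  apply: (@cvg_cM _ _ (nbhs x) (nbhs_filter x)); last exact: cp.
  exact: (@cvg_cM _ _ (nbhs x) (nbhs_filter x)).
move=> x.
have cl : {for x, continuous (fun y : U => ln (cabs (defect n y) ^+ 2 + dn n))}.
  apply: (@continuous_comp _ _ _ (fun y : U => cabs (defect n y) ^+ 2 + dn n) (@ln R)).
    by apply: cont_addR; [exact: (cabs_sqr_continuous cD)|exact: cst_continuous].
  by apply: continuous_ln; exact: pos.
change {for x, continuous (fun y : U =>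
  8^-1 ^+ n / 2 * ln (cabs (defect n y) ^+ 2 + dn n) - 2^-1 ^+ n)}.
by apply: cont_subR; [apply: cont_mulR; [exact: cst_continuous|]|exact: cst_continuous].
Qed.

(** On a complex line the defect is a polynomial in one variable, so this is
    [circle_avg_ln_sqr_poly]. *)
Lemma potential_submean n (x y : U) (c : R[i]^o) r : 0 < r ->
  potential n (x + c *: y) <= circle_avg (fun t => potential n (x + (c + circ r t) *: y)).
Proof.
move=> r0.
pose lin (v1 v2 : R[i]) : {poly R[i]} := (v1 + c * v2)%:P + v2 *: 'X.
have linE v1 v2 l : (lin v1 v2).[l] = v1 + (c + l) * v2.
  by rewrite hornerD hornerC hornerZ hornerX; ring.
pose q := lin x.2 y.2 ^+ 2 * (root_poly 1 a n \Po lin x.1 y.1) - (root_poly (-1) b n \Po lin x.1 y.1).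
have qE l : q.[l] = defect n (x + (c + l) *: y).
  by rewrite hornerD hornerN hornerM horner_exp !horner_comp !linE.
have cq : continuous (fun t => ln (cabs q.[circ r t] ^+ 2 + dn n)).
  apply: continuous_ln_comp; last by move=> t; rewrite qE pos.
  move=> t; apply: cvgD; last exact: cvg_cst.
  apply: (@cabs_sqr_continuous _ _ (fun t => q.[circ r t])) => {}t.
  apply: (@continuous_comp _ _ _ (circ r) (fun z => q.[z] : R[i]^o)); first exact: circ_continuous.
  exact: horner_continuous.
rewrite (@eq_circle_avg _ _ (fun t => 8^-1 ^+ n / 2 * ln (cabs q.[circ r t] ^+ 2 + dn n) + (- 2^-1 ^+ n))); last first.
  by move=> t; rewrite qE.
rewrite circle_avgD ?circle_avgZ ?circle_avg_cst; [|exact: cq| |exact: cst_continuous]; last first.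
  by move=> t; apply: cvgM; [exact: cvg_cst|exact: cq].
rewrite lerD2r ler_wpM2l ?(ltW (w8_gt0 n)) //.
have := circle_avg_ln_sqr_poly q r0 (expR_gt0 (- (4 * 8 ^+ n)) : 0 < dn n).
by rewrite qE addr0.
Qed.

Let ab1 j : (0 < j)%N -> `|a j| <= 1 /\ `|b j| <= 1.
Proof. by move=> /ab[h1 h2 h3]; split; rewrite ler_norml; apply/andP; split; lra. Qed.

Let pow_le_expR (B : R) n : 0 <= B -> B ^+ n <= expR (n%:R * B).
Proof.
move=> B0; rewrite expRM_natl; apply: lerXn2r; rewrite ?nnegrE ?expR_ge0 //.
by have := expR_ge1Dx B; lra.
Qed.

Lemma potential_eventually_le0 rho : exists N : nat, forall n x, (N <= n)%N ->
  cabs x.1 <= rho -> cabs x.2 <= rho -> potential n x <= 0.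
Proof.
have [B B2 rB] : exists2 B : R, 2 <= B & rho + 1 <= B.
  by exists (`|rho| + 2); [rewrite lerDr|have := ler_norm rho; lra].
have [N hN] := linear_le_pow4 B.
exists N => n x Nn x1 x2.
have B0 : 0 <= B by lra.
have c1 := cabs_ge0 x.1; have c2 := cabs_ge0 x.2.
have pB p0 u : `|p0| <= 1 -> (forall j, (0 < j)%N -> `|u j| <= 1) ->
    cabs (root_poly p0 u n).[x.1] <= B ^+ n.+1.
  move=> h1 h2; apply: le_trans (root_poly_le n x.1 h1 h2) _.
  by apply: lerXn2r; rewrite ?nnegrE; lra.
have hQ : cabs (root_poly 1 a n).[x.1] <= B ^+ n.+1.
  by apply: pB => [|j /ab1[]//]; rewrite normr1.
have hP : cabs (root_poly (-1) b n).[x.1] <= B ^+ n.+1.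
  by apply: pB => [|j /ab1[]//]; rewrite normrN normr1.
have p0 : 0 <= B ^+ n.+1 by rewrite exprn_ge0.
have p1 : 1 <= B ^+ n.+1 by apply: exprn_ege1; apply: le_trans B2; rewrite ler1n.
have hD : cabs (defect n x) <= B ^+ 2 * B ^+ n.+1.
  apply: le_trans (cabsD _ _) _; rewrite cabsN cabsM cabsX.
  by apply: weighted_sum_le => //; rewrite ?cabs_ge0 //= lerBrDr (le_trans _ rB) // lerD2r.
have dn1 : dn n <= 1.
  by rewrite -expR0 ler_expR oppr_le0 mulr_ge0 // exprn_ge0.
(* The defect is at most B^(n+3), and one more factor B absorbs d_n <= 1. The term is then at most
   8^-n (n + 4) B - 2^-n, nonpositive once (n + 4) B <= 4^n. *)
have key : cabs (defect n x) ^+ 2 + dn n <= expR (2 * ((n + 4)%:R * B)).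
  apply: (@le_trans _ _ ((B ^+ (n + 4)) ^+ 2)); last first.
    rewrite expRM_natl; apply: lerXn2r; rewrite ?nnegrE ?expR_ge0 ?exprn_ge0 //.
    exact: pow_le_expR.
  have -> : B ^+ (n + 4) = B * (B ^+ 2 * B ^+ n.+1) by rewrite addn4 -exprD -exprS.
  set X := B ^+ 2 * B ^+ n.+1 in hD *.
  have X1 : 1 <= X by rewrite /X -[leLHS]mulr1 ler_pM // exprn_ege1 // (le_trans _ B2) // ler1n.
  by apply: sqr_shift_le => //; rewrite cabs_ge0.
apply: le_trans (potential_le key) _.
have := hN _ Nn; have p4 : 0 < 4 ^+ n :> R by rewrite exprn_gt0.
have e2 : 2^-1 ^+ n = 8^-1 ^+ n * 4 ^+ n :> R.
  by rewrite -exprMn; congr (_ ^+ _); field.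
have := w8_gt0 n; rewrite subr_le0 e2 => h0 h1.
have -> : 8^-1 ^+ n / 2 * (2 * ((n + 4)%:R * B)) = 8^-1 ^+ n * ((n + 4)%:R * B) by field.
by rewrite ler_wpM2l // exprn_ge0 // invr_ge0.
Qed.

Let f := fK a b.

Lemma defectE n z w : (~` in_plane (cantor_of a b)) z ->
  defect n (z, w) = (root_poly 1 a n).[z] * (w ^+ 2 - Fn a b n z ^+ 2).
Proof.
move=> nz; have zK (t : R) : cantor_of a b t -> z != t%:C.
  by move=> Kt; apply/eqP => zt; apply: nz; exists t.
rewrite /defect /= mulrBr [_ * Fn _ _ _ _ ^+ 2](_ : _ = (root_poly (-1) b n).[z]) 1?mulrC //.
rewrite mulrC (Fn_prod a0 b0 ab disj) root_poly_sb //.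
  exact: zK (cantor_of_bounds a0 b0 ab).2.
by move=> j j0; exact: zK (cantor_of_endpoints a0 b0 ab disj j0).1.
Qed.

Let sqrB_le z n d rho M : reg a b d rho z -> cabs (Fn a b n z) <= M ->
  cabs (Fn a b n z - f z) <= M * (b n.+1 - a n.+1) ->
  cabs (f z ^+ 2 - Fn a b n z ^+ 2) <= 4 * M ^+ 2 * (b n.+1 - a n.+1).
Proof.
move=> hz h1 h2; set l := b n.+1 - a n.+1 in h2 *.
have l2 : 0 <= l <= 2.
  by have [k1 k2 k3] := ab (ltn0Sn n); rewrite /l; apply/andP; split; lra.
case/andP: l2 => l0 l2.
have M0 : 0 <= M by apply: le_trans h1; exact: cabs_ge0.
have -> : f z ^+ 2 - Fn a b n z ^+ 2 = - (Fn a b n z - f z) * (Fn a b n z *+ 2 - (Fn a b n z - f z)).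
  by ring.
rewrite cabsM cabsN.
have h3 : cabs (Fn a b n z *+ 2 - (Fn a b n z - f z)) <= 4 * M.
  apply: le_trans (cabsD _ _) _; rewrite cabsN mulr2n.
  have := cabsD (Fn a b n z) (Fn a b n z); have : M * l <= M * 2 by rewrite ler_wpM2l.
  lra.
apply: (@le_trans _ _ (M * l * (4 * M))); first by apply: ler_pM; rewrite ?cabs_ge0.
by have -> : M * l * (4 * M) = 4 * M ^+ 2 * l by ring.
Qed.

Lemma potential_graph z : (~` in_plane (cantor_of a b)) z ->
  exists N, forall n, (N <= n)%N -> potential n (z, f z) <= -1.
Proof.
move=> nz; have [d [rho [r [d0 r0 hr]]]] := notin_cantor_reg nz.
have hz : reg a b d rho z by apply: hr; rewrite subrr cabs0 ltW.
have [n0 [M [M0 small hM]]] := fK_approx a0 b0 ab len disj rho d0.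
have c0 := cabs_ge0 z.
have [B [B1 B2 B3]] : exists B : R, [/\ 1 <= B, cabs z + 1 <= B & 4 * M ^+ 2 <= B].
  by exists (cabs z + 1 + 4 * M ^+ 2); have m0 := sqr_ge0 M; split; lra.
have [N hN] := linear_le_pow4 B.
exists (maxn n0 N) => n; rewrite geq_max => /andP[n1 n2].
have [k1 k2] := hM _ hz _ n1.
have k3 := sqrB_le hz k1 k2.
have hQ : cabs (root_poly 1 a n).[z] <= B ^+ n.+1.
  apply: le_trans (root_poly_le n z _ _) _; first by rewrite normr1.
    by move=> j /ab1[].
  by apply: lerXn2r; rewrite ?nnegrE //; lra.
have p8 : 4 ^+ n <= 8 ^+ n :> R by apply: lerXn2r; rewrite ?nnegrE // ler_nat.
have p1 : 1 <= 8 ^+ n :> R by apply: exprn_ege1; rewrite ler1n.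
set l := b n.+1 - a n.+1 in k3.
have l0 : 0 <= l by have [_ h _] := ab (ltn0Sn n); rewrite /l; lra.
(* The square in [tiny] and A >= 16 give 32. This beats the growth exp((n + 4) B) of the polynomial
   factors and leaves exp(-2 8^n), whose square is d_n. *)
have hl : l <= expR (- (32 * 8 ^+ n)).
  apply: le_trans (tiny n) _; rewrite -expRM_natl ler_expR.
  have : 16 * 8 ^+ n <= A * 8 ^+ n by rewrite ler_wpM2r //; lra.
  lra.
have hD : cabs (defect n (z, f z)) <= B ^+ (n + 4) * l.
  rewrite defectE // cabsM; apply: (@le_trans _ _ (B ^+ n.+1 * (B * l))).
    apply: ler_pM; rewrite ?cabs_ge0 //; apply: le_trans k3 _.
    by rewrite ler_wpM2r.
  rewrite mulrA -exprSr ler_wpM2r //; apply: ler_weXn2l => //; by rewrite addn4 !ltnS; do 2 apply: leqW.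
have hE : B ^+ (n + 4) * l <= expR (- (2 * 8 ^+ n)).
  apply: (@le_trans _ _ (expR ((n + 4)%:R * B) * expR (- (32 * 8 ^+ n)))).
    by apply: ler_pM => //; [rewrite exprn_ge0 //; lra|apply: pow_le_expR; lra].
  by rewrite -expRD ler_expR; have := hN _ n2; lra.
(* Both summands are at most d_n and 2 <= exp 1; the term is therefore at most 8^-n / 2 - 2 -
   2^-n. *)
have key : cabs (defect n (z, f z)) ^+ 2 + dn n <= expR (1 - 4 * 8 ^+ n).
  have h1 : cabs (defect n (z, f z)) ^+ 2 <= dn n.
    apply: (@le_trans _ _ (expR (- (2 * 8 ^+ n)) ^+ 2)).
      by apply: lerXn2r; rewrite ?nnegrE ?cabs_ge0 ?expR_ge0 // (le_trans hD).
    by rewrite -expRM_natl /dn ler_expR; lra.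
  rewrite expRD -/(dn n); have := expR_ge1Dx (1 : R); have := expR_gt0 (- (4 * 8 ^+ n) : R).
  rewrite -/(dn n) => h2 h3; have : 2 * dn n <= expR 1 * dn n by rewrite ler_wpM2r ?(ltW h2) //; lra.
  lra.
apply: le_trans (potential_le key) _.
have e1 : 8^-1 ^+ n * 8 ^+ n = 1 :> R by rewrite -exprMn mulVf ?expr1n // pnatr_eq0.
have -> : 8^-1 ^+ n / 2 * (1 - 4 * 8 ^+ n) = 8^-1 ^+ n / 2 - 2 * (8^-1 ^+ n * 8 ^+ n) :> R by field.
rewrite e1; have : 8^-1 ^+ n <= 1 :> R by rewrite exprn_ile1 ?invr_ge0 // invf_le1 // ler1n.
have : 0 <= 2^-1 ^+ n :> R by rewrite exprn_ge0 // invr_ge0.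
lra.
Qed.

(** At a fixed point off both graphs the defect decays at most geometrically in n, so its logarithm
    is at least linear in - n and the weights 8^-n make the negative parts summable. *)
Lemma potential_off_graph z w : (~` in_plane (cantor_of a b)) z -> w ^+ 2 != f z ^+ 2 ->
  exists m, forall k, m <= \sum_(n < k) potential n (z, w).
Proof.
move=> nz wf; have [d [rho [r [d0 r0 hr]]]] := notin_cantor_reg nz.
have hz : reg a b d rho z by apply: hr; rewrite subrr cabs0 ltW.
have [n0 [M [M0 small hM]]] := fK_approx a0 b0 ab len disj rho d0.
set kap := cabs (w ^+ 2 - f z ^+ 2) / 2.
have kap0 : 0 < kap by rewrite divr_gt0 // cabs_gt0 subr_eq0.
have M2 : 0 < 4 * M ^+ 2 by rewrite mulr_gt0 // exprn_gt0.
have [N _ hN] := @halving_small _ (fun n => b n.+1 - a n.+1) 0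
  (fun n _ => len (ltn0Sn n)) _ (divr_gt0 kap0 M2).
(* Powers of 1 / D bound Q_n(z) from below through the distance d to the Cantor set, and w^2 -
   f_n(z)^2 through kap; D >= 1 allows the exponent to be rounded up to n + 4. *)
have [D [D1 Dd' Dk]] : exists D : R, [/\ 1 <= D, d^-1 <= D & kap^-1 <= D].
  have id0 : 0 < d^-1 by rewrite invr_gt0.
  have ik0 : 0 < kap^-1 by rewrite invr_gt0.
  by exists (d^-1 + kap^-1 + 1); split; lra.
have D0 : 0 < D by lra.
apply: (@partial_sum_lower _ (fun n => potential n (z, w)) (4 * D + 1) (maxn n0 N)); first by lra.
move=> n; rewrite geq_max => /andP[n1 n2].
have [k1 k2] := hM _ hz _ n1.
have k3 : cabs (f z ^+ 2 - Fn a b n z ^+ 2) <= kap.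
  apply: le_trans (sqrB_le hz k1 k2) _.
  by rewrite mulrC -ler_pdivlMr // hN.
have k4 : kap <= cabs (w ^+ 2 - Fn a b n z ^+ 2).
  have := cabsD (w ^+ 2 - Fn a b n z ^+ 2) (- (f z ^+ 2 - Fn a b n z ^+ 2)).
  have -> : w ^+ 2 - Fn a b n z ^+ 2 + - (f z ^+ 2 - Fn a b n z ^+ 2) = w ^+ 2 - f z ^+ 2 by ring.
  have -> : cabs (w ^+ 2 - f z ^+ 2) = 2 * kap by rewrite /kap mulrC divfK // pnatr_eq0.
  by rewrite cabsN; lra.
have inv_le (x : R) : 0 < x -> x^-1 <= D -> D^-1 <= x.
  by move=> x0 h; rewrite -[leRHS]invrK lef_pV2 ?posrE ?invr_gt0.
have hQ : D^-1 ^+ n.+1 <= cabs (root_poly 1 a n).[z].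
  have Dd : D^-1 <= d by exact: inv_le.
  apply: root_poly_ge; first by rewrite invr_ge0 ltW.
    by apply: le_trans Dd _; apply: hz.2; exact: (cantor_of_bounds a0 b0 ab).2.
  by move=> j j0; apply: le_trans Dd _; apply: hz.2; exact: (cantor_of_endpoints a0 b0 ab disj j0).1.
have hD : D^-1 ^+ (n + 4) <= cabs (defect n (z, w)).
  rewrite defectE // cabsM; apply: (@le_trans _ _ (D^-1 ^+ n.+1 * D^-1)).
    by rewrite -exprSr; apply: ler_wiXn2l; rewrite ?invr_ge0 ?invf_le1 ?(ltW D0) // addn4; do 2 apply: leqW.
  apply: ler_pM; rewrite ?exprn_ge0 ?invr_ge0 ?(ltW D0) //.
  by apply: le_trans k4; exact: inv_le.
have key : expR (- (2 * ((n + 4)%:R * D))) <= cabs (defect n (z, w)) ^+ 2 + dn n.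
  apply: (@le_trans _ _ ((D^-1 ^+ (n + 4)) ^+ 2)); last first.
    rewrite -[leLHS]addr0; apply: lerD; last exact: expR_ge0.
    by apply: lerXn2r; rewrite ?nnegrE ?cabs_ge0 ?exprn_ge0 ?invr_ge0 ?(ltW D0).
  rewrite expRN !exprVn lef_pV2 ?posrE ?expR_gt0 ?exprn_gt0 //.
  rewrite expRM_natl; apply: lerXn2r; rewrite ?nnegrE ?expR_ge0 ?exprn_ge0 ?(ltW D0) //.
  by apply: pow_le_expR; exact: ltW.
apply: le_trans (potential_ge key).
have n4 := add4_le_pow2 R n.
have q8 : 8^-1 ^+ n * 2 ^+ n <= 2^-1 ^+ n :> R.
  rewrite -exprMn; apply: lerXn2r; rewrite ?nnegrE ?mulr_ge0 ?invr_ge0 //; lra.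
have -> : 8^-1 ^+ n / 2 * - (2 * ((n + 4)%:R * D)) = - (D * (8^-1 ^+ n * (n + 4)%:R)) by field.
have e8 : 0 <= 8^-1 ^+ n :> R by rewrite exprn_ge0 // invr_ge0.
have h1 : 8^-1 ^+ n * (n + 4)%:R <= 4 * 2^-1 ^+ n :> R.
  apply: le_trans (ler_wpM2l e8 n4) _; rewrite mulrCA; lra.
have := ler_wpM2l (ltW D0) h1; lra.
Qed.

Lemma hull_sub_graphs z w : (~` in_plane (cantor_of a b)) z ->
  pluripolar_hull setT (graph_on (~` in_plane (cantor_of a b)) f : set U) (z, w) ->
  w = f z \/ w = - f z.
Proof.
move=> nz [_ hull]; apply: contrapT => no.
have wf : w ^+ 2 != f z ^+ 2.
  by apply/negP; rewrite eqf_sqr => /orP[] /eqP wE; apply: no; [left|right].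
have [m hm] := potential_off_graph nz wf.

have := series_psh_gtNy potential_eventually_le0 hm.
move/eqP; apply; apply: hull.
  exact: (series_psh_psh potential_continuous potential_submean potential_eventually_le0).
move=> [z' w'] [/= nz' ->]; have [N hN] := potential_graph nz'.
exact: series_psh_Ny hN.
Qed.

End potential.

Theorem theorem3p6 (R : realType) :
  exists (K : set R) (a b : nat -> R) (f : R[i]^o -> R[i]^o),
    [/\ cantor_type_set K,
        cantor_gaps K a b,
        a 0%N = -1 /\ b 0%N = 1,
        is_f_K K a b f &
        pluripolar_hull setT (graph_on (~` in_plane K) f)
            `&` ((~` in_plane K) `*` setT)
        = graph_on (~` in_plane K) f
            `|` graph_on (~` in_plane K) (fun z => - f z)].
Proof.
have l12 : 0 < ln (12 / 11) :> R by rewrite ln_gt0 // ltr_pdivlMr // mul1r ltr_nat.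
have l0 : 0 <= ln 3 * ln 64 :> R by rewrite mulr_ge0 // ln_ge0 // ler1n.
(* The summand 16 serves the radii of the discs and the decay of the defect; the other makes 2 ln 3
   ln 64 / A at most half of ln (12 / 11). *)
pose A : R := 16 + 4 * (ln 3 * ln 64) / ln (12 / 11).
have A16 : 16 <= A by rewrite lerDl; apply: divr_ge0; [exact: mulr_ge0|exact: ltW].
have A0 : 0 < A by apply: lt_le_trans A16.
have Aln : 2 * (ln 3 * ln 64 / A) <= ln (12 / 11) / 2.
  have h : 4 * (ln 3 * ln 64) <= ln (12 / 11) * A.
    rewrite /A mulrDr [ln _ * (_ / _)]mulrC divfK ?gt_eqF // lerDr.
    by rewrite mulr_ge0 // ltW.
  rewrite mulrA ler_pdivrMr //; lra.
(* Gaps are numbered from 1 and the exponents 8^j from 0, whence the predecessor; the square leaves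
   room for discs whose radius is the square root of the length bound. *)
have [a [b [[a0 b0] abe len disj dense]]] :=
  @cantor_gaps_exist R (fun j => expR (- (A * 8 ^+ j.-1)) ^+ 2) (fun j => exprn_gt0 2 (expR_gt0 _)).
have ab j : (0 < j)%N -> [/\ -1 < a j, a j < b j & b j < 1] by move=> /abe[].
have tiny j : b j.+1 - a j.+1 <= expR (- (A * 8 ^+ j)) ^+ 2 by have [] := abe j.+1 isT.
exists (cantor_of a b), a, b, (fK a b); split => //.
- exact: (cantor_type_cantor_of a0 b0 ab).
- exact: (cantor_gaps_cantor_of a0 b0 ab).
- exact: (fK_is_f_K a0 b0 ab len disj).
apply/seteqP; split=> [[z w] [hull [/= nz _]]|[z w]].
  by have [->|->] := hull_sub_graphs a0 b0 ab len disj A16 tiny nz hull; [left|right].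
case=> -[/= nz ->]; split=> //; split=> // h psh_h pole; first by apply: pole.
apply: (fK_neg_pole a0 b0 ab len disj A16 Aln tiny psh_h) => // z' nz'.
exact: pole.
Qed.
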